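(* Let $\mathcal{H}=(\mathcal{H},\alpha,\beta,\cdot,\Delta,\epsilon)$ be a Hopf algebroid over a unital associative $\mathbb{K}$-algebra $R$. Put $W^n=\mathcal{H}^{\otimes_R n}$ (so $W^0=R$) and $W=\bigoplus_{n\ge 0}\mathcal{H}^{\otimes_R n}[-n]$, so that elements of $\mathcal{H}^{\otimes_R n}$ have degree $n$. Then $$B_\infty(\mathcal{H}):=\bigl(W,\ \delta_{\mathcal{H}},\ \cup,\ \{\mu_k^{\Delta}\}_{k\ge 0}\bigr)$$ is a brace $B_\infty$ algebra, where: - for $x_1\otimes_R\cdots\otimes_R x_n\in W^n$, $$\delta_{\mathcal{H}}(x_1\otimes_R\cdots\otimes_R x_n)=x_1\otimes_R\cdots\otimes_R x_n\otimes_R 1-\sum_{i=1}^n(-1)^{n-i}x_1\otimes_R\cdots\otimes_R\Delta(x_i)\otimes_R\cdots\otimes_R x_n-(-1)^n\,1\otimes_R x_1\otimes_R\cdots\otimes_R x_n ;$$ - for $x\in W^n$, $y\in W^m$, $x\cup y=(-1)^{nm}x\otimes_R y$; - for $x=x_1\otimes_R\cdots\otimes_R x_p\in W^p$ and $y_i\in W^{q_i}$ ($1\le i\le k$): if $p\ge k$, $$\mu_k^{\Delta}(x\otimes y_1[1]\otimes\cdots\otimes y_k[1])=x\{y_1,\dots,y_k\}=\sum_{1\le j_1<\cdots<j_k\le p}(-1)^{\sum_{l=1}^k(j_l-l+q_1+\cdots+q_{l-1})(q_l-1)}\;x_1\otimes_R\cdots\otimes_R\bigl((\Delta^{q_1-1}x_{j_1})\cdot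 y_1\bigr)\otimes_R\cdots\otimes_R\bigl((\Delta^{q_k-1}x_{j_k})\cdot y_k\bigr)\otimes_R\cdots\otimes_R x_p ,$$ and if $p<k$, $x\{y_1,\dots,y_k\}=0$.
   Context: $\mathbb{K}$ is a field of characteristic zero, $\otimes=\otimes_{\mathbb{K}}$; for graded $W$, $(W[k])^i=W^{i+k}$. **Hopf algebroid** over $R$ (in the sense of Xu): $(\mathcal{H},\alpha,\beta,\cdot,\Delta,\epsilon)$ where (1) $(\mathcal{H},\cdot)$ is a unital associative $\mathbb{K}$-algebra; (2) $\alpha:R\to\mathcal{H}$ is an algebra homomorphism and $\beta:R\to\mathcal{H}$ an algebra anti-homomorphism with $\alpha(a)\beta(b)=\beta(b)\alpha(a)$; $\mathcal{H}$ is an $(R,R)$-bimodule via $a\cdot x=\alpha(a)x$, $x\cdot b=\beta(b)x$; (3) $\Delta:\mathcal{H}\to\mathcal{H}\otimes_R\mathcal{H}$ is an $(R,R)$-bimodule map with $\Delta(1)=1\otimes_R1$ and $(\Delta\otimes_R\mathrm{id})\Delta=(\mathrm{id}\otimes_R\Delta)\Delta$; (4) $\Delta(x)\cdot(\beta(a)\otimes1-1\otimes\alpha(a))=0$ for all $x\in\mathcal{H},a\in R$ (right multiplication by $\mathcal{H}\otimes\mathcal{H}$), and $\Delta(x_1x_2)=\Delta(x_1)\cdot\Delta(x_2)$ (well defined by the previous condition); (5) $\epsilon:\mathcal{H}\to R$ is an $(R,R)$-bimodule map with $\epsilon(1)=1$ and $(\epsilon\otimes_R\mathrm{id})\Delta=(\mathrm{id}\otimes_R\epsilon)\Delta=\mathrm{id}$;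 (6) $\ker\epsilon$ is a left ideal of $\mathcal{H}$. $R$ is a left $\mathcal{H}$-module via $x\rhd a=\epsilon(x\alpha(a))=\epsilon(x\beta(a))$. $\mathcal{H}^{\otimes_R n}$ is the $n$-fold tensor product over $R$ ($\mathcal{H}^{\otimes_R0}=R$); $\mathcal{H}^{\otimes n}$ acts on it on the right by $(h_1\otimes_R\cdots\otimes_R h_n)\cdot(u_1\otimes\cdots\otimes u_n)=h_1u_1\otimes_R\cdots\otimes_R h_nu_n$. Set $\Delta^0=\mathrm{id}$, $\Delta^1=\Delta$, $\Delta^n=(\Delta^{n-1}\otimes_R\mathrm{id})\Delta$. For $h\in\mathcal{H}$ and $u\in\mathcal{H}^{\otimes_Rn}$, $n\ge1$, $(\Delta^{n-1}h)\cdot u$ denotes $\Delta^{n-1}(h)\cdot\tilde u$ for any lift $\tilde u\in\mathcal{H}^{\otimes n}$ of $u$ (independent of the lift); for $n=0$, $u\in R$, $(\Delta^{-1}h)\cdot u:=h\rhd u\in R$. Factors lying in $R$ are absorbed via $R\otimes_R\mathcal{H}\simeq\mathcal{H}\simeq\mathcal{H}\otimes_RR$. **Brace $B_\infty$ algebra**: a graded space $W$ with a degree 1 map $d:W\to W[1]$, a degree 0 product $\cdot:W\otimes W\to W$, and degree 0 maps $\mu_k:W\otimes(W[1])^{\otimes k}\to W$ ($k\ge0$), written $x\{x_1,\dots,x_k\}=\mu_k(x\otimes x_1[1]\otimes\cdots\otimes x_k[1])$, such that for homogeneous elements: (i) $x\{\}=x$; (ii) $x\{y_1,\dots,y_n\}\{z_1,\dots,z_m\}=\sum\pm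 x\{z_1,\dots,z_{i_1},y_1\{z_{i_1+1},\dots,z_{i_1+r_1}\},\dots,z_{i_n},y_n\{z_{i_n+1},\dots,z_{i_n+r_n}\},\dots,z_m\}$, with sign $(-1)^{\sum_{p=1}^n(|y_p|+1)\sum_{q=1}^{i_p}(|z_q|+1)}$, summed over non-negative integers with $i_1+r_1\le i_2,\dots,i_{n-1}+r_{n-1}\le i_n$, $i_n+r_n\le m$; (iii) $(W,d,\cdot)$ is a dg associative algebra (unit not required); (iv) $(x_1\cdot x_2)\{y_1,\dots,y_n\}=\sum_{k=0}^n(-1)^{|x_2|\sum_{p=1}^k(|y_p|+1)}x_1\{y_1,\dots,y_k\}\cdot x_2\{y_{k+1},\dots,y_n\}$; (v) $d(x\{x_1,\dots,x_n\})-(dx)\{x_1,\dots,x_n\}-\sum_{i=1}^n(-1)^{|x|+1+\sum_{j<i}(|x_j|+1)}x\{x_1,\dots,dx_i,\dots,x_n\}=(-1)^{|x|(|x_1|+1)}x_1\cdot(x\{x_2,\dots,x_n\})-\sum_{i=1}^{n-1}(-1)^{|x|+1+\sum_{j\le i}(|x_j|+1)}x\{x_1,\dots,x_i\cdot x_{i+1},\dots,x_n\}+(-1)^{|x|+1+\sum_{j\le n-1}(|x_j|+1)}(x\{x_1,\dots,x_{n-1}\})\cdot x_n$ (for $n\ge1$). *)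

(* Defs.v *)
From HB Require Import structures.
From mathcomp Require Import all_boot all_order all_algebra generic_quotient.
From mathcomp Require Import ring_quotient boolp freeg.

Set Implicit Arguments.
Unset Strict Implicit.
Unset Printing Implicit Defensive.

Import GRing.Theory.
Local Open Scope ring_scope.
Local Open Scope quotient_scope.

(* The quotient of [V] by the linear span of [S]; span membership is made
   decidable by classical logic. *)
Section LinearQuotient.
Variables (K : fieldType) (V : lmodType K) (S : V -> Prop).

Definition lspan : {pred V} := fun v =>
  `[< exists2 s : seq (K * V), (forall p, p \in s -> S p.2) &
        v = \sum_(p <- s) p.1 *: p.2 >].

Lemma lspanP v :
  reflect (exists2 s : seq (K * V), (forall p, p \in s -> S p.2) &
             v = \sum_(p <- s) p.1 *: p.2) (v \in lspan).
Proof. exact: asboolP. Qed.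

Lemma lspanZ a v : v \in lspan -> a *: v \in lspan.
Proof.
case/lspanP=> s Ss ->; apply/lspanP.
exists [seq (a * p.1, p.2) | p <- s].
  by move=> p /mapP[p' /Ss Sp' ->].
by rewrite big_map scaler_sumr; apply: eq_bigr => p _; rewrite scalerA.
Qed.

Lemma lspan_zmod_closed : zmod_closed lspan.
Proof.
split=> [|u v].
  by apply/lspanP; exists [::] => //; rewrite big_nil.
move=> /lspanP[s Ss ->] /(lspanZ (-1)) /lspanP[s' Ss' eq_s'].
apply/lspanP; exists (s ++ s').
  by move=> p; rewrite mem_cat => /orP[/Ss|/Ss'].
by rewrite big_cat /= -eq_s' scaleN1r.
Qed.

HB.instance Definition _ := GRing.isZmodClosed.Build V lspan lspan_zmod_closed.

Lemma mem_lspan v : S v -> v \in lspan.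
Proof.
move=> Sv; apply/lspanP; exists [:: (1, v)]; last by rewrite big_seq1 scale1r.
by move=> p; rewrite inE => /eqP->.
Qed.

Definition lquot := (@Quotient.quot V lspan).
HB.instance Definition _ := GRing.Zmodule.on lquot.
HB.instance Definition _ := Quotient.on lquot.

Definition lquot_scale (a : K) (x : lquot) : lquot :=
  \pi_lquot (a *: repr x).

Lemma lquot_pi_eq (u v : V) :
  (\pi_lquot u == \pi_lquot v) = (u - v \in lspan).
Proof. exact/esym/Quotient.idealrBE. Qed.

Lemma lquot_piD (u v : V) : \pi_lquot (u + v) = \pi_lquot u + \pi_lquot v.
Proof. exact: (@pi_addr _ _ _ _ _ (@Quotient.quot V lspan)). Qed.

Lemma lquot_pi_scale a v :
  lquot_scale a (\pi_lquot v) = \pi_lquot (a *: v).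
Proof.
apply/eqP; rewrite /lquot_scale lquot_pi_eq -scalerBr.
by apply: lspanZ; rewrite -lquot_pi_eq reprK.
Qed.

Lemma lquot_scaleA a b x :
  lquot_scale a (lquot_scale b x) = lquot_scale (a * b) x.
Proof.
by elim/quotW: x => x; rewrite (lquot_pi_scale b) !lquot_pi_scale scalerA.
Qed.

Lemma lquot_scale1 x : lquot_scale 1 x = x.
Proof. by elim/quotW: x => x; rewrite lquot_pi_scale scale1r. Qed.

Lemma lquot_scaleDr a : {morph lquot_scale a : x y / x + y}.
Proof.
elim/quotW=> x; elim/quotW=> y; rewrite -lquot_piD !lquot_pi_scale.
by rewrite scalerDr lquot_piD.
Qed.

Lemma lquot_scaleDl x : {morph lquot_scale^~ x : a b / a + b}.
Proof.
move=> a b; elim/quotW: x => x; rewrite !lquot_pi_scale.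
by rewrite scalerDl lquot_piD.
Qed.

HB.instance Definition _ := GRing.Zmodule_isLmodule.Build K lquot
  lquot_scaleA lquot_scale1 lquot_scaleDr lquot_scaleDl.

Lemma lquot_piZ a v : \pi_lquot (a *: v) = a *: \pi_lquot v.
Proof. by rewrite -lquot_pi_scale. Qed.

End LinearQuotient.

Section DirectSum.
Variables (K : fieldType) (T : nat -> lmodType K).

Definition finitely_supported (f : forall n, T n) :=
  exists N, forall n, (N <= n)%N -> f n = 0.

Record dsum := DSum {
  dcoord :> forall n, T n;
  dcoord_finite : finitely_supported dcoord }.

Lemma dsumP (u v : dsum) : (forall n, u n = v n) -> u = v.
Proof.
case: u v => [f pf] [g pg] /= fg.
have eq_fg : f = g by apply: functional_extensionality_dep.
by case: g / eq_fg pg {fg} => pg; congr DSum; apply: Prop_irrelevance.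
Qed.

HB.instance Definition _ := gen_eqMixin dsum.
HB.instance Definition _ := gen_choiceMixin dsum.

Lemma dsum0_finite : finitely_supported (fun=> 0).
Proof. by exists 0%N. Qed.

Lemma dsumD_finite (u v : dsum) : finitely_supported (fun n => u n + v n).
Proof.
have [[N uN] [M vM]] := (dcoord_finite u, dcoord_finite v).
exists (maxn N M) => n; rewrite geq_max => /andP[/uN-> /vM->].
exact: addr0.
Qed.

Lemma dsumN_finite (u : dsum) : finitely_supported (fun n => - u n).
Proof.
by have [N uN] := dcoord_finite u; exists N => n /uN->; rewrite oppr0.
Qed.

Lemma dsumZ_finite (a : K) (u : dsum) :
  finitely_supported (fun n => a *: u n).
Proof.
by have [N uN] := dcoord_finite u; exists N => n /uN->; rewrite scaler0.
Qed.

Definition dsum0 := DSum dsum0_finite.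
Definition dsumD u v := DSum (dsumD_finite u v).
Definition dsumN u := DSum (dsumN_finite u).
Definition dsumZ a u := DSum (dsumZ_finite a u).

Lemma dsumDA : associative dsumD.
Proof. by move=> u v w; apply: dsumP => n /=; rewrite addrA. Qed.
Lemma dsumDC : commutative dsumD.
Proof. by move=> u v; apply: dsumP => n /=; rewrite addrC. Qed.
Lemma dsum0D : left_id dsum0 dsumD.
Proof. by move=> u; apply: dsumP => n /=; rewrite add0r. Qed.
Lemma dsumND : left_inverse dsum0 dsumN dsumD.
Proof. by move=> u; apply: dsumP => n /=; rewrite addNr. Qed.

HB.instance Definition _ :=
  GRing.isZmodule.Build dsum dsumDA dsumDC dsum0D dsumND.

Lemma dsumZA a b u : dsumZ a (dsumZ b u) = dsumZ (a * b) u.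
Proof. by apply: dsumP => n /=; rewrite scalerA. Qed.
Lemma dsum1Z u : dsumZ 1 u = u.
Proof. by apply: dsumP => n /=; rewrite scale1r. Qed.
Lemma dsumZDr a : {morph dsumZ a : u v / u + v}.
Proof. by move=> u v; apply: dsumP => n /=; rewrite scalerDr. Qed.
Lemma dsumZDl u : {morph dsumZ^~ u : a b / a + b}.
Proof. by move=> a b; apply: dsumP => n /=; rewrite scalerDl. Qed.

HB.instance Definition _ := GRing.Zmodule_isLmodule.Build K dsum
  dsumZA dsum1Z dsumZDr dsumZDl.

Lemma dinj_finite n (x : T n) :
  finitely_supported (dfwith (fun k => 0 : T k) x).
Proof.
by exists n.+1 => m ltnm; rewrite dfwith_out // neq_ltn ltnm.
Qed.

Definition dinj n (x : T n) : dsum := DSum (dinj_finite x).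

(* [T n] sits in degree [n]; negative degrees contain only 0. *)
Definition dsum_homog (i : int) (w : dsum) : Prop :=
  forall n : nat, n%:Z != i -> w n = 0.

End DirectSum.

Section BraceAlgebra.
Variables (K : fieldType) (W : lmodType K).

(* A graded space is a space [W] with subspaces [gr i] (the elements of degree
   [i]) whose internal direct sum is [W].  Keeping all degrees in one space
   avoids transports along equalities of degrees. *)
Record is_grading (gr : int -> W -> Prop) : Prop := IsGrading {
  gr_zero : forall i, gr i 0;
  gr_linear : forall i (a : K) u v, gr i u -> gr i v -> gr i (a *: u + v);
  gr_generate : forall w, exists (s : seq int) (h : int -> W),
    (forall i, gr i (h i)) /\ w = \sum_(i <- s) h i;
  gr_independent : forall (s : seq int) (h : int -> W), uniq s ->
    (forall i, gr i (h i)) -> \sum_(i <- s) h i = 0 ->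
    forall i, i \in s -> h i = 0 }.

Definition has_degrees (gr : int -> W -> Prop) (es : seq int) (ys : seq W) :=
  size es = size ys /\
  forall i, (i < size ys)%N -> gr (nth 0 es i) (nth 0 ys i).

Definition sgn (z : int) : K := (-1) ^ z.

(* |y_1| + 1 + ... + |y_k| + 1.  The parity is that of the total degree of
   y_1[1], ..., y_k[1]. *)
Definition shifted_deg (es : seq int) (k : nat) : int :=
  \sum_(i < k) (nth 0 es i + 1).

(* [ir] lists the pairs (i_p, r_p); the condition says
   pos <= i_1, i_1 + r_1 <= i_2, ..., i_n + r_n <= m. *)
Fixpoint nested (m pos : nat) (ir : seq (nat * nat)) : bool :=
  if ir is (i, r) :: ir' then (pos <= i)%N && nested m (i + r) ir'
  else (pos <= m)%N.

(* The list z_{pos+1}, ..., z_{i_1}, y_1{z_{i_1+1}, ..., z_{i_1+r_1}}, ...,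
   y_n{z_{i_n+1}, ..., z_{i_n+r_n}}, ..., z_m. *)
Fixpoint insert_braces (mu : W -> seq W -> W) (zs : seq W) (pos : nat)
    (ys : seq W) (ir : seq (nat * nat)) : seq W :=
  match ys, ir with
  | y :: ys', (i, r) :: ir' =>
      take (i - pos) (drop pos zs) ++
      mu y (take r (drop i zs)) :: insert_braces mu zs (i + r) ys' ir'
  | _, _ => drop pos zs
  end.

(* [mu x [:: x_1; ...; x_k]] is x{x_1, ..., x_k}; the family (mu_k) of
   multilinear maps is given by the restrictions of [mu] to lists of size k.
   Elements of lists are numbered from 0 here. *)
Record brace_Binfty_algebra (gr : int -> W -> Prop)
    (d : W -> W) (cup : W -> W -> W) (mu : W -> seq W -> W) : Prop :=
  BraceBinftyAlgebra {
  brace_grading : is_grading gr;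

  d_linear : linear d;
  d_degree : forall i x, gr i x -> gr (i + 1) (d x);

  cup_linearl : forall y, linear (cup^~ y);
  cup_linearr : forall x, linear (cup x);
  cup_degree : forall i j x y, gr i x -> gr j y -> gr (i + j) (cup x y);

  mu_linear : forall ys, linear (mu^~ ys);
  mu_multilinear : forall x ys1 ys2, linear (fun y => mu x (ys1 ++ y :: ys2));
  mu_degree : forall i x es ys, gr i x -> has_degrees gr es ys ->
    gr (i + \sum_(e <- es) (e - 1)) (mu x ys);

  brace_nil : forall x, mu x [::] = x;

  brace_brace : forall dx x es ys fs zs,
    gr dx x -> has_degrees gr es ys -> has_degrees gr fs zs ->
    let n := size ys in let m := size zs in
    mu (mu x ys) zs =
    \sum_(ir : n.-tuple ('I_m.+1 * 'I_m.+1)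
           | nested m 0 [seq (nat_of_ord p.1, nat_of_ord p.2) | p <- ir])
      sgn (\sum_(p < n) (nth 0 es p + 1) * shifted_deg fs (tnth ir p).1) *:
      mu x (insert_braces mu zs 0 ys
              [seq (nat_of_ord p.1, nat_of_ord p.2) | p <- ir]);

  d_square : forall x, d (d x) = 0;
  d_leibniz : forall i j x y, gr i x -> gr j y ->
    d (cup x y) = cup (d x) y + sgn i *: cup x (d y);
  cup_assoc : associative cup;

  brace_cup : forall i1 x1 i2 x2 es ys,
    gr i1 x1 -> gr i2 x2 -> has_degrees gr es ys ->
    mu (cup x1 x2) ys =
    \sum_(k < (size ys).+1)
      sgn (i2 * shifted_deg es k) *:
      cup (mu x1 (take k ys)) (mu x2 (drop k ys));

  brace_d : forall dx x es ys,
    gr dx x -> has_degrees gr es ys -> (0 < size ys)%N ->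
    let n := size ys in
    d (mu x ys) - mu (d x) ys
      - \sum_(i < n) sgn (dx + 1 + shifted_deg es i) *:
          mu x (take i ys ++ d (nth 0 ys i) :: drop i.+1 ys)
    = sgn (dx * (nth 0 es 0 + 1)) *: cup (nth 0 ys 0) (mu x (behead ys))
      - \sum_(i < n.-1) sgn (dx + 1 + shifted_deg es i.+1) *:
          mu x (take i ys ++ cup (nth 0 ys i) (nth 0 ys i.+1) :: drop i.+2 ys)
      + sgn (dx + 1 + shifted_deg es n.-1) *:
          cup (mu x (take n.-1 ys)) (nth 0 ys n.-1) }.

End BraceAlgebra.

Section TensorPowers.
Variables (K : fieldType) (R H : algType K) (alpha beta : R -> H).

Definition upd n (v : 'I_n -> H) (i : 'I_n) (a : H) : 'I_n -> H :=
  fun j => if j == i then a else v j.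

Definition free_word n (v : 'I_n -> H) : {freeg {ffun 'I_n -> H} / K} :=
  << finfun v >>.

Inductive tensor_rel n : {freeg {ffun 'I_n -> H} / K} -> Prop :=
| tensor_rel_linear (v : 'I_n -> H) i (c : K) (a b : H) :
    tensor_rel (free_word (upd v i (c *: a + b))
      - (c *: free_word (upd v i a) + free_word (upd v i b)))
| tensor_rel_balanced (v : 'I_n -> H) (i j : 'I_n) (r : R) :
    j = i.+1 :> nat ->
    tensor_rel (free_word (upd v i (beta r * v i))
      - free_word (upd v j (alpha r * v j))).

(* The n-fold tensor product of [H] over [R], where [H] is the (R,R)-bimodule
   with a . x = alpha a * x and x . b = beta b * x. *)
Definition tpow (n : nat) : lmodType K :=
  if n is n'.+1 then lquot (@tensor_rel n'.+1) else R.

(* x_1 (x) ... (x) x_n, which is 1 in R when n = 0. *)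
Definition tpure n : ('I_n -> H) -> tpow n :=
  match n with
  | 0 => fun=> 1 : R
  | n'.+1 => fun v => \pi_(lquot (@tensor_rel n'.+1)) (free_word v)
  end.

(* The map x_1 (x) ... (x) x_n |-> f (x_1, ..., x_n), extended linearly; it is
   computed on a chosen representative, which is immaterial as soon as [f] is
   multilinear and balanced, see [tlift_linear] and [tlift_pure]. *)
Definition tlift n (V : lmodType K) (f : ('I_n.+1 -> H) -> V)
    (t : tpow n.+1) : V :=
  fglift (fun v : {ffun 'I_n.+1 -> H} => f v)
    (repr (t : lquot (@tensor_rel n.+1))).

Definition multilinear n (V : lmodType K) (f : ('I_n -> H) -> V) :=
  forall v i, linear (fun a => f (upd v i a)).

Definition balanced n (V : lmodType K) (f : ('I_n -> H) -> V) :=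
  forall v (i j : 'I_n) r, j = i.+1 :> nat ->
    f (upd v i (beta r * v i)) = f (upd v j (alpha r * v j)).

Section Lift.
Variables (n : nat) (V : lmodType K) (f : ('I_n.+1 -> H) -> V).
Hypotheses (f_lin : multilinear f) (f_bal : balanced f).

Let F := fglift (fun v : {ffun 'I_n.+1 -> H} => f v).

Let FB : {morph F : x y / x - y}.
Proof. exact: lift_is_additive. Qed.

Let F0 : F 0 = 0.
Proof. by rewrite -(subrr 0) FB subrr. Qed.

Let FD : {morph F : x y / x + y}.
Proof.
by move=> x y; rewrite -{1}[y]opprK FB -[- y]sub0r FB F0 sub0r opprK.
Qed.

Let Fword v : F (free_word v) = f v.
Proof.
rewrite /F liftU scale1r; congr f.
by apply: funext => i; rewrite ffunE.
Qed.

Let FZ a x : F (a *: x) = a *: F x.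
Proof.
have Fsum (s : seq {ffun 'I_n.+1 -> H}) (G : {ffun 'I_n.+1 -> H} -> _) :
  F (\sum_(i <- s) G i) = \sum_(i <- s) F (G i).
  by elim: s => [|v s IHs]; rewrite ?big_nil // !big_cons FD IHs.
have scaleU b (v : {ffun 'I_n.+1 -> H}) : a *: << b *g v >> = << a * b *g v >>.
  by apply/eqP/freeg_eqP => w; rewrite coeffZ !coeffU mulrA.
rewrite -(freeg_sumE x) scaler_sumr !Fsum scaler_sumr.
by apply: eq_bigr => v _; rewrite scaleU /F !liftU scalerA.
Qed.

Let F_rel x : x \in lspan (@tensor_rel n.+1) -> F x = 0.
Proof.
case/lspanP=> s Ss ->; elim: s Ss => [|p s IHs] Ss.
  by rewrite big_nil F0.
rewrite big_cons FD FZ IHs ?addr0; last first.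
  by move=> q qs; apply: Ss; rewrite inE qs orbT.
have [v i c a b|v i j r eq_j] := Ss p (mem_head _ _); rewrite FB.
  by rewrite FD FZ !Fword (f_lin v i) subrr scaler0.
by rewrite !Fword (f_bal v r eq_j) subrr scaler0.
Qed.

Let tlift_pi x : tlift f (\pi_(lquot (@tensor_rel n.+1)) x) = F x.
Proof.
apply/eqP; rewrite -subr_eq0 -FB F_rel //.
by rewrite -lquot_pi_eq reprK.
Qed.

Lemma tlift_linear : linear (tlift f).
Proof.
move=> a; elim/quotW=> x; elim/quotW=> y; rewrite -lquot_piZ -lquot_piD.
rewrite !tlift_pi.
by rewrite FD FZ.
Qed.

Lemma tlift_pure v : tlift f (tpure v) = f v.
Proof. by rewrite tlift_pi Fword. Qed.

End Lift.

Lemma tpure_multilinear n : multilinear (@tpure n.+1).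
Proof.
move=> v i c a b; apply/eqP; rewrite -lquot_piZ -lquot_piD lquot_pi_eq.
exact/mem_lspan/tensor_rel_linear.
Qed.

Lemma tpure_balanced n : balanced (@tpure n.+1).
Proof.
move=> v i j r eq_j; apply/eqP; rewrite lquot_pi_eq.
exact/mem_lspan/tensor_rel_balanced.
Qed.

Definition tone (h : H) : tpow 1 := tpure (fun=> h).

Definition ttwo (h1 h2 : H) : tpow 2 :=
  tpure (fun i : 'I_2 => if i == ord0 then h1 else h2).

(* a . (x_1 (x) ... (x) x_n) and (x_1 (x) ... (x) x_n) . b *)
Definition tlmul n (a : R) (t : tpow n.+1) : tpow n.+1 :=
  tlift (fun v => tpure (upd v ord0 (alpha a * v ord0))) t.

Definition trmul n (t : tpow n.+1) (b : R) : tpow n.+1 :=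
  tlift (fun v => tpure (upd v ord_max (beta b * v ord_max))) t.

(* The canonical map from the product of the n-th and m-th tensor powers to the
   (n + m)-th one, where factors in R are absorbed. *)
Definition tcat n m : tpow n -> tpow m -> tpow (n + m) :=
  match n, m with
  | 0, 0 => fun a b => (a : R) * b
  | 0, m'.+1 => fun a u => tlmul a u
  | n'.+1, 0 => fun t b =>
      ecast k (tpow k) (esym (addn0 n'.+1)) (trmul t b)
  | n'.+1, m'.+1 => fun t u =>
      tlift (fun v => tlift (fun w =>
        tpure (fun i : 'I_(n'.+1 + m'.+1) =>
          match split i with inl j => v j | inr k => w k end)) u) t
  end.

(* (h_1 (x) ... (x) h_n) . (u_1 (x) ... (x) u_n) = h_1 u_1 (x) ... (x) h_n u_n *)
Definition tright n (t : tpow n.+1) (u : 'I_n.+1 -> H) : tpow n.+1 :=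
  tlift (fun h => tpure (fun i => h i * u i)) t.

(* t . u, through a lift of [u] to a formal combination of words in [H]; this
   does not depend on the lift when [t] = Delta^n(h), but does in general. *)
Definition tmul n (t u : tpow n.+1) : tpow n.+1 := tlift (tright t) u.

End TensorPowers.

Record hopf_algebroid (K : fieldType) (R H : algType K) := HopfAlgebroid {
  alpha : {lrmorphism R -> H};
  beta : {linear R -> H};
  beta_one : beta 1 = 1;
  beta_anti : forall a b, beta (a * b) = beta b * beta a;
  alpha_beta : forall a b, alpha a * beta b = beta b * alpha a;

  Delta : {linear H -> tpow alpha beta 2};
  Delta_left : forall a x, Delta (alpha a * x) = tlmul a (Delta x);
  Delta_right : forall x b, Delta (beta b * x) = trmul (Delta x) b;
  Delta_one : Delta 1 = ttwo alpha beta 1 1;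
  Delta_coassoc : forall x,
    tlift (fun v : 'I_2 -> H => tcat (Delta (v ord0)) (tone alpha beta (v ord_max)))
      (Delta x) =
    tlift (fun v : 'I_2 -> H => tcat (tone alpha beta (v ord0)) (Delta (v ord_max)))
      (Delta x) :> tpow alpha beta 3;

  Delta_takeuchi : forall x a,
    tright (Delta x) (fun i : 'I_2 => if i == ord0 then beta a else 1)
    - tright (Delta x) (fun i : 'I_2 => if i == ord0 then 1 else alpha a) = 0;
  Delta_mul : forall x y, Delta (x * y) = tmul (Delta x) (Delta y);

  epsilon : {linear H -> R};
  epsilon_left : forall a x, epsilon (alpha a * x) = a * epsilon x;
  epsilon_right : forall x b, epsilon (beta b * x) = epsilon x * b;
  epsilon_one : epsilon 1 = 1;
  counit_left : forall x,
    tlift (fun v : 'I_2 -> H => alpha (epsilon (v ord0)) * v ord_max) (Delta x) = x;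
  counit_right : forall x,
    tlift (fun v : 'I_2 -> H => beta (epsilon (v ord_max)) * v ord0) (Delta x) = x;

  epsilon_ker : forall x y, epsilon y = 0 -> epsilon (x * y) = 0 }.

Section HopfBrace.
Variables (K : fieldType) (R H : algType K) (HA : hopf_algebroid R H).

Local Notation T := (tpow (alpha HA) (beta HA)).

Definition WH : lmodType K := dsum T.

Definition WH_homog : int -> WH -> Prop := @dsum_homog K T.

(* Homogeneous elements of [WH], with their degree as first component. *)
Definition hom : Type := {n : nat & T n}.

Definition mkhom n (t : T n) : hom := existT (fun k => T k : Type) n t.

Definition inW (x : hom) : WH := dinj (projT2 x).

Definition hone : hom := mkhom (n := 0) (1 : R).

Definition hcat (x y : hom) : hom := mkhom (tcat (projT2 x) (projT2 y)).

Local Notation "\bigotimes_ ( i < n ) F" := (\big[hcat/hone]_(i < n) F)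
  (at level 36, F at level 36, i, n at level 50).

Definition in_R (r : R) : hom := mkhom (n := 0) r.
Definition in_H (h : H) : hom := mkhom (tone (alpha HA) (beta HA) h).

(* [iDelta n] is Delta^n = (Delta^(n-1) (x) id) Delta, also for n = 1 since
   Delta^0 = id. *)
Fixpoint iDelta (n : nat) : H -> T n.+1 :=
  if n is n'.+1 then fun h =>
    tlift (fun v : 'I_2 -> H =>
        ecast k (T k) (addn1 n'.+1)
          (tcat (iDelta n' (v ord0)) (tone (alpha HA) (beta HA) (v ord_max))))
      (Delta HA h)
  else tone (alpha HA) (beta HA).

(* [hact q h u] is (Delta^{q-1} h) . u. *)
Definition hact (q : nat) (h : H) : T q -> T q :=
  match q with
  | 0 => fun r => epsilon HA (h * alpha HA r)
  | q'.+1 => fun u => tmul (iDelta q' h) u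
  end.

(* The degree 0 part is W^0 = R, whose elements are not of the form
   x_1 (x) ... (x) x_n: it has its own clause. *)
Definition is_hopf_differential (d : WH -> WH) : Prop :=
  (forall r : R,
     d (inW (in_R r)) =
     inW (hcat (in_R r) (in_H 1)) - inW (hcat (in_H 1) (in_R r))) /\
  (forall n (x : 'I_n -> H),
     let xs := \bigotimes_(j < n) in_H (x j) in
     d (inW xs) =
     inW (hcat xs (in_H 1))
     - \sum_(i < n) sgn K (n%:Z - (i.+1)%:Z) *:
         inW (\bigotimes_(j < n)
                (if j == i then mkhom (Delta HA (x j)) else in_H (x j)))
     - sgn K n%:Z *: inW (hcat (in_H 1) xs)).

Definition is_hopf_cup (cup : WH -> WH -> WH) : Prop :=
  forall n m (x : T n) (y : T m),
    cup (inW (mkhom x)) (inW (mkhom y)) =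
    sgn K (n%:Z * m%:Z) *: inW (hcat (mkhom x) (mkhom y)).

(* [j] is the sequence j_1 < ... < j_k, numbered from 0 (so are its values,
   which leaves j_l - l unchanged). *)
Definition is_hopf_brace (mu : WH -> seq WH -> WH) : Prop :=
  [/\ forall r : R, mu (inW (in_R r)) [::] = inW (in_R r),
      forall p (x : 'I_p -> H) k (q : 'I_k -> nat) (y : forall l, T (q l)),
        (k <= p)%N ->
        mu (inW (\bigotimes_(i < p) in_H (x i)))
           [seq inW (mkhom (y l)) | l <- enum 'I_k] =
        \sum_(j : {ffun 'I_k -> 'I_p}
               | [forall l : 'I_k, forall l' : 'I_k, (l < l')%N ==> (j l < j l')%N])
          sgn K (\sum_(l < k)
                   ((j l)%:Z - l%:Z + \sum_(l' < k | (l' < l)%N) (q l')%:Z)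
                   * ((q l)%:Z - 1)) *:
          inW (\bigotimes_(i < p)
                 (if [pick l | j l == i] is Some l
                  then mkhom (hact (x i) (y l)) else in_H (x i)))
    & forall p (x : T p) ys, (p < size ys)%N ->
        (forall y, y \in ys -> exists q, WH_homog q y) ->
        mu (inW (mkhom x)) ys = 0].

End HopfBrace.

(* Main.v *)
From HB Require Import structures.
Require Import Defs.
From mathcomp Require Import all_boot all_order all_algebra generic_quotient.
From mathcomp Require Import boolp freeg zify.

Set Implicit Arguments.
Unset Strict Implicit.
Unset Printing Implicit Defensive.

Import GRing.Theory.
Local Open Scope ring_scope.

(** The tensor powers of [H] over [R] are the homogeneous parts of the tensor
    algebra [W] of the bimodule [H] ([tensor_alg]): the tensor product over [R],
    with factors in [R] absorbed, is an associative unital product on [W], and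
    [W] is generated by [R] in degree 0 and [H] in degree 1.  So a linear map on
    [W] is given by its values on [R] and on words, subject to multilinearity
    and balancing ([tensor_lift]), and a property of homogeneous elements is
    proved by multiplying on the right by one element of [H] at a time
    ([gr_ind]).  All computations take place in this single algebra.

    The expression (Delta^(q-1) h) . u is an action [act] of [H] on [W] which is
    multiplicative in the sense of Hopf algebroids: h . (u v) is the sum of the
    (h_1 . u) (h_2 . v), see [act_mul].  Coassociativity and the condition
    Delta(x) (beta(a) (x) 1 - 1 (x) alpha(a)) = 0 enter only here.

    The braces [mu] satisfy, and are defined by, a recursion on the last factor
    of x: either no argument is inserted into it, or the last one is
    ([mu_rcons_step]):

      (w h){y_1, ..., y_n} = w{y_1, ..., y_n} h + w{y_1, ..., y_(n-1)} . (h . y_n)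

    where the second product carries the sign of the position at which y_n is
    inserted ([smul]).  Induction on this recursion gives the braces of a
    product ([mu_mul]), the compatibility of the braces with the action
    ([act_mu]), and from these two the relation for iterated braces
    ([mu_mu_star]); there the sum is organised by the position of the last y.

    The differential is handled as for an operad with multiplication.  With
    M = 1 (x) 1 one has

      dx = M{x} + (-1)^|x| x{M},   x cup y = (-1)^|x| M{x, y},   M{M} = 0,

    and M takes at most two arguments.  Expanding M{M}{x}, M{x}{M} and x{M}{M}
    gives d d = 0 ([cobar_d_square]); expanding M{x}{y_1, ..., y_n},
    x{M}{y_1, ..., y_n} and x{y_1, ..., y_n}{M} gives the formula for the
    differential of a brace ([mu_cobar_d]).  The Leibniz rule and the braces of
    a cup product are instances of [mu_mul].

    Two comparisons with the explicit formulas remain.  The sum over increasing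
    maps in the braces of pure tensors splits according to whether the last slot
    is used ([sum_incrS], [mu_prod]), and the sum over nested intervals in the
    relation for iterated braces splits according to its last interval
    ([tuple_sum_star]). *)

(** * Direct sums *)

Section DirectSumLift.
Variables (K : fieldType) (T : nat -> lmodType K).

Lemma dinj_id n (x : T n) : dinj x n = x.
Proof. exact: dfwith_in. Qed.

Lemma dinj_out n (x : T n) m : n != m -> dinj x m = 0.
Proof. by move=> nm; rewrite /= dfwith_out. Qed.

Lemma dinj_linear n : linear (@dinj K T n).
Proof.
move=> a x y; apply: dsumP => m; have [<-|nm] := eqVneq n m.
  by rewrite /= !dfwith_in.
by rewrite /= !dfwith_out // scaler0 addr0.
Qed.
HB.instance Definition _ n :=
  GRing.isLinear.Build K (T n) (dsum T) *:%R (@dinj K T n) (@dinj_linear n).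

Definition dproj n (w : dsum T) : T n := w n.
Lemma dproj_linear n : linear (@dproj n). Proof. by []. Qed.
HB.instance Definition _ n :=
  GRing.isLinear.Build K (dsum T) (T n) *:%R (@dproj n) (@dproj_linear n).

Lemma dinj_inj n : injective (@dinj K T n).
Proof. by move=> x y /(congr1 (@dproj n)); rewrite /dproj !dinj_id. Qed.

Lemma dsum_expand (w : dsum T) N : (forall n, (N <= n)%N -> w n = 0) ->
  w = \sum_(n < N) dinj (w n).
Proof.
move=> wN; apply: dsumP => m; rewrite -[RHS]/(dproj m _) raddf_sum /=.
have [leNm|ltmN] := leqP N m.
  rewrite wN // big1 // => i _; apply: dinj_out.
  by rewrite neq_ltn (leq_trans (ltn_ord i) leNm).
rewrite (bigD1 (Ordinal ltmN)) //= big1 ?addr0; first exact/esym/dinj_id.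
by move=> i; rewrite -val_eqE /= => im; apply: dinj_out.
Qed.

Variables (V : lmodType K) (f : forall n, T n -> V).
(** The sum over a chosen bound of the support; [dsum_liftE] shows that every
    other bound gives the same value. *)
Definition dsum_lift (w : dsum T) : V :=
  \sum_(n < sval (cid (dcoord_finite w))) f (w n).

Hypothesis f_lin : forall n, linear (@f n).

Lemma linear_fun0 (U U' : lmodType K) (g : U -> U') : linear g -> g 0 = 0.
Proof. by move=> gl; have := gl (-1) 0 0; rewrite !scaleN1r oppr0 addr0 addNr. Qed.

Lemma dsum_liftE (w : dsum T) N : (forall n, (N <= n)%N -> w n = 0) ->
  dsum_lift w = \sum_(n < N) f (w n).
Proof.
rewrite /dsum_lift; case: cid => M wM wN /=.
have key M' N' : (forall n, (N' <= n)%N -> w n = 0) -> (N' <= M')%N ->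
    \sum_(n < M') f (w n) = \sum_(n < N') f (w n).
  move=> wN' leNM; rewrite (big_ord_widen _ (fun n => f (w n)) leNM).
  rewrite [RHS]big_mkcond; apply: eq_bigr => i _; case: ltnP => // /wN' ->.
  exact: linear_fun0.
by have /orP[/key->|/key->] := leq_total M N.
Qed.

Lemma dsum_lift_linear : linear dsum_lift.
Proof.
move=> a u v; have [N uN] := dcoord_finite u; have [M vM] := dcoord_finite v.
have uB n : (maxn N M <= n)%N -> u n = 0.
  by rewrite geq_max => /andP[/uN].
have vB n : (maxn N M <= n)%N -> v n = 0.
  by rewrite geq_max => /andP[_ /vM].
rewrite (dsum_liftE uB) (dsum_liftE vB) (@dsum_liftE _ (maxn N M)).
  by rewrite scaler_sumr -big_split; apply: eq_bigr => i _ /=; rewrite f_lin.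
by move=> n le_n /=; rewrite uB // vB // scaler0 addr0.
Qed.

Lemma dsum_lift_inj n (x : T n) : dsum_lift (dinj x) = f x.
Proof.
rewrite (@dsum_liftE _ n.+1); last by move=> m ltnm; rewrite dinj_out // ltn_eqF.
rewrite big_ord_recr /= dfwith_in big1 ?add0r // => i _.
by rewrite dfwith_out ?(linear_fun0 (@f_lin i)) // gtn_eqF.
Qed.

End DirectSumLift.

Section DirectSumGrading.
Variables (K : fieldType) (T : nat -> lmodType K).
Local Notation gr := (@dsum_homog K T).

Lemma gr_lin i (a : K) u v : gr i u -> gr i v -> gr i (a *: u + v).
Proof. by move=> gu gv n ni /=; rewrite gu // gv // scaler0 addr0. Qed.

Lemma gr0 i : gr i 0. Proof. by []. Qed.
Lemma grD i u v : gr i u -> gr i v -> gr i (u + v).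
Proof. by move=> gu gv; rewrite -[u]scale1r; apply: gr_lin. Qed.
Lemma grZ i (a : K) u : gr i u -> gr i (a *: u).
Proof. by move=> gu; rewrite -[_ *: _]addr0; apply: gr_lin. Qed.
Lemma gr_sum i I (r : seq I) (P : pred I) F :
  (forall j, P j -> gr i (F j)) -> gr i (\sum_(j <- r | P j) F j).
Proof. by move=> gF; elim/big_ind: _ => // u v; apply: grD. Qed.

Lemma gr_inj n (x : T n) : gr n%:Z (dinj x).
Proof. by move=> m; rewrite eqz_nat eq_sym => /dinj_out. Qed.

Lemma gr_cases i u : gr i u ->
  u = 0 \/ exists n (x : T n), i = n%:Z /\ u = dinj x.
Proof.
case: i => n gu; last by left; apply: dsumP => m /=; apply: gu.
right; exists n, (u n); split=> //; apply: dsumP => m.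
have [<-|nm] := eqVneq n m; first by rewrite dinj_id.
by rewrite dinj_out // gu // eqz_nat eq_sym.
Qed.

Lemma dsum_grading : is_grading gr.
Proof.
split; [exact: gr0 | exact: gr_lin | |].
  move=> w; have [N wN] := dcoord_finite w.
  exists [seq n%:Z | n <- iota 0 N].
  exists (fun i => if i is Posz n then dinj (w n) else 0); split.
    by case=> n; [apply: gr_inj | apply: gr0].
  by rewrite big_map -[N in iota _ N]subn0 -/(index_iota 0 N) big_mkord; apply: dsum_expand.
move=> s h s_uniq gh sum0 i si; have := gh i.
case: (i) si => n si ghn; last by apply: dsumP => m; apply: ghn.
apply: dsumP => m; have [<-|nm] := eqVneq n m; last first.
  by rewrite ghn // eqz_nat eq_sym.
have /(congr1 (dproj n)) := sum0; rewrite raddf_sum (bigD1_seq n%:Z) //=.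
rewrite big1 ?addr0 // => j nj; apply: gh; by rewrite eq_sym.
Qed.

End DirectSumGrading.

(** * Words and the tensor algebra *)

Section WordFunctions.
Local Open Scope quotient_scope.
Variables (K : fieldType) (R H : algType K) (alpha beta : R -> H).
Local Notation T := (tpow alpha beta).

(** Pure tensors span: the coefficients of a formal combination of words are
    absorbed by linearity. *)
Lemma tpow_ind n (P : T n.+1 -> Prop) :
    P 0 -> (forall a u v, P u -> P v -> P (a *: u + v)) ->
    (forall v, P (tpure alpha beta v)) -> forall t, P t.
Proof.
move=> P0 Plin Ppure; elim/quotW=> x; rewrite -(freeg_sumE x).
elim: (dom x) => [|w s IHs].
  rewrite big_nil; congr (P _): P0.
  by apply/esym; rewrite -[LHS]/(\pi_(lquot _) 0) -(subrr 0) lquot_piD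
    -scaleN1r lquot_piZ scaleN1r subrr.
rewrite big_cons.
have -> : << coeff w x *g w >> = coeff w x *: << w >> :> {freeg _ / K}.
  by apply/eqP/freeg_eqP => z; rewrite coeffZ !coeffU mulrA mulr1.
rewrite lquot_piD lquot_piZ; apply: Plin IHs.
have := Ppure w; rewrite /tpure /free_word.
by have -> : finfun w = w by apply/ffunP => i; rewrite ffunE.
Qed.

Lemma codom_nth (s : seq H) n :
  size s = n -> codom (fun i : 'I_n => nth 0 s i) = s.
Proof.
move=> <-; apply: (@eq_from_nth _ 0) => [|i].
  by rewrite size_codom card_ord.
rewrite size_codom card_ord => ltis.
rewrite /codom /image_mem (nth_map (Ordinal ltis)) ?size_enum_ord //.
by rewrite nth_enum_ord.
Qed.

Lemma nth_codom_ord n (v : 'I_n -> H) (i : 'I_n) x0 : nth x0 (codom v) i = v i.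
Proof.
rewrite /codom /image_mem (nth_map i) ?size_enum_ord //.
by congr v; apply: val_inj; rewrite /= nth_enum_ord.
Qed.

Lemma codom_upd n (v : 'I_n -> H) i a :
  codom (upd v i a) = take i (codom v) ++ a :: drop i.+1 (codom v).
Proof.
have sz : size (codom v) = n by rewrite size_codom card_ord.
have szt : size (take i (codom v)) = i by rewrite size_takel ?sz // ltnW.
apply: (@eq_from_nth _ 0) => [|j].
  rewrite size_codom card_ord size_cat /= szt size_drop sz.
  by rewrite addnS -addSn subnKC.
rewrite size_codom card_ord => ltjn.
rewrite (nth_codom_ord _ (Ordinal ltjn)) /upd nth_cat szt -val_eqE /=.
case: ltngtP => [ltji|ltij|->].
- by rewrite nth_take // (nth_codom_ord v (Ordinal ltjn)).
- have -> : (j - i)%N = (j - i.+1).+1 by rewrite subnSK.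
  by rewrite /= nth_drop subnKC // (nth_codom_ord v (Ordinal ltjn)).
by rewrite subnn.
Qed.

Lemma codom_split n (v : 'I_n -> H) (i : 'I_n) :
  codom v = take i (codom v) ++ v i :: drop i.+1 (codom v).
Proof.
rewrite -codom_upd; apply: eq_codom => j; rewrite /upd.
by case: eqP => [->|].
Qed.

Variable V : lmodType K.
Implicit Type G : seq H -> V.

(** Words are lists here, not functions on ordinals, because concatenation of
    lists is strictly associative: no cast along an equality of degrees occurs. *)
Definition seq_linear G := forall s1 s2, linear (fun a => G (s1 ++ a :: s2)).

Definition seq_balanced G := forall s1 s2 a b r,
  G (s1 ++ beta r * a :: b :: s2) = G (s1 ++ a :: alpha r * b :: s2).

Lemma codom_multilinear G n : seq_linear G ->
  multilinear (fun v : 'I_n -> H => G (codom v)).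
Proof. by move=> Glin v i c a b; rewrite !codom_upd Glin. Qed.

Lemma codom_balanced G n : seq_balanced G ->
  balanced alpha beta (fun v : 'I_n -> H => G (codom v)).
Proof.
move=> Gbal v i j r ji; rewrite !codom_upd.
have sz : size (codom v) = n by rewrite size_codom card_ord.
have -> : drop i.+1 (codom v) = v j :: drop j.+1 (codom v).
  by rewrite (drop_nth 0) -ji ?sz // nth_codom_ord.
rewrite {2}ji (take_nth 0) ?sz // nth_codom_ord cat_rcons.
exact: Gbal.
Qed.

End WordFunctions.

Section TensorAlgebra.
Variables (K : fieldType) (R H : algType K) (HA : hopf_algebroid R H).
Local Notation al := (alpha HA).
Local Notation be := (beta HA).
Local Notation T := (tpow al be).
Local Notation tp := (tpure al be).
Local Notation tl := (@tlift K R H al be _ _).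

Definition tensor_alg : Type := dsum T.
HB.instance Definition _ := GRing.Lmodule.on tensor_alg.
Implicit Types (r : R) (h : H) (s : seq H).

Definition inR r : tensor_alg := dinj (r : T 0).
Definition word s : tensor_alg := dinj (tp (fun i : 'I_(size s) => nth 0 s i)).

Lemma inR_linear : linear inR.
Proof. by move=> a x y; rewrite /inR -linearP. Qed.
HB.instance Definition _ := GRing.isLinear.Build K R tensor_alg *:%R inR inR_linear.

Lemma word_codom n (v : 'I_n -> H) : dinj (tp v) = word (codom v).
Proof.
have := size_codom v; rewrite card_ord; move: (nth_codom_ord v).
rewrite /word; move: (codom v) => c cv sz; case: n / sz v cv => v cv.
by congr (dinj (tp _)); apply: funext => i; rewrite cv.
Qed.

Lemma word_tpure n s (szs : size s = n) :
  word s = dinj (tp (fun i : 'I_n => nth 0 s i)).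
Proof. by case: n / szs. Qed.

Lemma word_nil : word [::] = inR 1. Proof. by []. Qed.

Lemma word_upd s1 s2 a :
  word (s1 ++ a :: s2) = dinj (tp (upd (fun i => nth 0 (s1 ++ 0 :: s2) i)
     (inord (size s1) : 'I_(size s1 + size s2).+1) a)).
Proof.
rewrite word_codom codom_upd codom_nth; last by rewrite size_cat /= addnS.
rewrite inordK; last by rewrite ltnS leq_addr.
by rewrite take_size_cat // drop_cat ltnNge leqnSn subSnn /= drop0.
Qed.

Lemma word_linear : seq_linear word.
Proof. by move=> s1 s2 c a b; rewrite !word_upd tpure_multilinear linearP. Qed.

Lemma word_balanced : seq_balanced al be word.
Proof.
move=> s1 s2 a b r.
pose n := (size s1 + size s2)%N.
have sz : size (s1 ++ a :: b :: s2) = n.+2 by rewrite size_cat /= !addnS.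
pose v (i : 'I_n.+2) := nth 0 (s1 ++ a :: b :: s2) i.
have lt1 : (size s1 < n.+2)%N by rewrite ltnS leqW ?leq_addr.
have lt2 : ((size s1).+1 < n.+2)%N by rewrite !ltnS leq_addr.
have := @tpure_balanced _ _ _ al be n.+1 v (Ordinal lt1) (Ordinal lt2) r erefl.
rewrite {2 4}/v /= !nth_cat ltnn ltnNge leqnSn subnn subSnn /=.
move/(congr1 (@dinj _ T n.+2)); rewrite !word_codom !codom_upd !codom_nth //=.
rewrite take_size_cat // !drop_cat ltnNge leqnSn subSnn.
rewrite ltnNge leqW ?leqnSn //= subSn ?leqnSn // subSnn /= !drop0.
by rewrite take_cat ltnNge leqnSn subSnn /= -catA.
Qed.

Lemma tensor_ind (P : tensor_alg -> Prop) :
    P 0 -> (forall a u v, P u -> P v -> P (a *: u + v)) ->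
    (forall r, P (inR r)) -> (forall h s, P (word (h :: s))) -> forall w, P w.
Proof.
move=> P0 Plin PR Pword w; have [N wN] := dcoord_finite w.
rewrite (dsum_expand wN); elim/big_ind: _ => // [u v Pu Pv|n _].
  by rewrite -[u]scale1r; apply: Plin.
case: (val n) (w n) => [|m]; first exact: PR.
elim/tpow_ind => [|a u v Pu Pv|v]; first by rewrite linear0.
- by rewrite linearP; apply: Plin.
rewrite word_codom; move: (size_codom v); rewrite card_ord.
by case: (codom v).
Qed.

Section Universal.
Variables (V : lmodType K) (G0 : R -> V) (G : seq H -> V).

Definition tensor_lift : tensor_alg -> V :=
  dsum_lift (fun n => match n return T n -> V with
    0 => G0 | n'.+1 => tlift (fun v => G (codom v)) end).

Hypotheses (G0lin : linear G0) (Glin : seq_linear G)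
  (Gbal : seq_balanced al be G).

Let f_lin n : linear (match n return T n -> V with
    0 => G0 | n'.+1 => tlift (fun v => G (codom v)) end).
Proof.
case: n => // n; apply: tlift_linear; first exact: codom_multilinear.
exact: codom_balanced.
Qed.

Lemma tensor_lift_linear : linear tensor_lift.
Proof. exact: dsum_lift_linear f_lin. Qed.

Lemma tensor_lift_inR r : tensor_lift (inR r) = G0 r.
Proof. by rewrite /tensor_lift dsum_lift_inj //; apply: f_lin. Qed.

Lemma tensor_lift_word h s : tensor_lift (word (h :: s)) = G (h :: s).
Proof.
rewrite /tensor_lift dsum_lift_inj; last exact: f_lin.
rewrite -[LHS]/(tlift (fun v : 'I_(size s).+1 -> H => G (codom v))
  (tp (fun i : 'I_(size s).+1 => nth 0 (h :: s) i))).
rewrite tlift_pure ?codom_nth //.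
  exact: codom_multilinear.
exact: codom_balanced.
Qed.

End Universal.

(** Two elements of a tensor power are equal as soon as their images in the tensor
    algebra are, and there the entries of a word can be handled as a list. *)
Lemma multilinear_inj n m (g : ('I_n -> H) -> T m) (G : seq H -> tensor_alg) :
    (forall v, dinj (g v) = G (codom v)) -> seq_linear G -> multilinear g.
Proof.
move=> gG Glin v i a x y; apply: (@dinj_inj _ T m).
by rewrite gG (codom_multilinear Glin v i a x y) linearP -!gG.
Qed.

Lemma balanced_inj n m (g : ('I_n -> H) -> T m) (G : seq H -> tensor_alg) :
    (forall v, dinj (g v) = G (codom v)) -> seq_balanced al be G ->
  balanced al be g.
Proof.
move=> gG Gbal v i j r ji; apply: (@dinj_inj _ T m).
by rewrite !gG; apply: (codom_balanced Gbal).
Qed.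

(** What the products of [r] with a word, on the left and on the right, have to be. *)
Definition scale_head r s : tensor_alg :=
  if s is h :: s' then word (al r * h :: s') else inR r.
Definition scale_last r s : tensor_alg :=
  if s is h :: s' then word (belast h s' ++ [:: be r * last h s']) else inR r.

Lemma scale_head_linear r : seq_linear (scale_head r).
Proof.
move=> [|h s1] s2 a x y /=; last exact: (word_linear (_ :: s1)).
by rewrite mulrDr -scalerAr; apply: (word_linear [::]).
Qed.

Lemma scale_head_balanced r : seq_balanced al be (scale_head r).
Proof.
move=> [|h s1] s2 a b r' /=; last exact: (word_balanced (_ :: s1)).
by rewrite mulrA alpha_beta -mulrA; apply: (word_balanced [::]).
Qed.

Lemma scale_last_rcons r s h : scale_last r (rcons s h) = word (rcons s (be r * h)).
Proof. by case: s => [|k s] //=; rewrite belast_rcons last_rcons cats1. Qed.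

Lemma scale_last_linear r : seq_linear (scale_last r).
Proof.
move=> s1 s2; case/lastP: s2 => [|s2 k] a x y.
  by rewrite /= !cats1 !scale_last_rcons mulrDr -scalerAr -!cats1 word_linear.
rewrite /= -!rcons_cons -!rcons_cat !scale_last_rcons -!cats1 -!catA /=.
exact: word_linear.
Qed.

Lemma scale_last_balanced r : seq_balanced al be (scale_last r).
Proof.
move=> s1 s2; case/lastP: s2 => [|s2 k] a b r'.
  rewrite -!cat_rcons !cats0 !scale_last_rcons mulrA -alpha_beta -mulrA.
  by rewrite -!cats1 -!catA; apply: word_balanced.
rewrite /= -!rcons_cons -!rcons_cat !scale_last_rcons -!cats1 -!catA /=.
exact: word_balanced.
Qed.

Lemma tlmul_cod n r (v : 'I_n.+1 -> H) :
  dinj (tp (upd v ord0 (al r * v ord0))) = scale_head r (codom v) :> tensor_alg.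
Proof.
by rewrite word_codom codom_upd [in RHS](codom_split v ord0) /= !take0.
Qed.

Lemma trmul_cod n r (v : 'I_n.+1 -> H) :
  dinj (tp (upd v ord_max (be r * v ord_max))) = scale_last r (codom v) :> tensor_alg.
Proof.
rewrite word_codom codom_upd [in RHS](codom_split v ord_max) /=.
by rewrite drop_oversize ?size_codom ?card_ord // !cats1 scale_last_rcons.
Qed.

Lemma tlmul_pure n r (v : 'I_n.+1 -> H) :
  tlmul r (tp v) = tp (upd v ord0 (al r * v ord0)).
Proof.
rewrite /tlmul tlift_pure //.
  exact: multilinear_inj (tlmul_cod r) (scale_head_linear r).
exact: balanced_inj (tlmul_cod r) (scale_head_balanced r).
Qed.

Lemma tlmul_linearr n r : linear (@tlmul _ _ _ al be n r).
Proof.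
apply: tlift_linear.
  exact: multilinear_inj (tlmul_cod r) (scale_head_linear r).
exact: balanced_inj (tlmul_cod r) (scale_head_balanced r).
Qed.

Lemma trmul_pure n r (v : 'I_n.+1 -> H) :
  trmul (tp v) r = tp (upd v ord_max (be r * v ord_max)).
Proof.
rewrite /trmul tlift_pure //.
  exact: multilinear_inj (trmul_cod r) (scale_last_linear r).
exact: balanced_inj (trmul_cod r) (scale_last_balanced r).
Qed.

Lemma trmul_linearl n r : linear (fun t => @trmul _ _ _ al be n t r).
Proof.
apply: tlift_linear.
  exact: multilinear_inj (trmul_cod r) (scale_last_linear r).
exact: balanced_inj (trmul_cod r) (scale_last_balanced r).
Qed.

Lemma linear_comb (U V : lmodType K) (f1 f2 f3 : U -> V) (a : K) :
  linear f1 -> linear f2 -> (forall x, f3 x = a *: f1 x + f2 x) -> linear f3.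
Proof.
move=> l1 l2 f3E b x y; rewrite !f3E l1 l2 !scalerDr !scalerA addrACA.
by rewrite mulrC.
Qed.

Lemma linear_cst0 (U V : lmodType K) (f : U -> V) :
  (forall x, f x = 0) -> linear f.
Proof. by move=> f0 a x y; rewrite !f0 scaler0 addr0. Qed.

Lemma tlmul_linearl n t : linear (fun r => @tlmul _ _ _ al be n r t).
Proof.
elim/tpow_ind: t => [|a u v lu lv|v].
- by apply: linear_cst0 => r; rewrite (linear_fun0 (@tlmul_linearr n r)).
- by apply: (linear_comb (a := a) lu lv) => r; rewrite tlmul_linearr.
move=> a x y; rewrite !tlmul_pure linearP mulrDl -scalerAl.
exact: tpure_multilinear.
Qed.

Lemma trmul_linearr n t : linear (@trmul _ _ _ al be n t).
Proof.
elim/tpow_ind: t => [|a u v lu lv|v].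
- by apply: linear_cst0 => r; rewrite (linear_fun0 (@trmul_linearl n r)).
- by apply: (linear_comb (a := a) lu lv) => r; rewrite trmul_linearl.
move=> a x y; rewrite !trmul_pure linearP mulrDl -scalerAl.
exact: tpure_multilinear.
Qed.

Lemma catv_cod n m (v : 'I_n.+1 -> H) (w : 'I_m.+1 -> H) :
  dinj (tp (fun i : 'I_(n.+1 + m.+1) =>
     match split i with inl j => v j | inr k => w k end))
  = word (codom v ++ codom w) :> tensor_alg.
Proof.
rewrite word_codom; congr word; apply: (@eq_from_nth _ 0) => [|i].
  by rewrite size_cat !size_codom !card_ord.
rewrite size_codom card_ord => lti.
rewrite (nth_codom_ord _ (Ordinal lti)) nth_cat size_codom card_ord.
case: splitP => j /= ->; first by rewrite ltn_ord nth_codom_ord.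
by rewrite ltnNge leq_addr /= addKn nth_codom_ord.
Qed.

Lemma word_cat_linearl s : seq_linear (fun s' => word (s' ++ s)).
Proof. by move=> s1 s2 a x y; rewrite -!catA /=; apply: word_linear. Qed.
Lemma word_cat_linearr s : seq_linear (fun s' => word (s ++ s')).
Proof. by move=> s1 s2 a x y; rewrite !catA /=; apply: word_linear. Qed.
Lemma word_cat_balancedl s : seq_balanced al be (fun s' => word (s' ++ s)).
Proof. by move=> s1 s2 a x y; rewrite -!catA /=; apply: word_balanced. Qed.
Lemma word_cat_balancedr s : seq_balanced al be (fun s' => word (s ++ s')).
Proof. by move=> s1 s2 a x y; rewrite !catA /=; apply: word_balanced. Qed.

Section TcatSS.
Variables n m : nat.
Let cv (v : 'I_n.+1 -> H) (w : 'I_m.+1 -> H) : T (n.+1 + m.+1) :=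
  tp (fun i : 'I_(n.+1 + m.+1) =>
     match split i with inl j => v j | inr k => w k end).

Let cvr_lin v : linear (tl (cv v)).
Proof.
apply: tlift_linear.
  exact: multilinear_inj (catv_cod v) (word_cat_linearr _).
exact: balanced_inj (catv_cod v) (word_cat_balancedr _).
Qed.

Let cvr_pure v w : tl (cv v) (tp w) = cv v w.
Proof.
apply: tlift_pure.
  exact: multilinear_inj (catv_cod v) (word_cat_linearr _).
exact: balanced_inj (catv_cod v) (word_cat_balancedr _).
Qed.

Let cvl_mlin u : multilinear (fun v => tl (cv v) u).
Proof.
elim/tpow_ind: u => [|a x y mx my|w].
- by move=> v i; apply: linear_cst0 => h; rewrite (linear_fun0 (cvr_lin _)).
- by move=> v i; apply: (linear_comb (a := a) (mx v i) (my v i)) => h; rewrite cvr_lin.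
move=> v i a x y; rewrite !cvr_pure.
exact: (multilinear_inj ((@catv_cod n m)^~ w) (word_cat_linearl _)).
Qed.

Let cvl_bal u : balanced al be (fun v => tl (cv v) u).
Proof.
elim/tpow_ind: u => [|a x y mx my|w] v i j r ji.
- by rewrite !(linear_fun0 (cvr_lin _)).
- by rewrite !cvr_lin (mx v i j) // (my v i j).
rewrite !cvr_pure.
exact: (balanced_inj ((@catv_cod n m)^~ w) (word_cat_balancedl _)).
Qed.

Lemma tcatSS_linearl (u : T m.+1) : linear (fun t : T n.+1 => tcat t u).
Proof. exact: tlift_linear (@cvl_mlin u) (@cvl_bal u). Qed.

Lemma tcatSS_pure v w : tcat (tp v) (tp w) = cv v w.
Proof.
rewrite -cvr_pure.
exact: (tlift_pure (@cvl_mlin (tp w)) (@cvl_bal (tp w)) v).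
Qed.

Lemma tcatSS_linearr (t : T n.+1) : linear (fun u : T m.+1 => tcat t u).
Proof.
elim/tpow_ind: t => [|a x y lx ly|v].
- by apply: linear_cst0 => u; rewrite (linear_fun0 (tcatSS_linearl u)).
- by apply: (linear_comb (a := a) lx ly) => u; rewrite (tcatSS_linearl u).
have E u : tcat (tp v) u = tl (cv v) u.
  exact: (tlift_pure (@cvl_mlin u) (@cvl_bal u) v).
by move=> a x y; rewrite !E cvr_lin.
Qed.
End TcatSS.

Lemma ecast_linear n m (e : n = m) : linear (fun t : T n => ecast k (T k) e t).
Proof. by case: m / e. Qed.

Lemma dinj_ecast n m (e : n = m) (t : T n) :
  dinj (ecast k (T k) e t) = dinj t :> tensor_alg.
Proof. by case: m / e. Qed.

Lemma tcat_linearl n m (u : T m) : linear (fun t : T n => tcat t u).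
Proof.
case: n m u => [|n] [|m] u.
- by move=> a x y /=; rewrite mulrDl scalerAl.
- exact: tlmul_linearl.
- move=> a x y; rewrite -[LHS]/(ecast k (T k) _ _) trmul_linearl.
  exact: ecast_linear.
exact: tcatSS_linearl.
Qed.

Lemma tcat_linearr n m (t : T n) : linear (fun u : T m => tcat t u).
Proof.
case: n m t => [|n] [|m] t.
- by move=> a x y /=; rewrite mulrDr scalerAr.
- exact: tlmul_linearr.
- move=> a x y; rewrite -[LHS]/(ecast k (T k) _ _) trmul_linearr.
  exact: ecast_linear.
exact: tcatSS_linearr.
Qed.

Definition tensor_mul (u v : tensor_alg) : tensor_alg :=
  dsum_lift (fun n (a : T n) =>
    dsum_lift (fun m (b : T m) => dinj (tcat a b) : tensor_alg) v) u.

Let mulr_lin n (a : T n) m : linear (fun b : T m => dinj (tcat a b) : tensor_alg).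
Proof. by move=> c x y; rewrite tcat_linearr linearP. Qed.

Let mull_lin v n :
  linear (fun a : T n => dsum_lift (fun m (b : T m) => dinj (tcat a b) : tensor_alg) v).
Proof.
have [M vM] := dcoord_finite v.
move=> c x y; rewrite !(dsum_liftE (mulr_lin _) vM) scaler_sumr -big_split /=.
by apply: eq_bigr => i _; rewrite tcat_linearl linearP.
Qed.

Lemma tensor_mul_linearl v : linear (tensor_mul^~ v).
Proof. exact: dsum_lift_linear (mull_lin v). Qed.

Lemma tensor_mul_linearr u : linear (tensor_mul u).
Proof.
have [M uM] := dcoord_finite u.
move=> c x y; rewrite /tensor_mul !(dsum_liftE (mull_lin _) uM) scaler_sumr -big_split /=.
by apply: eq_bigr => i _; rewrite dsum_lift_linear //; apply: mulr_lin.
Qed.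

Lemma tensor_mul_inj n m (a : T n) (b : T m) :
  tensor_mul (dinj a) (dinj b) = dinj (tcat a b).
Proof.
rewrite /tensor_mul dsum_lift_inj; last exact: mull_lin.
by rewrite dsum_lift_inj //; apply: mulr_lin.
Qed.

Lemma tensor_mul_RR r r' : tensor_mul (inR r) (inR r') = inR (r * r').
Proof. exact: tensor_mul_inj. Qed.

Lemma tensor_mul_Rw r h s : tensor_mul (inR r) (word (h :: s)) = word (al r * h :: s).
Proof.
rewrite /word tensor_mul_inj -[tcat _ _]/(tlmul _ _).
by rewrite (@tlmul_pure (size s)) tlmul_cod codom_nth.
Qed.

Lemma tensor_mul_wR r h s :
  tensor_mul (word (rcons s h)) (inR r) = word (rcons s (be r * h)).
Proof.
rewrite (@word_tpure (size s).+1) ?size_rcons // tensor_mul_inj.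
rewrite -[tcat _ _]/(ecast k (T k) _ (trmul _ _)) dinj_ecast.
by rewrite trmul_pure trmul_cod codom_nth ?size_rcons // scale_last_rcons.
Qed.

Lemma tensor_mul_ww h s h' s' :
  tensor_mul (word (h :: s)) (word (h' :: s')) = word (h :: s ++ h' :: s').
Proof.
rewrite (@word_tpure (size s).+1) // (@word_tpure (size s').+1) // tensor_mul_inj.
by rewrite tcatSS_pure catv_cod !codom_nth.
Qed.

Lemma tensor_mul1 : left_id (inR 1) tensor_mul.
Proof.
elim/tensor_ind => [|a u v IHu IHv|r|h s].
- exact: linear_fun0 (tensor_mul_linearr _).
- by rewrite tensor_mul_linearr IHu IHv.
- by rewrite tensor_mul_RR mul1r.
by rewrite tensor_mul_Rw rmorph1 mul1r.
Qed.

Lemma tensor_1mul : right_id (inR 1) tensor_mul.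
Proof.
elim/tensor_ind => [|a u v IHu IHv|r|h s].
- exact: linear_fun0 (tensor_mul_linearl _).
- by rewrite tensor_mul_linearl IHu IHv.
- by rewrite tensor_mul_RR mulr1.
by case/lastP: (h :: s) => [|s' k]; rewrite ?tensor_mul_RR ?mulr1 // tensor_mul_wR
  beta_one mul1r.
Qed.

Lemma tensor_mul_word s t : tensor_mul (word s) (word t) = word (s ++ t).
Proof.
case: s t => [|h s] [|k t]; rewrite ?word_nil ?tensor_mul1 ?tensor_1mul ?cats0 //.
exact: tensor_mul_ww.
Qed.

Let Rw r h s := tensor_mul_Rw r h s.

(** The product is checked on generators.  Two cases have content: an element of
    [R] between two words is the balancing relation, and a single letter between
    two elements of [R] needs that [al] and [be] commute. *)
Lemma tensor_mulA : associative tensor_mul.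
Proof.
move=> u v w.
elim/tensor_ind: u => [|a x y Ex Ey|r1|h1 s1].
- by rewrite !(linear_fun0 (tensor_mul_linearl _)).
- by rewrite !tensor_mul_linearl Ex Ey.
all: elim/tensor_ind: v => [|a x y Ex Ey|r2|h2 s2].
1,5: by rewrite (linear_fun0 (tensor_mul_linearl _)) !(linear_fun0 (tensor_mul_linearr _))
  (linear_fun0 (tensor_mul_linearl _)).
1,4: by rewrite tensor_mul_linearl !tensor_mul_linearr Ex Ey tensor_mul_linearl.
all: elim/tensor_ind: w => [|a x y Ex Ey|r3|h3 s3].
1,5,9,13: by rewrite !(linear_fun0 (tensor_mul_linearr _)).
1,4,7,10: by rewrite !tensor_mul_linearr Ex Ey.
- by rewrite !tensor_mul_RR mulrA.
- by rewrite tensor_mul_RR !Rw rmorphM mulrA.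
- rewrite Rw; case: s2 => [|k2 s2].
    by rewrite (tensor_mul_wR _ _ [::]) (tensor_mul_wR _ _ [::]) Rw /= !mulrA alpha_beta.
  rewrite (lastI k2) -!rcons_cons tensor_mul_wR rcons_cons Rw -!rcons_cons.
  by rewrite tensor_mul_wR.
- by rewrite Rw !tensor_mul_word Rw.
- by rewrite (lastI h1) !tensor_mul_wR tensor_mul_RR tensor_mul_wR beta_anti mulrA.
- rewrite Rw (lastI h1) tensor_mul_wR !tensor_mul_word !cat_rcons.
  exact/esym/word_balanced.
- by rewrite (lastI h2) tensor_mul_wR !tensor_mul_word -!rcons_cat tensor_mul_wR.
by rewrite !tensor_mul_word catA.
Qed.

Lemma tensor_mulDl : left_distributive tensor_mul +%R.
Proof.
by move=> u v w; rewrite -[u in LHS]scale1r tensor_mul_linearl scale1r.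
Qed.
Lemma tensor_mulDr : right_distributive tensor_mul +%R.
Proof.
by move=> u v w; rewrite -[v in LHS]scale1r tensor_mul_linearr scale1r.
Qed.
Lemma tensor_one_neq0 : inR 1 != 0.
Proof.
apply/eqP=> /(congr1 (dproj 0)); rewrite /dproj dinj_id => /eqP.
by rewrite oner_eq0.
Qed.

HB.instance Definition _ := GRing.Zmodule_isNzRing.Build tensor_alg
  tensor_mulA tensor_mul1 tensor_1mul tensor_mulDl tensor_mulDr tensor_one_neq0.

Lemma tensor_scaleAl (a : K) (u v : tensor_alg) : a *: (u * v) = (a *: u) * v.
Proof.
by have := tensor_mul_linearl v a u 0; rewrite (linear_fun0 (tensor_mul_linearl v)) !addr0.
Qed.
HB.instance Definition _ := GRing.Lmodule_isLalgebra.Build K tensor_alg tensor_scaleAl.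
Lemma tensor_scaleAr (a : K) (u v : tensor_alg) : a *: (u * v) = u * (a *: v).
Proof.
by have := tensor_mul_linearr u a v 0; rewrite (linear_fun0 (tensor_mul_linearr u)) !addr0.
Qed.
HB.instance Definition _ := GRing.Lalgebra_isAlgebra.Build K tensor_alg tensor_scaleAr.

End TensorAlgebra.

(** * Generators and degrees *)

Section Generators.
Variables (K : fieldType) (R H : algType K) (HA : hopf_algebroid R H).
Local Notation al := (alpha HA).
Local Notation be := (beta HA).
Local Notation T := (tpow al be).
Local Notation tp := (tpure al be).
Local Notation word := (@word K R H HA).
Local Notation inR := (@inR K R H HA).
Local Notation gr := (@dsum_homog K T).
Implicit Types (r : R) (h g : H) (s : seq H) (u v w : tensor_alg HA).

Definition inH h : tensor_alg HA := word [:: h].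

Lemma inH_linear : linear inH.
Proof. exact: (@word_linear _ _ _ _ [::] [::]). Qed.
HB.instance Definition _ := GRing.isLinear.Build K H (tensor_alg HA) *:%R inH inH_linear.

Lemma inHE h : inH h = dinj (tone al be h).
Proof.
rewrite /inH (@word_tpure _ _ _ _ 1) //; congr (dinj (tp _)).
by apply: funext => i; rewrite ord1.
Qed.

Lemma inR1 : inR 1 = 1. Proof. by []. Qed.
Lemma inRM r r' : inR (r * r') = inR r * inR r'.
Proof. by rewrite [RHS]tensor_mul_RR. Qed.
Lemma inR_inH r h : inR r * inH h = inH (al r * h).
Proof. exact: tensor_mul_Rw. Qed.
Lemma inH_inR r h : inH h * inR r = inH (be r * h).
Proof. exact: (@tensor_mul_wR _ _ _ HA r h [::]). Qed.
Lemma word_cat s1 s2 : word (s1 ++ s2) = word s1 * word s2.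
Proof. by rewrite [RHS]tensor_mul_word. Qed.
Lemma word_rcons s h : word (rcons s h) = word s * inH h.
Proof. by rewrite -cats1 word_cat. Qed.

Lemma inW_hcat (x y : Defs.hom HA) : inW (hcat x y) = (inW x : tensor_alg HA) * inW y.
Proof. by rewrite [RHS]tensor_mul_inj. Qed.

Lemma inW_prod n (F : 'I_n -> Defs.hom HA) :
  inW (\big[@hcat K R H HA/hone HA]_(i < n) F i) =
    \prod_(i < n) (inW (F i) : tensor_alg HA).
Proof. exact: (big_morph (fun x : Defs.hom HA => inW x : tensor_alg HA) inW_hcat). Qed.

Lemma inW_inH h : inW (in_H HA h) = inH h.
Proof. by rewrite inHE. Qed.
Lemma inW_inR r : inW (in_R HA r) = inR r.
Proof. by []. Qed.

Lemma gr_inR r : gr 0 (inR r). Proof. exact: (@gr_inj K T 0). Qed.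
Lemma gr_word s : gr (size s)%:Z (word s). Proof. exact: gr_inj. Qed.
Lemma gr_inH h : gr 1 (inH h). Proof. exact: (@gr_word [:: h]). Qed.

(** Since [R] and [H] generate, a homogeneous element is reached from [R] by right
    multiplications by elements of [H].  Negative degrees contain only 0. *)
Lemma gr_ind (P : int -> tensor_alg HA -> Prop) :
    (forall i, P i 0) ->
    (forall i a u v, gr i u -> gr i v -> P i u -> P i v -> P i (a *: u + v)) ->
    (forall r, P 0 (inR r)) ->
    (forall i w h, gr i w -> P i w -> P (i + 1) (w * inH h)) ->
  forall i u, gr i u -> P i u.
Proof.
move=> P0 Plin PR Pstep i u /gr_cases[->|[n [x [-> ->]]]]; first exact: P0.
have Pword s : P (size s)%:Z (word s).
  elim/last_ind: s => [|s h IHs]; first exact: PR.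
  by rewrite word_rcons size_rcons -addn1 PoszD; apply/Pstep/IHs/gr_word.
case: n x => [|n] x; first exact: PR.
elim/tpow_ind: x => [|a x y Px Py|v].
- by rewrite linear0.
- by rewrite linearP; apply: Plin => //; apply: gr_inj.
by rewrite word_codom; have := Pword (codom v); rewrite size_codom card_ord.
Qed.

Lemma tensor_homog_ind (P : tensor_alg HA -> Prop) :
  P 0 -> (forall a u v, P u -> P v -> P (a *: u + v)) ->
  (forall i u, gr i u -> P u) -> forall u, P u.
Proof.
move=> P0 Plin Pg u; have [N uN] := dcoord_finite u; rewrite (dsum_expand uN).
elim/big_ind: _ => // [x y Px Py|n _]; last exact/Pg/gr_inj.
by rewrite -[x]scale1r; apply: Plin.
Qed.

Lemma tensor_rcons_ind (P : tensor_alg HA -> Prop) :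
    P 0 -> (forall a u v, P u -> P v -> P (a *: u + v)) ->
    (forall r, P (inR r)) -> (forall w h, P w -> P (w * inH h)) -> forall u, P u.
Proof.
move=> P0 Plin PR Pstep; apply: tensor_homog_ind => //.
by apply: (@gr_ind (fun _ u => P u)) => // i *; [apply: Plin | apply: Pstep].
Qed.

Lemma grM i j u v : gr i u -> gr j v -> gr (i + j) (u * v).
Proof.
move=> gu; move: j v; apply: gr_ind => [i'|i' a x y _ _ gx gy|r|j w h _ gw].
- by rewrite mulr0; apply: gr0.
- by rewrite mulrDr -scalerAr; apply: gr_lin.
- rewrite addr0; move: i u gu; apply: gr_ind => [i'|i' a x y _ _ gx gy|r'|i w h gw _].
  + by rewrite mul0r; apply: gr0.
  + by rewrite mulrDl -scalerAl; apply: gr_lin.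
  + by rewrite -inRM; apply: gr_inR.
  rewrite -mulrA inH_inR; case/gr_cases: gw => [->|[n [x [-> ->]]]].
    by rewrite mul0r; apply: gr0.
  rewrite inHE -[_ * _]/(tensor_mul _ _) tensor_mul_inj.
  exact: (@gr_inj K T (n + 1)).
rewrite mulrA; case/gr_cases: gw => [->|[n [x [eij ->]]]].
  by rewrite mul0r; apply: gr0.
rewrite inHE -[_ * _]/(tensor_mul _ _) tensor_mul_inj addrA eij.
exact: (@gr_inj K T (n + 1)).
Qed.

Lemma gr1 : gr 0 (1 : tensor_alg HA). Proof. exact: gr_inR. Qed.

End Generators.

(** * Sums over the coproduct *)

Section Sweedler.
Variables (K : fieldType) (R H : algType K) (HA : hopf_algebroid R H).
Local Notation al := (alpha HA).
Local Notation be := (beta HA).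
Local Notation T := (tpow al be).
Local Notation tp := (tpure al be).
Local Notation inH := (@inH K R H HA).
Local Notation inR := (@inR K R H HA).
Local Notation tl := (@tlift K R H al be _ _).

Definition tDelta (h : H) : tensor_alg HA := dinj (Delta HA h).

Lemma tDelta_linear : linear tDelta.
Proof. by move=> a x y; rewrite /tDelta linearP linearP. Qed.
HB.instance Definition _ :=
  GRing.isLinear.Build K H (tensor_alg HA) *:%R tDelta tDelta_linear.

Definition pair_word (a b : H) (i : 'I_2) : H := if i == ord0 then a else b.

Lemma pair_word_codom a b : codom (pair_word a b) = [:: a; b].
Proof.
rewrite -[RHS](@codom_nth _ _ _ 2) //; apply: eq_codom.
case=> [[|[|m]] i] //.
Qed.

Lemma dinj_pair a b : dinj (tp (pair_word a b)) = inH a * inH b.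
Proof. by rewrite word_codom pair_word_codom -word_cat. Qed.

Lemma pair_wordE (v : 'I_2 -> H) : v = pair_word (v ord0) (v ord_max).
Proof.
apply: funext => i; rewrite /pair_word; case: eqP => [->//|].
case: i => [[|[|m]] p] ne //; first by case: ne; apply: val_inj.
by congr v; apply: val_inj.
Qed.

Lemma sum_of_pairs (t : T 2) :
  exists s : seq (H * H), t = \sum_(p <- s) tp (pair_word p.1 p.2).
Proof.
elim/tpow_ind: t => [|a x y [s ->] [s' ->]|v]; first by exists [::]; rewrite big_nil.
  exists ([seq (a *: p.1, p.2) | p <- s] ++ s').
  rewrite big_cat big_map scaler_sumr; congr (_ + _); apply: eq_bigr => p _.
  apply: (@dinj_inj _ T 2); rewrite linearZ /= !dinj_pair linearZ /=.
  by rewrite -scalerAl.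
by exists [:: (v ord0, v ord_max)]; rewrite big_seq1 -pair_wordE.
Qed.

(** A chosen expression of the coproduct as a sum of pure tensors, so that sums in
    Sweedler notation are plain finite sums; [sw_rep] removes the choice. *)
Definition sweedler h : seq (H * H) := sval (cid (sum_of_pairs (Delta HA h))).

Lemma sweedlerE h : tDelta h = \sum_(p <- sweedler h) inH p.1 * inH p.2.
Proof.
rewrite /tDelta [in LHS](svalP (cid (sum_of_pairs (Delta HA h)))) raddf_sum.
by apply: eq_bigr => p _; apply: dinj_pair.
Qed.

Section Bilinear.
Variable V : lmodType K.
Implicit Type f : H -> H -> V.

Definition bibalanced f :=
  [/\ forall b, linear (f^~ b), forall a, linear (f a) &
      forall r a b, f (be r * a) b = f a (al r * b)].

Definition sw f h : V := \sum_(p <- sweedler h) f p.1 p.2.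

Let bimul f : bibalanced f ->
  multilinear (fun v : 'I_2 -> H => f (v ord0) (v ord_max)).
Proof.
case=> fl fr _ v i a x y; rewrite /upd.
have [->|] := eqVneq i ord0; first exact: fl.
by case: i => [[|[]]] // *; apply: fr.
Qed.

Let bibal f : bibalanced f ->
  balanced al be (fun v : 'I_2 -> H => f (v ord0) (v ord_max)).
Proof.
case=> _ _ fb v i j r; rewrite /upd.
case: i => [[|[]]] //= i0; case: j => [[|[]]] //= j1 _.
rewrite fb.
by congr f; [congr v | congr (_ * v _)]; apply: val_inj.
Qed.

Lemma tlift2 f h s : bibalanced f -> tDelta h = \sum_(p <- s) inH p.1 * inH p.2 ->
  tl (fun v : 'I_2 -> H => f (v ord0) (v ord_max)) (Delta HA h)
  = \sum_(p <- s) f p.1 p.2.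
Proof.
move=> fB; set F := tl _ => E.
have -> : Delta HA h = \sum_(p <- s) tp (pair_word p.1 p.2).
  apply: (@dinj_inj _ T 2); rewrite -/(tDelta h) E raddf_sum.
  by apply/esym/eq_bigr => p _; apply: dinj_pair.
have Flin : linear F by apply: tlift_linear; [apply: bimul | apply: bibal].
elim: s {E} => [|p s IHs]; first by rewrite !big_nil (linear_fun0 Flin).
rewrite !big_cons -[tp _]scale1r Flin IHs scale1r /F tlift_pure //.
  exact: bimul.
exact: bibal.
Qed.

(** Both sides are the value at the coproduct of the linear map on the second
    tensor power that [f] defines. *)
Lemma sw_rep f h s : bibalanced f -> tDelta h = \sum_(p <- s) inH p.1 * inH p.2 ->
  sw f h = \sum_(p <- s) f p.1 p.2.
Proof. by move=> fB E; rewrite -(tlift2 fB E) (tlift2 fB (sweedlerE h)). Qed.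

Lemma tlift_sw f h : bibalanced f ->
  tl (fun v : 'I_2 -> H => f (v ord0) (v ord_max)) (Delta HA h) = sw f h.
Proof. by move/tlift2/(_ (sweedlerE h)). Qed.

Lemma sw_linear f : bibalanced f -> linear (sw f).
Proof.
move=> fB a x y; rewrite -!(tlift_sw _ fB) linearP.
by apply: tlift_linear; [apply: bimul | apply: bibal].
Qed.

Lemma eq_sw f g h : (forall a b, f a b = g a b) -> sw f h = sw g h.
Proof. by move=> fg; apply: eq_bigr. Qed.

Lemma tDelta_al r h : tDelta (al r * h) = inR r * tDelta h.
Proof.
rewrite /tDelta Delta_left.
exact: esym (@tensor_mul_inj _ _ _ HA 0 2 r (Delta HA h)).
Qed.

Lemma tDelta_be r h : tDelta (be r * h) = tDelta h * inR r.
Proof.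
by rewrite /tDelta Delta_right [RHS](@tensor_mul_inj _ _ _ HA 2 0 _ r) dinj_ecast.
Qed.

Lemma tDelta1 : tDelta 1 = inH 1 * inH 1.
Proof. by rewrite /tDelta Delta_one dinj_pair. Qed.

Lemma sw_al f r h : bibalanced f ->
  sw f (al r * h) = sw (fun a b => f (al r * a) b) h.
Proof.
move=> fB; rewrite (@sw_rep f _ [seq (al r * p.1, p.2) | p <- sweedler h]) ?big_map //.
rewrite tDelta_al sweedlerE mulr_sumr; apply: eq_bigr => p _.
by rewrite mulrA inR_inH.
Qed.

Lemma sw_be f r h : bibalanced f ->
  sw f (be r * h) = sw (fun a b => f a (be r * b)) h.
Proof.
move=> fB; rewrite (@sw_rep f _ [seq (p.1, be r * p.2) | p <- sweedler h]) ?big_map //.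
rewrite tDelta_be sweedlerE mulr_suml; apply: eq_bigr => p _.
by rewrite -mulrA inH_inR.
Qed.

Lemma sw1 f : bibalanced f -> sw f 1 = f 1 1.
Proof.
move=> fB; rewrite (@sw_rep f _ [:: (1, 1)]) ?big_seq1 //.
exact: tDelta1.
Qed.

End Bilinear.

Lemma sw_raddf (V V' : lmodType K) (g : V -> V') f h : linear g ->
  g (sw f h) = sw (fun a b => g (f a b)) h.
Proof.
move=> gl; rewrite /sw; elim: (sweedler h) => [|p s IHs].
  by rewrite !big_nil (linear_fun0 gl).
by rewrite !big_cons -[f _ _]scale1r gl IHs !scale1r.
Qed.

Lemma sw_mull (f : H -> H -> tensor_alg HA) h (u : tensor_alg HA) :
  sw f h * u = sw (fun a b => f a b * u) h.
Proof. exact: mulr_suml. Qed.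

Lemma sw_mulr (f : H -> H -> tensor_alg HA) h (u : tensor_alg HA) :
  u * sw f h = sw (fun a b => u * f a b) h.
Proof. exact: mulr_sumr. Qed.

Lemma mul_linl (u : tensor_alg HA) (V : lmodType K) (g : V -> tensor_alg HA) :
  linear g -> linear (fun x => g x * u).
Proof. by move=> gl a x y; rewrite gl mulrDl scalerAl. Qed.
Lemma mul_linr (u : tensor_alg HA) (V : lmodType K) (g : V -> tensor_alg HA) :
  linear g -> linear (fun x => u * g x).
Proof. by move=> gl a x y; rewrite gl mulrDr scalerAr. Qed.

Lemma inH_linl (h : H) : linear (fun x => inH (x * h)).
Proof. by move=> a x y; rewrite mulrDl -scalerAl linearP. Qed.

Lemma bibalanced_inH : bibalanced (fun a b => inH a * inH b).
Proof.
split=> [b|a|r a b].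
- exact/mul_linl/linearP.
- exact/mul_linr/linearP.
by rewrite -inH_inR -inR_inH mulrA.
Qed.

Lemma sw_tDelta h : sw (fun a b => inH a * inH b) h = tDelta h.
Proof. exact/esym/sweedlerE. Qed.

Lemma tright_cod n (h u : 'I_n.+1 -> H) :
  dinj (tp (fun i => h i * u i)) =
  word HA [seq p.1 * p.2 | p <- zip (codom h) (codom u)].
Proof.
rewrite word_codom; congr word; apply: (@eq_from_nth _ 0) => [|i].
  by rewrite size_codom [RHS]size_map size_zip !size_codom !card_ord minnn.
rewrite size_codom card_ord => lti.
rewrite (nth_codom_ord _ (Ordinal lti)).
rewrite (nth_map (0, 0)) ?size_zip ?size_codom ?card_ord ?minnn //.
rewrite nth_zip ?size_codom ?card_ord //=.
by rewrite (nth_codom_ord _ (Ordinal lti)) (nth_codom_ord _ (Ordinal lti)).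
Qed.

Let zipm (u h : seq H) := [seq p.1 * p.2 | p <- zip h u].

Lemma zipm_split u s1 a s2 : size u = (size s1 + (size s2).+1)%N ->
  zipm u (s1 ++ a :: s2) = zipm (take (size s1) u) s1 ++
   a * nth 0 u (size s1) :: zipm (drop (size s1).+1 u) s2.
Proof.
move=> szu.
have lt1 : (size s1 < size u)%N by rewrite szu -addSnnS leq_addr.
rewrite -{1}(cat_take_drop (size s1) u) (drop_nth 0) //.
by rewrite /zipm zip_cat ?size_takel 1?ltnW // map_cat.
Qed.

Lemma tright_mul n (u : 'I_n.+1 -> H) :
  multilinear (fun h : 'I_n.+1 -> H => tp (fun i => h i * u i)).
Proof.
move=> v i a x y; apply: (@dinj_inj _ T n.+1).
rewrite linearP /= !tright_cod !codom_upd -!/(zipm _ _).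
have sz : size (take i (codom v)) = i.
  by rewrite size_takel // size_codom card_ord ltnW.
have szu : size (codom u) = (size (take i (codom v)) + (size (drop i.+1 (codom v))).+1)%N.
  by rewrite sz size_drop !size_codom !card_ord -addSnnS subnKC.
rewrite !zipm_split // mulrDl -scalerAl.
exact: word_linear.
Qed.

(** Right multiplication of the entries commutes with the left multiplications by
    [al r] and [be r] that define the bimodule structure. *)
Lemma tright_bal n (u : 'I_n.+1 -> H) :
  balanced al be (fun h : 'I_n.+1 -> H => tp (fun i => h i * u i)).
Proof.
move=> v i j r ji.
pose w k := v k * u k.
have E k x : (fun l => upd v k (x * v k) l * u l) = upd w k (x * w k).
  by apply: funext => l; rewrite /upd /w; case: eqP => // ->; rewrite mulrA.
by rewrite !E; apply: tpure_balanced.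
Qed.

Lemma tright_linear n (u : 'I_n.+1 -> H) : linear (fun t : T n.+1 => tright t u).
Proof. apply: tlift_linear; [exact: tright_mul | exact: tright_bal]. Qed.

Lemma tright_pure n (h u : 'I_n.+1 -> H) :
  tright (tp h) u = tp (fun i => h i * u i).
Proof. apply: tlift_pure; [exact: tright_mul | exact: tright_bal]. Qed.

Lemma tright_pair a b x y :
  dinj (tright (tp (pair_word a b)) (pair_word x y)) = inH (a * x) * inH (b * y).
Proof.
rewrite tright_pure -dinj_pair; congr (dinj (tp _)).
by apply: funext => i; rewrite /pair_word; case: ifP.
Qed.

Lemma tright_Delta h x y :
  dinj (tright (Delta HA h) (pair_word x y)) =
  sw (fun a b => inH (a * x) * inH (b * y)) h.
Proof.
rewrite /sw; have -> : Delta HA h = \sum_(p <- sweedler h) tp (pair_word p.1 p.2).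
  apply: (@dinj_inj _ T 2); rewrite -/(tDelta h) sweedlerE raddf_sum.
  by apply/esym/eq_bigr => p _; apply: dinj_pair.
elim: (sweedler h) => [|p s IHs].
  by rewrite !big_nil (linear_fun0 (@tright_linear 1 _)) linear0.
rewrite !big_cons -[tp _]scale1r (@tright_linear 1) linearP /= IHs /= scale1r.
by rewrite tright_pair.
Qed.

Section BilinearMul.
Variable V : lmodType K.
Implicit Type f : H -> H -> V.

(** The linear map is the lift of the function on words which is [f] in length 2
    and zero in all other lengths. *)
Lemma bibalanced_universal f : bibalanced f ->
  exists2 F : tensor_alg HA -> V, linear F & forall a b, F (inH a * inH b) = f a b.
Proof.
move=> [fl fr fb].
pose G s := if s is [:: a; b] then f a b else 0.
have Glin : seq_linear G.
  move=> [|x [|y s1]] [|z [|t s2]] a p q /=;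
    rewrite ?scaler0 ?addr0 ?fr ?fl //.
  all: try by case: s1 => [|? ?]; rewrite scaler0 addr0.
have Gbal : seq_balanced al be G.
  by move=> [|x [|y [|w s1]]] [|z s2] a b r //=; apply: fb.
exists (tensor_lift (HA := HA) (fun=> 0) G).
  by apply: tensor_lift_linear => // a x y; rewrite scaler0 addr0.
move=> a b; rewrite -word_cat tensor_lift_word //.
by move=> c x y; rewrite scaler0 addr0.
Qed.

Lemma sw_takeuchi f r h : bibalanced f ->
  sw (fun a b => f (a * be r) b) h = sw (fun a b => f a (b * al r)) h.
Proof.
case/bibalanced_universal=> F Flin FE.
have := Delta_takeuchi HA h r; rewrite -!/(pair_word _ _).
move=> /subr0_eq/(congr1 (@dinj _ T 2)).
rewrite !tright_Delta => /(congr1 F); rewrite !(sw_raddf _ _ Flin).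
rewrite (eq_sw (g := fun a b => f (a * be r) b)).
  by move->; apply: eq_sw => a b; rewrite FE mulr1.
by move=> a b; rewrite FE mulr1.
Qed.

End BilinearMul.

Lemma bibalanced_mulr (V : lmodType K) (f : H -> H -> V) c d :
  bibalanced f -> bibalanced (fun a b => f (a * c) (b * d)).
Proof.
case=> [fl fr fb]; split=> [b|a|r a b].
- by move=> k x y; rewrite mulrDl -scalerAl fl.
- by move=> k x y; rewrite mulrDl -scalerAl fr.
by rewrite -!mulrA fb.
Qed.

(** Balancing in the second pair of factors is the Takeuchi condition on [x]. *)
Lemma bibalanced_mul (V : lmodType K) (f : H -> H -> V) x : bibalanced f ->
  bibalanced (fun c d => sw (fun a b => f (a * c) (b * d)) x).
Proof.
move=> fB; have [fl fr fb] := fB; split=> [b|a|r a b].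
- move=> c p q; rewrite /sw scaler_sumr -big_split; apply: eq_bigr => i _ /=.
  by rewrite mulrDr -scalerAr fl.
- move=> c p q; rewrite /sw scaler_sumr -big_split; apply: eq_bigr => i _ /=.
  by rewrite mulrDr -scalerAr fr.
rewrite (eq_sw (g := fun p q => f (p * be r * a) (q * b))); last first.
  by move=> p q; rewrite mulrA.
rewrite (sw_takeuchi r x (bibalanced_mulr a b fB)).
by apply: eq_sw => p q; rewrite mulrA.
Qed.

Lemma sw_mul (V : lmodType K) (f : H -> H -> V) x y : bibalanced f ->
  sw f (x * y) = sw (fun a b => sw (fun c d => f (a * c) (b * d)) y) x.
Proof.
move=> /[dup] fB /bibalanced_universal [F Flin FE].
have -> : sw f (x * y) = F (tDelta (x * y)).
  by rewrite -sw_tDelta sw_raddf //; apply: eq_sw => a b; rewrite FE.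
rewrite /tDelta Delta_mul /tmul.
have -> : @tright K R H al be 1 (Delta HA x)
   = (fun v => tright (Delta HA x) (pair_word (v ord0) (v ord_max))).
  by apply: funext => v; rewrite -pair_wordE.
have B : bibalanced (fun a b => tright (Delta HA x) (pair_word a b)).
  have [l r b] := bibalanced_mul x bibalanced_inH.
  split=> [d|c|r' c d]; [move=> e p q | move=> e p q |];
    apply: (@dinj_inj _ T 2); rewrite ?[RHS]linearP /= !tright_Delta.
  - exact: l.
  - exact: r.
  exact: b.
rewrite (tlift_sw _ B) (raddf_sum (@dinj _ T 2)) /=.
rewrite -[X in F X]/(sw (fun a b => dinj (tright (Delta HA x) (pair_word a b))) y).
rewrite (sw_raddf _ _ Flin) /sw exchange_big /=; apply: eq_bigr => p _.
rewrite tright_Delta (sw_raddf _ _ Flin).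
by apply: eq_bigr => q _; rewrite FE.
Qed.

Lemma sw_mul_swap (V : lmodType K) (f : H -> H -> V) x y : bibalanced f ->
  sw f (x * y) = sw (fun c d => sw (fun a b => f (a * c) (b * d)) x) y.
Proof. by move=> fB; rewrite sw_mul // /sw exchange_big. Qed.

Lemma sw_mul_al (V : lmodType K) (f : H -> H -> V) x r : bibalanced f ->
  sw f (x * al r) = sw (fun a b => f (a * al r) b) x.
Proof.
move=> fB; have fB' := bibalanced_mul x fB.
rewrite sw_mul_swap // -[al r]mulr1 sw_al // sw1; last first.
  case: fB' => l m b; split=> [d|c|r' c d].
  - by move=> k p q; rewrite mulrDr -scalerAr l.
  - exact: m.
  by rewrite mulrA alpha_beta -mulrA b.
by apply: eq_sw => a b; rewrite !mulr1.
Qed.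

Lemma bibalanced_comp (V V' : lmodType K) (f : H -> H -> V) (F : V -> V') :
  linear F -> bibalanced f -> bibalanced (fun a b => F (f a b)).
Proof.
move=> Fl [fl fr fb]; split=> [b|a|r a b].
- by move=> c x y; rewrite fl Fl.
- by move=> c x y; rewrite fr Fl.
by rewrite fb.
Qed.

Lemma bibalanced_tDelta_l : bibalanced (fun a b => tDelta a * inH b).
Proof.
split=> [b|a|r a b].
- exact/mul_linl/linearP.
- exact/mul_linr/linearP.
by rewrite tDelta_be -inR_inH mulrA.
Qed.

Lemma bibalanced_tDelta_r : bibalanced (fun a b => inH a * tDelta b).
Proof.
split=> [b|a|r a b].
- exact/mul_linl/linearP.
- exact/mul_linr/linearP.
by rewrite tDelta_al -inH_inR mulrA.
Qed.

Lemma sw_coassoc_tDelta h :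
  sw (fun a b => tDelta a * inH b) h = sw (fun a b => inH a * tDelta b) h.
Proof.
have := Delta_coassoc HA h => /(congr1 (@dinj _ T 3)).
have E1 a b : dinj (tcat (Delta HA a) (tone al be b)) = tDelta a * inH b.
  by rewrite inHE; apply: esym (@tensor_mul_inj _ _ _ HA 2 1 _ _).
have E2 a b : dinj (tcat (tone al be a) (Delta HA b)) = inH a * tDelta b.
  by rewrite inHE; apply: esym (@tensor_mul_inj _ _ _ HA 1 2 _ _).
rewrite (@tlift_sw _ (fun a b => tcat (Delta HA a) (tone al be b))); last first.
  have [l r b] := bibalanced_tDelta_l.
  split=> [x|x|x y z]; [move=> c y z | move=> c y z |];
    apply: (@dinj_inj _ T 3); rewrite ?[in RHS]linearP /= !E1; [exact: l|exact: r|exact: b].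
rewrite (@tlift_sw _ (fun a b => tcat (tone al be a) (Delta HA b))); last first.
  have [l r b] := bibalanced_tDelta_r.
  split=> [x|x|x y z]; [move=> c y z | move=> c y z |];
    apply: (@dinj_inj _ T 3); rewrite ?[in RHS]linearP /= !E2; [exact: l|exact: r|exact: b].
rewrite !(raddf_sum (@dinj _ T 3)) /=.
move=> E; rewrite /sw -(eq_bigr _ (fun p _ => E1 p.1 p.2)).
by rewrite -(eq_bigr _ (fun p _ => E2 p.1 p.2)).
Qed.

(** The identity in the third tensor power is transported along the linear map
    that the trilinear function [f] defines on words of length 3. *)
Lemma sw_coassoc (V : lmodType K) (f : H -> H -> H -> V) h :
  (forall b c, linear (fun a => f a b c)) ->
  (forall a c, linear (fun b => f a b c)) ->
  (forall a b, linear (f a b)) ->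
  (forall r a b c, f (be r * a) b c = f a (al r * b) c) ->
  (forall r a b c, f a (be r * b) c = f a b (al r * c)) ->
  sw (fun a c => sw (fun a1 a2 => f a1 a2 c) a) h =
  sw (fun a c => sw (fun b1 b2 => f a b1 b2) c) h.
Proof.
move=> f1 f2 f3 f12 f23.
pose G s := if s is [:: a; b; c] then f a b c else 0.
have Glin : seq_linear G.
  move=> [|x [|y [|w s1]]] [|z [|t [|v s2]]] a p q /=;
    rewrite ?scaler0 ?addr0 ?f1 ?f2 ?f3 //.
  all: try by case: s1 => [|? ?]; rewrite scaler0 addr0.
  all: try by case: s2 => [|? ?]; rewrite scaler0 addr0.
have Gbal : seq_balanced al be G.
  move=> [|x [|y [|w s1]]] [|z [|t s2]] a b r //=.
  all: try by case: s1 => //.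
have l0 : linear (fun _ : R => 0 : V) by move=> a x y; rewrite scaler0 addr0.
pose F := tensor_lift (HA := HA) (fun=> 0) G.
have Fl : linear F by apply: tensor_lift_linear.
have FE a b c : F (inH a * inH b * inH c) = f a b c.
  by rewrite -!word_cat /F tensor_lift_word.
have := congr1 F (sw_coassoc_tDelta h).
rewrite !(sw_raddf _ _ Fl) => E.
transitivity (sw (fun a b => F (tDelta a * inH b)) h).
  apply: eq_sw => a b; rewrite -sw_tDelta sw_mull (sw_raddf _ _ Fl).
  by apply: eq_sw => x y; rewrite FE.
rewrite E; apply: eq_sw => a b; rewrite -sw_tDelta sw_mulr (sw_raddf _ _ Fl).
by apply: eq_sw => x y; rewrite mulrA FE.
Qed.

(** The difference of the two arguments is the product of [h] with an element of
    the kernel of the counit, which is a left ideal. *)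
Lemma eps_mul_be r h : epsilon HA (h * be r) = epsilon HA (h * al r).
Proof.
apply/eqP; rewrite -subr_eq0 -linearB -mulrBr; apply/eqP/epsilon_ker.
by rewrite linearB -[al r]mulr1 -[be r]mulr1 epsilon_left epsilon_right
  epsilon_one mulr1 mul1r subrr.
Qed.

Lemma eps_mul x y : epsilon HA (x * y) = epsilon HA (x * al (epsilon HA y)).
Proof.
apply/eqP; rewrite -subr_eq0 -linearB -mulrBr; apply/eqP/epsilon_ker.
by rewrite linearB -[al _]mulr1 epsilon_left epsilon_one mulr1 subrr.
Qed.

Lemma bibalanced_epsl : bibalanced (fun a b => al (epsilon HA a) * b).
Proof.
split=> [b|a|r a b].
- by move=> c x y; rewrite !linearP mulrDl scalerAl.
- by move=> c x y; rewrite mulrDr scalerAr.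
by rewrite epsilon_right rmorphM mulrA.
Qed.

Lemma bibalanced_epsr : bibalanced (fun a b => be (epsilon HA b) * a).
Proof.
split=> [b|a|r a b].
- by move=> c x y; rewrite mulrDr scalerAr.
- by move=> c x y; rewrite !linearP mulrDl scalerAl.
by rewrite epsilon_left beta_anti mulrA.
Qed.

Lemma sw_counitl h : sw (fun a b => al (epsilon HA a) * b) h = h.
Proof. by rewrite -(tlift_sw _ bibalanced_epsl) counit_left. Qed.

Lemma sw_counitr h : sw (fun a b => be (epsilon HA b) * a) h = h.
Proof. by rewrite -(tlift_sw _ bibalanced_epsr) counit_right. Qed.

End Sweedler.

(** * The action on tensor powers *)

Section Action.
Variables (K : fieldType) (R H : algType K) (HA : hopf_algebroid R H).
Local Notation al := (alpha HA).
Local Notation be := (beta HA).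
Local Notation eps := (epsilon HA).
Local Notation T := (tpow al be).
Local Notation tp := (tpure al be).
Local Notation word := (@word K R H HA).
Local Notation inH := (@inH K R H HA).
Local Notation inR := (@inR K R H HA).
Local Notation gr := (@dsum_homog K T).
Implicit Types (r : R) (h g : H) (u v w : tensor_alg HA) (s t : seq H).

(** The action on the word whose letters are listed in [t] from the last one to
    the first: the recursion of Delta^n = (Delta^(n-1) (x) id) Delta splits off the
    last letter. *)
Fixpoint act_rev t h : tensor_alg HA :=
  if t is g :: t' then sw HA (fun a b => act_rev t' a * inH (b * g)) h
  else inR (eps h).

Lemma act_rev_bibal t : linear (act_rev t) /\
  (forall r h, act_rev t (be r * h) = act_rev t h * inR r) /\
  (forall r h, act_rev t (al r * h) = inR r * act_rev t h).
Proof.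
elim: t => [|g t [IHl [IHb IHa]]] /=.
  split=> [a x y|]; first by rewrite linearP [LHS]linearP.
  by split=> r h; rewrite ?epsilon_right ?epsilon_left inRM.
have B : bibalanced HA (fun a b => act_rev t a * inH (b * g)).
  split=> [b|a|r a b].
  - exact: mul_linl.
  - exact/mul_linr/inH_linl.
  by rewrite IHb -mulrA inR_inH mulrA.
split; first exact: sw_linear.
split=> r h; rewrite ?(sw_be _ _ B) ?(sw_al _ _ B).
  by rewrite sw_mull; apply: eq_sw => a b; rewrite -[RHS]mulrA inH_inR mulrA.
by rewrite sw_mulr; apply: eq_sw => a b; rewrite IHa mulrA.
Qed.

Lemma act_rev_linear t : linear (act_rev t). Proof. by case: (act_rev_bibal t). Qed.
Lemma act_rev_be t r h : act_rev t (be r * h) = act_rev t h * inR r.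
Proof. by case: (act_rev_bibal t) => _ []. Qed.
Lemma act_rev_al t r h : act_rev t (al r * h) = inR r * act_rev t h.
Proof. by case: (act_rev_bibal t) => _ []. Qed.

Lemma sw_comb (V : lmodType K) (f1 f2 f3 : H -> H -> V) (c : K) h :
  (forall a b, f3 a b = c *: f1 a b + f2 a b) ->
  sw HA f3 h = c *: sw HA f1 h + sw HA f2 h.
Proof.
by move=> E; rewrite /sw scaler_sumr -big_split; apply: eq_bigr => p _; apply: E.
Qed.

Lemma act_rev_linear_word h : seq_linear (fun s => act_rev (rev s) h).
Proof.
suff key t1 t2 h' : linear (fun a => act_rev (t1 ++ a :: t2) h').
  by move=> s1 s2 a x y; rewrite !rev_cat !rev_cons !cat_rcons key.
elim: t1 h' => [|g t1 IHt] h' c x y /=; apply: sw_comb => a b.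
  by rewrite mulrDr -scalerAr linearP mulrDr -scalerAr.
by rewrite IHt mulrDl -scalerAl.
Qed.

Lemma inH2_balanced g r a b :
  inH (be r * a * g) * inH b = inH (a * g) * inH (al r * b).
Proof. by rewrite -mulrA -inH_inR -inR_inH mulrA. Qed.

(** For the two letters concerned, coassociativity moves both coproducts to the
    same factor, where the Takeuchi condition applies. *)
Lemma act_rev_balanced_word h : seq_balanced al be (fun s => act_rev (rev s) h).
Proof.
suff key t1 t2 a b r h' :
    act_rev (t1 ++ b :: be r * a :: t2) h' = act_rev (t1 ++ al r * b :: a :: t2) h'.
  by move=> s1 s2 a b r; rewrite !rev_cat !rev_cons !cat_rcons key.
elim: t1 h' => [|g t1 IHt] h' /=; last by apply: eq_sw => c d; rewrite IHt.
pose f x y p q z := act_rev t2 p * inH (q * x) * inH (z * y).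
have coassoc x y : sw HA (fun p q =>
      sw HA (fun p' q' => act_rev t2 p' * inH (q' * x)) p * inH (q * y)) h' =
    sw HA (fun p q => sw HA (fun q1 q2 => f x y p q1 q2) q) h'.
  rewrite -(@sw_coassoc _ _ _ _ _ (f x y)).
  - by apply: eq_sw => p q; rewrite sw_mull.
  - by move=> q z; apply/mul_linl/mul_linl/act_rev_linear.
  - by move=> p z; apply/mul_linl/mul_linr/inH_linl.
  - by move=> p q; apply/mul_linr/inH_linl.
  - by move=> r' p q z; rewrite /f act_rev_be -[al r' * q * x]mulrA -inR_inH !mulrA.
  move=> r' p q z; rewrite /f -!(mulrA (act_rev t2 p)) -[al r' * z * y]mulrA.
  by rewrite inH2_balanced.
rewrite !coassoc; apply: eq_sw => p q.
pose F x y := act_rev t2 p * inH (x * a) * inH (y * b).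
have FB : bibalanced HA F.
  split=> [z|x|r' x z].
  - exact/mul_linl/mul_linr/inH_linl.
  - exact/mul_linr/inH_linl.
  by rewrite /F -!(mulrA (act_rev t2 p)) -[al r' * z * b]mulrA inH2_balanced.
transitivity (sw HA (fun c d => F (c * be r) d) q).
  by apply: eq_sw => c d; rewrite /F /f mulrA.
by rewrite sw_takeuchi //; apply: eq_sw => c d; rewrite /F /f mulrA.
Qed.

Definition act h (w : tensor_alg HA) : tensor_alg HA :=
  tensor_lift (fun r => inR (eps (h * al r))) (fun s => act_rev (rev s) h) w.

Let actR_lin h : linear (fun r => inR (eps (h * al r))).
Proof.
by move=> a x y; rewrite linearP mulrDr -scalerAr linearP [LHS]linearP.
Qed.

Lemma act_linear h : linear (act h).
Proof.
apply: tensor_lift_linear; first exact: actR_lin.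
  exact: act_rev_linear_word.
exact: act_rev_balanced_word.
Qed.
HB.instance Definition _ h :=
  GRing.isLinear.Build K (tensor_alg HA) (tensor_alg HA) *:%R (act h) (act_linear h).

Lemma act_inR h r : act h (inR r) = inR (eps (h * al r)).
Proof.
apply: tensor_lift_inR; first exact: actR_lin.
  exact: act_rev_linear_word.
exact: act_rev_balanced_word.
Qed.

Lemma act_word h g s : act h (word (g :: s)) = act_rev (rev (g :: s)) h.
Proof.
apply: tensor_lift_word; first exact: actR_lin.
  exact: act_rev_linear_word.
exact: act_rev_balanced_word.
Qed.

Lemma act_linearl w : linear (fun h => act h w).
Proof.
elim/tensor_ind: w => [|a x y lx ly|r|g s].
- by apply: linear_cst0 => h; rewrite linear0.
- by apply: (linear_comb (a := a) lx ly) => h; rewrite linearP.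
- move=> a x y; rewrite !act_inR mulrDl -scalerAl linearP [LHS]linearP //.
by move=> a x y; rewrite !act_word act_rev_linear.
Qed.

Lemma act_be r h w : act (be r * h) w = act h w * inR r.
Proof.
elim/tensor_ind: w => [|a x y Ex Ey|r'|g s].
- by rewrite !linear0 mul0r.
- by rewrite !linearP /= Ex Ey mulrDl -scalerAl.
- by rewrite !act_inR -mulrA epsilon_right inRM.
by rewrite !act_word act_rev_be.
Qed.

Lemma act_al r h w : act (al r * h) w = inR r * act h w.
Proof.
elim/tensor_ind: w => [|a x y Ex Ey|r'|g s].
- by rewrite !linear0 mulr0.
- by rewrite !linearP /= Ex Ey mulrDr -scalerAr.
- by rewrite !act_inR -mulrA epsilon_left inRM.
by rewrite !act_word act_rev_al.
Qed.

Lemma bibal_act_inH w g : bibalanced HA (fun a b => act a w * inH (b * g)).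
Proof.
split=> [b|a|r a b].
- exact/mul_linl/act_linearl.
- exact/mul_linr/inH_linl.
by rewrite act_be -mulrA inR_inH mulrA.
Qed.

(** For [w] in [R] this is the left counit property applied to [h * al r]. *)
Lemma act_step h w g :
  act h (w * inH g) = sw HA (fun a b => act a w * inH (b * g)) h.
Proof.
elim/tensor_ind: w => [|c x y Ex Ey|r|k s].
- rewrite mul0r linear0 /sw big1 // => p _; by rewrite linear0 mul0r.
- rewrite mulrDl -scalerAl linearP /= Ex Ey; apply/esym/sw_comb => a b.
  by rewrite linearP /= mulrDl -scalerAl.
- rewrite inR_inH [LHS]act_word /= -[h in LHS]mul1r.
  have mulk k : linear (fun b : H => b * k).
    by move=> c x y; rewrite mulrDl scalerAl.
  transitivity (inH (h * (al r * g))).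
    rewrite mul1r -[h in RHS](sw_counitl HA) (sw_raddf HA _ _ (mulk _)).
    rewrite (sw_raddf HA _ _ (linearP _)); apply: eq_sw => a b.
    by rewrite inR_inH mulrA.
  rewrite mulrA -[h * al r](sw_counitl HA) (sw_raddf HA _ _ (mulk g)).
  rewrite (sw_raddf HA _ _ (linearP _)) sw_mul_al; last first.
    apply: bibalanced_comp (linearP _) _.
    exact: bibalanced_comp (mulk g) (bibalanced_epsl HA).
  by apply: eq_sw => a b; rewrite act_inR inR_inH mulrA.
rewrite -word_rcons rcons_cons act_word -rcons_cons rev_rcons.
by apply: eq_sw => a b; rewrite act_word.
Qed.

Lemma act1 h : act h 1 = inR (eps h).
Proof. by rewrite -inR1 act_inR rmorph1 mulr1. Qed.

Lemma act_inH h g : act h (inH g) = inH (h * g).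
Proof.
have mulk : linear (fun b : H => b * g).
  by move=> c x y; rewrite mulrDl scalerAl.
rewrite -[inH g]mul1r act_step -[h in RHS](sw_counitl HA).
rewrite (sw_raddf HA _ _ mulk) (sw_raddf HA _ _ (linearP _)).
by apply: eq_sw => a b; rewrite act1 inR_inH mulrA.
Qed.

Lemma act_id w : act 1 w = w.
Proof.
elim/tensor_rcons_ind: w => [|a x y Ex Ey|r|w g IHw]; first by rewrite linear0.
- by rewrite linearP /= Ex Ey.
- by rewrite act_inR mul1r -[al r]mulr1 epsilon_left epsilon_one mulr1.
by rewrite act_step sw1 ?IHw ?mul1r //; apply: bibal_act_inH.
Qed.

Lemma act_comp g h w : act (g * h) w = act g (act h w).
Proof.
elim/tensor_rcons_ind: w g h => [|a x y Ex Ey|r|w k IHw] g h.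
- by rewrite !linear0.
- by rewrite !linearP /= Ex Ey.
- by rewrite !act_inR -mulrA eps_mul.
rewrite !act_step sw_mul_swap; last exact: bibal_act_inH.
rewrite (sw_raddf HA _ _ (act_linear g)); apply: eq_sw => c d.
by rewrite act_step; apply: eq_sw => a b; rewrite IHw mulrA.
Qed.

(** Coassociativity in the form needed to extend multiplicativity by one letter. *)
Lemma act_coassoc (u : tensor_alg HA) g h v :
  sw HA (fun a b => sw HA (fun a1 a2 => act a1 u * act a2 v) a * inH (b * g)) h =
  sw HA (fun a b => act a u * sw HA (fun b1 b2 => act b1 v * inH (b2 * g)) b) h.
Proof.
pose f a b c := act a u * act b v * inH (c * g).
transitivity (sw HA (fun a c => sw HA (fun a1 a2 => f a1 a2 c) a) h).
  by apply: eq_sw => a b; rewrite sw_mull.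
rewrite sw_coassoc => [|b c|a c|a b|r a b c|r a b c].
- by apply: eq_sw => a b; rewrite sw_mulr; apply: eq_sw => c d; rewrite mulrA.
- exact/mul_linl/mul_linl/act_linearl.
- exact/mul_linl/mul_linr/act_linearl.
- exact/mul_linr/inH_linl.
- by rewrite /f act_be act_al !mulrA.
by rewrite /f act_be -[al r * c * g]mulrA -inR_inH !mulrA.
Qed.

(** After moving [r] into the last letter of [u] by [be], the right counit property
    and the Takeuchi condition identify both sides. *)
Lemma act_mulR h u r : act h (u * inR r) = sw HA (fun a b => act a u * act b (inR r)) h.
Proof.
elim/tensor_rcons_ind: u h => [|a x y Ex Ey|r'|w k _] h.
- by rewrite mul0r linear0 /sw big1 // => p _; rewrite linear0 mul0r.
- rewrite mulrDl -scalerAl linearP /= Ex Ey; apply/esym/sw_comb => c d.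
  by rewrite linearP /= mulrDl -scalerAl.
- rewrite -inRM act_inR.
  transitivity (inR (sw HA (fun a b => eps (a * al r') * eps (b * al r)) h)).
    congr inR; have B : bibalanced HA (fun a b => eps (a * al r') * eps b).
      split=> [b|a|s a b].
      - by move=> c x y; rewrite mulrDl -scalerAl linearP mulrDl -scalerAl.
      - by move=> c x y; rewrite linearP mulrDr -scalerAr.
      by rewrite -mulrA epsilon_right epsilon_left mulrA.
    rewrite -(sw_takeuchi r h B).
    transitivity (eps (sw HA (fun a b => be (eps b) * a) h * be r * al r')).
      by rewrite sw_counitr -mulrA -alpha_beta mulrA eps_mul_be rmorphM -!mulrA.
    have lin : linear (fun b => eps (b * be r * al r')).
      by move=> c x y; rewrite !mulrDl -!scalerAl linearP.
    rewrite (sw_raddf HA _ _ lin); apply: eq_sw => a b.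
    by rewrite -!mulrA epsilon_right.
  rewrite (sw_raddf HA _ _ (linearP _)); apply: eq_sw => a b.
  by rewrite /= !act_inR inRM.
rewrite -mulrA inH_inR act_step.
have F p : act p (w * inH k) = sw HA (fun a b => act a w * inH (b * k)) p.
  exact: act_step.
transitivity (sw HA (fun p q =>
    sw HA (fun a b => act a w * inH (b * k) * act q (inR r)) p) h); last first.
  by apply: eq_sw => p q; rewrite F sw_mull.
pose f a b c := act a w * inH (b * k) * act c (inR r).
rewrite (@sw_coassoc _ _ _ HA _ f) => [|b c|a c|a b|s a b c|s a b c].
- apply: eq_sw => a b; rewrite /f; pose m := act a w.
  have B : bibalanced HA (fun p q => be (eps q) * p).
    exact: bibalanced_epsr.
  transitivity (act a w * inH (sw HA (fun p q => be (eps (q * al r)) * p) b * k)).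
    rewrite -(sw_takeuchi r b B); congr (_ * inH _).
    have lin : linear (fun x => x * be r * k).
      by move=> c x y; rewrite !mulrDl -!scalerAl.
    rewrite mulrA -[b in LHS](sw_counitr HA) (sw_raddf HA _ _ lin).
    rewrite /sw mulr_suml; apply: eq_bigr => p _; by rewrite !mulrA.
  rewrite (sw_raddf HA _ _ (@inH_linl _ _ _ HA k)) sw_mulr.
  by apply: eq_sw => p q; rewrite act_inR -[RHS]mulrA inH_inR mulrA.
- exact/mul_linl/mul_linl/act_linearl.
- exact/mul_linl/mul_linr/inH_linl.
- exact/mul_linr/act_linearl.
- by rewrite /f act_be -[al s * b * k]mulrA -inR_inH !mulrA.
by rewrite /f -[be s * b * k]mulrA -inH_inR act_al !mulrA.
Qed.

(** The tensor algebra is a module algebra over [H]: the last letter of [v] is split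
    off by [act_step], and coassociativity reassembles the remaining factors. *)
Lemma act_mul h u v : act h (u * v) = sw HA (fun a b => act a u * act b v) h.
Proof.
elim/tensor_rcons_ind: v h => [|a x y Ex Ey|r|w k IHw] h; last 1 first.
- rewrite mulrA act_step.
  transitivity (sw HA (fun a b =>
      sw HA (fun a1 a2 => act a1 u * act a2 w) a * inH (b * k)) h).
    by apply: eq_sw => a b; rewrite IHw.
  by rewrite act_coassoc; apply: eq_sw => a b; rewrite act_step.
- by rewrite mulr0 linear0 /sw big1 // => p _; rewrite linear0 mulr0.
- rewrite mulrDr -scalerAr linearP /= Ex Ey; apply/esym/sw_comb => c d.
  by rewrite linearP /= mulrDr -scalerAr.
exact: act_mulR.
Qed.

Lemma gr_act i h u : gr i u -> gr i (act h u).
Proof.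
move=> gu; move: i u gu h; apply: gr_ind => [i|i a x y _ _ gx gy|r|i w g _ gw] h.
- by rewrite linear0; apply: gr0.
- by rewrite linearP; apply: gr_lin; [apply: gx | apply: gy].
- by rewrite act_inR; apply: gr_inR.
by rewrite act_step; apply: gr_sum => p _; apply: grM; [apply: gw | apply: gr_inH].
Qed.

Lemma codom_rcons n (u : 'I_n.+1 -> H) :
  codom u = rcons (codom (fun i => u (widen_ord (leqnSn n) i))) (u ord_max).
Proof.
by rewrite /codom /image_mem enum_ordSr map_rcons -map_comp.
Qed.

Lemma codom1 (u : 'I_1 -> H) : codom u = [:: u ord0].
Proof.
apply: (@eq_from_nth _ 0); rewrite ?size_codom ?card_ord // => -[] // _.
exact: (nth_codom_ord u ord0).
Qed.

Lemma codom_cons1 n (u : 'I_n.+1 -> H) : exists g s, codom u = g :: s.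
Proof.
by have := size_codom u; rewrite card_ord; case: (codom u) => // g s _; exists g, s.
Qed.

Lemma tright_rcons n (t : T n.+1) b (u : 'I_n.+2 -> H) :
  dinj (tright (ecast k (T k) (addn1 n.+1) (tcat t (tone al be b))) u) =
  (dinj (tright t (fun i => u (widen_ord (leqnSn n.+1) i))) : tensor_alg HA)
    * inH (b * u ord_max).
Proof.
elim/tpow_ind: t => [|a x y Ex Ey|v].
- rewrite (linear_fun0 (@tcat_linearl _ _ _ _ n.+1 1 _)).
  rewrite (linear_fun0 (@ecast_linear _ _ _ HA _ _ _)).
  by rewrite !(linear_fun0 (@tright_linear _ _ _ HA _ _)) !linear0 mul0r.
- rewrite (@tcat_linearl _ _ _ _ n.+1 1) ecast_linear.
  by rewrite !tright_linear !linearP /= mulrDl -scalerAl Ex Ey.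
pose v' (i : 'I_n.+2) := nth 0 (rcons (codom v) b) i.
have -> : ecast k (T k) (addn1 n.+1) (tcat (tp v) (tone al be b)) = tp v'.
  apply: (@dinj_inj _ T n.+2); rewrite dinj_ecast -(@tensor_mul_inj _ _ _ HA).
  rewrite -inHE -[tensor_mul _ _]/((_ : tensor_alg HA) * _) !word_codom -word_rcons.
  by rewrite codom_nth // size_rcons size_codom card_ord.
rewrite !tright_pure !word_codom -word_rcons codom_rcons; congr (word (rcons _ _)).
  apply: eq_codom => i; congr (_ * _).
  by rewrite /v' nth_rcons size_codom card_ord /= ltn_ord nth_codom_ord.
by rewrite /v' nth_rcons size_codom card_ord ltnn eqxx.
Qed.

Definition iDelta_snoc n (a b : H) : T n.+2 :=
  ecast k (T k) (addn1 n.+1) (tcat (iDelta HA n a) (tone al be b)).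

Lemma iDelta_snocE n a b :
  dinj (iDelta_snoc n a b) = (dinj (iDelta HA n a) : tensor_alg HA) * inH b.
Proof. by rewrite dinj_ecast -(@tensor_mul_inj _ _ _ HA) -inHE. Qed.

Lemma iDelta_bibalanced n :
    (forall h, dinj (iDelta HA n h) = act h (word (nseq n.+1 1))) ->
  bibalanced HA (iDelta_snoc n).
Proof.
move=> E; split=> [b|a|r a b].
- move=> c x y; apply: (@dinj_inj _ T n.+2).
  by rewrite [RHS]linearP /= !iDelta_snocE !E act_linearl mulrDl -scalerAl.
- move=> c x y; apply: (@dinj_inj _ T n.+2).
  by rewrite [RHS]linearP /= !iDelta_snocE linearP mulrDr -scalerAr.
apply: (@dinj_inj _ T n.+2).
by rewrite !iDelta_snocE !E act_be -mulrA inR_inH.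
Qed.

(** The right-hand side is linear and balanced in [h], so the iterated coproduct can
    be fed into the next sum over the coproduct. *)
Lemma iDelta_act n h : dinj (iDelta HA n h) = act h (word (nseq n.+1 1)).
Proof.
elim: n h => [|n IHn] h; first by rewrite /= -inHE act_inH mulr1.
have -> : nseq n.+2 1 = rcons (nseq n.+1 1) 1 :> seq H.
  by rewrite -cats1 -[[:: 1]]/(nseq 1 1) -nseqD addn1.
rewrite word_rcons act_step.
have gB := iDelta_bibalanced IHn.
rewrite [iDelta _ _ _](tlift_sw h gB) (raddf_sum (@dinj _ T n.+2)).
by apply: eq_bigr => p _; rewrite /= mulr1 iDelta_snocE IHn.
Qed.

Lemma act_rev_iDelta n h (u : 'I_n.+1 -> H) :
  dinj (tright (iDelta HA n h) u) = act_rev (rev (codom u)) h.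
Proof.
elim: n h u => [|n IHn] h u.
  rewrite tright_pure word_codom !codom1 -[act_rev _ _]act_word.
  by rewrite -[word [:: u ord0]]/(inH _) act_inH.
rewrite codom_rcons rev_rcons /=; set u' := (fun i => u _).
have gB := iDelta_bibalanced (@iDelta_act n).
rewrite -/(iDelta HA n.+1 h) [iDelta _ _ _](tlift_sw h gB).
rewrite (sw_raddf HA _ _ (@tright_linear _ _ _ HA _ u)) (raddf_sum (@dinj _ T n.+2)).
by apply: eq_bigr => p _; rewrite -IHn; apply: tright_rcons.
Qed.

Lemma act_inW q h (y : T q) : inW (mkhom (hact h y)) = act h (inW (mkhom y)).
Proof.
case: q y => [|q] y; first by rewrite [RHS]act_inR.
rewrite /inW /= /tmul.
have G1 := multilinear_inj (act_rev_iDelta h) (act_rev_linear_word h).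
have G2 := balanced_inj (act_rev_iDelta h) (act_rev_balanced_word h).
elim/tpow_ind: y => [|a x y Ex Ey|v].
- by rewrite (linear_fun0 (tlift_linear (@G1 q) (@G2 q))) !linear0.
- by rewrite (tlift_linear (@G1 q) (@G2 q)) !linearP /= Ex Ey.
rewrite tlift_pure // act_rev_iDelta word_codom.
by have [g [s ->]] := codom_cons1 v; rewrite act_word.
Qed.

Lemma act_11 h : act h (inH 1 * inH 1) = tDelta HA h.
Proof.
by rewrite act_step -sw_tDelta; apply: eq_sw => a b; rewrite act_inH !mulr1.
Qed.

End Action.

(** * Signs *)

Definition oddz (z : int) : bool := odd `|z|%N.

Lemma oddzD x y : oddz (x + y) = oddz x (+) oddz y.
Proof. rewrite /oddz; lia. Qed.
Lemma oddzN x : oddz (- x) = oddz x.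
Proof. by rewrite /oddz abszN. Qed.
Lemma oddzM x y : oddz (x * y) = oddz x && oddz y.
Proof. by rewrite /oddz abszM oddM. Qed.
Lemma oddz_nat (n : nat) : oddz n%:Z = odd n. Proof. by []. Qed.
Lemma oddz0 : oddz 0 = false. Proof. by []. Qed.
Lemma oddz1 : oddz 1 = true. Proof. by []. Qed.
Lemma oddz2 : oddz 2 = false. Proof. by []. Qed.
Definition oddzE := (oddzD, oddzN, oddzM, oddz0, oddz1, oddz2).

Lemma sgnE (K : fieldType) z : sgn K z = (-1) ^+ oddz z.
Proof.
rewrite /sgn signr_odd; case: z => n //=.
by rewrite -[LHS]/((-1) ^- n.+1) -exprVn invrN invr1.
Qed.

Lemma sgn_eq (K : fieldType) x y : oddz x = oddz y -> sgn K x = sgn K y.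
Proof. by rewrite !sgnE => ->. Qed.
Lemma sgnM (K : fieldType) x y : sgn K x * sgn K y = sgn K (x + y).
Proof. by rewrite !sgnE oddzD signr_addb. Qed.
Lemma sgnN (K : fieldType) x : - sgn K x = sgn K (x + 1).
Proof. by rewrite !sgnE oddzD /= addbT signrN. Qed.
Lemma sgn0 (K : fieldType) : sgn K 0 = 1. Proof. by []. Qed.

(** A sign identity reduces to an identity between boolean polynomials in the
    parities of the atoms of the exponents, decided by case analysis. *)
Ltac parities := rewrite ?oddzE;
  repeat (match goal with |- context [oddz ?z] => case: (oddz z) end); by [].
Ltac parity := apply: sgn_eq; parities.

(** * The signed product *)

Section TwistedProduct.
Variables (K : fieldType) (R H : algType K) (HA : hopf_algebroid R H).
Local Notation al := (alpha HA).
Local Notation be := (beta HA).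
Local Notation T := (tpow al be).
Local Notation inH := (@inH K R H HA).
Local Notation inR := (@inR K R H HA).
Local Notation gr := (@dsum_homog K T).
Local Notation sgn := (sgn K).
Implicit Types (r : R) (h g : H) (u v w : tensor_alg HA).

Lemma odd_part_finite (w : dsum T) :
  finitely_supported (fun n => if odd n then w n else 0).
Proof. by have [N wN] := dcoord_finite w; exists N => n /wN->; case: ifP. Qed.
Definition odd_part (w : tensor_alg HA) : tensor_alg HA := DSum (odd_part_finite w).

Lemma odd_part_linear : linear odd_part.
Proof.
move=> a u v; apply: dsumP => n /=; case: ifP => //.
by rewrite scaler0 addr0.
Qed.
HB.instance Definition _ :=
  GRing.isLinear.Build K (tensor_alg HA) (tensor_alg HA) *:%R odd_part odd_part_linear.

Lemma odd_partE i u : gr i u -> odd_part u = if oddz i then u else 0.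
Proof.
move=> gu; apply: dsumP => n /=.
have [<-|ni] := eqVneq n%:Z i; first by rewrite oddz_nat; case: ifP.
by have u0 := gu n ni; do 2![case: ifP => _]; rewrite ?u0.
Qed.

(** For homogeneous arguments this is (-1)^(|u| (|v| - 1)) u v ([smulE]): the sign
    of inserting an element of degree |v| at position |u|.  It differs from u v
    only for odd u and even v, which gives a bilinear formula without degrees. *)
Definition smul u v : tensor_alg HA :=
  locked (u * v - (odd_part u * (v - odd_part v)) *+ 2).
Lemma smul_def u v :
  smul u v = u * v - (odd_part u * (v - odd_part v)) *+ 2.
Proof. by rewrite /smul -lock. Qed.
Local Notation "u *s v" := (smul u v) (at level 40, left associativity).

Lemma smulE i j u v : gr i u -> gr j v -> u *s v = sgn (i * (j - 1)) *: (u * v).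
Proof.
move=> gu gv; rewrite !smul_def (odd_partE gu) (odd_partE gv) sgnE !oddzE addbT.
case: (oddz i); last by rewrite mul0r mul0rn subr0 scale1r.
case: (oddz j); first by rewrite subrr mulr0 mul0rn subr0 scale1r.
by rewrite subr0 mulr2n opprD addrA subrr sub0r scaleN1r.
Qed.

Lemma smul_linearl v : linear (smul^~ v).
Proof.
move=> a x y; rewrite !smul_def !linearP /= !mulrDl mulrnDl -!scalerAl scalerBr.
by rewrite opprD scalerMnr addrACA.
Qed.

Lemma smul_linearr u : linear (smul u).
Proof.
move=> a x y; have E : a *: x + y - odd_part (a *: x + y) =
    a *: (x - odd_part x) + (y - odd_part y).
  by rewrite linearP /= opprD addrACA -scalerBr.
rewrite !smul_def E !(mulrDr _ (a *: _)) mulrnDl -!scalerAr scalerBr.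
by rewrite opprD scalerMnr addrACA.
Qed.

Lemma smul0l v : 0 *s v = 0. Proof. exact: linear_fun0 (smul_linearl v). Qed.
Lemma smul0r u : u *s 0 = 0. Proof. exact: linear_fun0 (smul_linearr u). Qed.
Lemma smulDl u v w : (u + v) *s w = u *s w + v *s w.
Proof. by rewrite -[u in LHS]scale1r smul_linearl scale1r. Qed.
Lemma smulZl a u v : (a *: u) *s v = a *: (u *s v).
Proof. by rewrite -[a *: u]addr0 smul_linearl smul0l addr0. Qed.
Lemma smul_suml I (r : seq I) (P : pred I) F v :
  (\sum_(i <- r | P i) F i) *s v = \sum_(i <- r | P i) F i *s v.
Proof. by elim/big_rec2: _ => [|i x y _ <-]; rewrite ?smul0l ?smulDl. Qed.

Lemma odd_part_mulR u r : odd_part (u * inR r) = odd_part u * inR r.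
Proof.
elim/tensor_homog_ind: u => [|a x y Ex Ey|i u gu]; first by rewrite mul0r !linear0 mul0r.
- by rewrite mulrDl -scalerAl !linearP /= Ex Ey mulrDl -scalerAl.
have gur : gr i (u * inR r) by rewrite -[i]addr0; apply/grM/gr_inR.
by rewrite (odd_partE gu) (odd_partE gur); case: ifP; rewrite ?mul0r.
Qed.

Lemma odd_part_Rmul u r : odd_part (inR r * u) = inR r * odd_part u.
Proof.
elim/tensor_homog_ind: u => [|a x y Ex Ey|i u gu]; first by rewrite mulr0 !linear0 mulr0.
- by rewrite mulrDr -scalerAr !linearP /= Ex Ey mulrDr -scalerAr.
have gur : gr i (inR r * u) by rewrite -[i]add0r; apply: grM => //; apply: gr_inR.
by rewrite (odd_partE gu) (odd_partE gur); case: ifP; rewrite ?mulr0.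
Qed.

Lemma smul_bal u r v : (u * inR r) *s v = u *s (inR r * v).
Proof.
by rewrite !smul_def odd_part_mulR odd_part_Rmul -mulrBr !mulrA.
Qed.

Lemma smul_mulR u r v : u *s (v * inR r) = (u *s v) * inR r.
Proof.
by rewrite !smul_def odd_part_mulR -mulrBl !mulrA mulrBl mulrnAl.
Qed.

Lemma smul1l v : 1 *s v = v.
Proof.
by rewrite !smul_def (odd_partE (gr1 HA)) mul0r mul0rn subr0 mul1r.
Qed.

Lemma smulRl r v : inR r *s v = inR r * v.
Proof. by rewrite -[inR r]mul1r smul_bal smul1l mul1r. Qed.

Lemma gr_smul i j u v : gr i u -> gr j v -> gr (i + j) (u *s v).
Proof. by move=> gu gv; rewrite (smulE gu gv); apply/grZ/grM. Qed.

Lemma odd_part_act h u : odd_part (act h u) = act h (odd_part u).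
Proof.
elim/tensor_homog_ind: u => [|a x y Ex Ey|i u gu]; first by rewrite !linear0.
- by rewrite !linearP /= Ex Ey.
have gau := gr_act h gu.
by rewrite (odd_partE gu) (odd_partE gau); case: ifP; rewrite ?linear0.
Qed.

Lemma act_smul h u v : act h (u *s v) = sw HA (fun a b => act a u *s act b v) h.
Proof.
rewrite !smul_def linearB linearMn /= !act_mul -sumrMnl -sumrB.
by apply: eq_bigr => p _; rewrite smul_def (linearB (act p.2)) /= -!odd_part_act.
Qed.

(** * Braces *)

(** The braces of a word, with the letters and the arguments listed from the last
    to the first. *)
Fixpoint mu_rev (rs : seq H) (rys : seq (tensor_alg HA)) : tensor_alg HA :=
  if rs is h :: rs' then
    mu_rev rs' rys * inH h +
    (if rys is y :: rys' then mu_rev rs' rys' *s act h y else 0)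
  else if rys is [::] then 1 else 0.

Lemma mu_rev_cons h rs rys : mu_rev (h :: rs) rys = mu_rev rs rys * inH h +
  (if rys is y :: rys' then mu_rev rs rys' *s act h y else 0).
Proof. by []. Qed.

Lemma mu_rev_linear_word rys : seq_linear (fun s => mu_rev (rev s) rys).
Proof.
suff key t1 t2 ys : linear (fun a => mu_rev (t1 ++ a :: t2) ys).
  by move=> s1 s2 a x y; rewrite !rev_cat !rev_cons !cat_rcons key.
elim: t1 ys => [|g t1 IHt] ys a x y /=.
  rewrite linearP /= mulrDr -scalerAr; case: ys => [|z ys]; first by rewrite !addr0.
  by rewrite act_linearl smul_linearr scalerDr addrACA.
rewrite IHt mulrDl -scalerAl; case: ys => [|z ys]; first by rewrite !addr0.
by rewrite IHt smul_linearl scalerDr addrACA.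
Qed.

Lemma mu_rev_be r a t ys : mu_rev (be r * a :: t) ys = mu_rev (a :: t) ys * inR r.
Proof.
rewrite /= -inH_inR mulrA mulrDl; congr (_ + _).
case: ys => [|y ys]; first by rewrite mul0r.
by rewrite act_be smul_mulR.
Qed.

(** An element of [R] acting by [be] on the last letter can be moved out to the
    right of the brace ([mu_rev_be]), and from there into the next letter. *)
Lemma mu_rev_balanced_word rys : seq_balanced al be (fun s => mu_rev (rev s) rys).
Proof.
suff key t1 t2 a b r ys :
    mu_rev (t1 ++ b :: be r * a :: t2) ys = mu_rev (t1 ++ al r * b :: a :: t2) ys.
  by move=> s1 s2 a b r; rewrite !rev_cat !rev_cons !cat_rcons key.
elim: t1 ys => [|g t1 IHt] ys; last first.
  by rewrite /= IHt; case: ys => // y ys; rewrite IHt.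
have E zs := mu_rev_be r a t2 zs.
rewrite !cat0s [LHS](mu_rev_cons b (be r * a :: t2)) E.
rewrite [RHS](mu_rev_cons (al r * b) (a :: t2)) -(inR_inH HA r b) mulrA.
case: ys => [|y ys]; first by [].
by rewrite (E ys) smul_bal -(act_al r b y).
Qed.

Definition mu (x : tensor_alg HA) (ys : seq (tensor_alg HA)) : tensor_alg HA :=
  tensor_lift (fun r => if ys is [::] then inR r else 0)
        (fun s => mu_rev (rev s) (rev ys)) x.

Let muR_lin (ys : seq (tensor_alg HA)) : linear (fun r => if ys is [::] then inR r else 0).
Proof.
case: ys => [|y ys]; first exact: linearP.
by move=> a x y'; rewrite scaler0 addr0.
Qed.

Lemma mu_linear ys : linear (mu^~ ys).
Proof.
apply: tensor_lift_linear; first exact: muR_lin.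
  exact: mu_rev_linear_word.
exact: mu_rev_balanced_word.
Qed.

Lemma mu_inR r ys : mu (inR r) ys = if ys is [::] then inR r else 0.
Proof.
apply: tensor_lift_inR; first exact: muR_lin.
  exact: mu_rev_linear_word.
exact: mu_rev_balanced_word.
Qed.

Lemma mu_word h s ys : mu (word HA (h :: s)) ys = mu_rev (rev (h :: s)) (rev ys).
Proof.
apply: tensor_lift_word; first exact: muR_lin.
  exact: mu_rev_linear_word.
exact: mu_rev_balanced_word.
Qed.

Lemma mu0 ys : mu 0 ys = 0. Proof. exact: linear_fun0 (mu_linear ys). Qed.
Lemma muD x y ys : mu (x + y) ys = mu x ys + mu y ys.
Proof. by rewrite -[x in LHS]scale1r mu_linear scale1r. Qed.
Lemma muZ a x ys : mu (a *: x) ys = a *: mu x ys.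
Proof. by rewrite -[a *: x]addr0 mu_linear mu0 addr0. Qed.
Lemma mu_sum I (r : seq I) (P : pred I) F ys :
  mu (\sum_(i <- r | P i) F i) ys = \sum_(i <- r | P i) mu (F i) ys.
Proof. by elim/big_rec2: _ => [|i x y _ <-]; rewrite ?mu0 ?muD. Qed.

Lemma mu_nil_step w h : mu (w * inH h) [::] = mu w [::] * inH h.
Proof.
elim/tensor_ind: w => [|a x y Ex Ey|r|k s].
- by rewrite mul0r !mu0 mul0r.
- by rewrite mulrDl -scalerAl !mu_linear Ex Ey mulrDl -scalerAl.
- rewrite inR_inH mu_inR [LHS]mu_word /= mul1r addr0.
  by rewrite inR_inH.
by rewrite -word_rcons rcons_cons !mu_word -rcons_cons rev_rcons /= addr0.
Qed.

Lemma mu_rcons_step w h ys y : mu (w * inH h) (rcons ys y) =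
  mu w (rcons ys y) * inH h + mu w ys *s act h y.
Proof.
elim/tensor_ind: w => [|a x z Ex Ez|r|k s].
- by rewrite mul0r !mu0 mul0r smul0l addr0.
- rewrite mulrDl -scalerAl !mu_linear Ex Ez mulrDl smul_linearl -scalerAl.
  by rewrite scalerDr addrACA.
- rewrite inR_inH !mu_inR [LHS]mu_word /= rev_rcons mul0r add0r act_al.
  case: ys => [|z ys] /=; first by rewrite mul0r add0r smulRl smul1l.
  rewrite smul0l mul0r addr0; case: (rev (z :: ys)) (size_rev (z :: ys)) => // *.
  exact: smul0l.
by rewrite -word_rcons rcons_cons !mu_word -rcons_cons rev_rcons /= rev_rcons.
Qed.

Lemma mu_nil x : mu x [::] = x.
Proof.
elim/tensor_rcons_ind: x => [|a x y Ex Ey|r|w h IHw]; first exact: mu0.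
- by rewrite mu_linear Ex Ey.
- exact: mu_inR.
by rewrite mu_nil_step IHw.
Qed.

Lemma mu_inR_rcons r ys y : mu (inR r) (rcons ys y) = 0.
Proof. by rewrite mu_inR; case: ys. Qed.

Lemma mu_multilinear x ys1 ys2 : linear (fun y => mu x (ys1 ++ y :: ys2)).
Proof.
elim/tensor_rcons_ind: x ys1 ys2 => [|a x y Ex Ey|r|w h IHw] ys1 ys2.
- by apply: linear_cst0 => y; rewrite mu0.
- by apply: (linear_comb (a := a) (Ex ys1 ys2) (Ey ys1 ys2)) => z; rewrite mu_linear.
- by apply: linear_cst0 => y; rewrite mu_inR; case: ys1.
case/lastP: ys2 => [|ys2 z] c p q.
  rewrite !cats1 !mu_rcons_step -!cats1 IHw linearP /= smul_linearr.
  by rewrite mulrDl -scalerAl scalerDr addrACA.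
rewrite -!rcons_cons -!rcons_cat !mu_rcons_step !rcons_cat !rcons_cons !IHw.
by rewrite mulrDl -scalerAl smul_linearl scalerDr addrACA.
Qed.

End TwistedProduct.

(** * Braces of products *)

Section BraceIdentity.
Variables (K : fieldType) (R H : algType K) (HA : hopf_algebroid R H).
Local Notation T := (tpow (alpha HA) (beta HA)).
Local Notation inH := (@inH K R H HA).
Local Notation inR := (@inR K R H HA).
Local Notation gr := (@dsum_homog K T).
Local Notation sgn := (sgn K).
Local Notation A := (tensor_alg HA).
Local Notation "u *s v" := (smul u v) (at level 40, left associativity).
Implicit Types (r : R) (h g : H) (u v w x a b : A) (ys zs : seq (int * A)).

(** Arguments of braces are carried together with their degrees. *)
Definition homs zs : Prop := forall p, p \in zs -> gr p.1 p.2.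
(** The total degree of the arguments after the shift: y_1[1], ..., y_n[1]. *)
Definition sdeg zs : int := \sum_(p <- zs) (p.1 - 1).

Lemma homs_rcons zs z : homs (rcons zs z) <-> homs zs /\ gr z.1 z.2.
Proof.
split=> [hz|[hz gz] p]; last by rewrite mem_rcons inE => /predU1P[->|/hz].
by split=> [p pz|]; apply: hz; rewrite mem_rcons inE ?pz ?orbT ?eqxx.
Qed.
Lemma homs_take k zs : homs zs -> homs (take k zs).
Proof. by move=> hz p /mem_take/hz. Qed.
Lemma homs_drop k zs : homs zs -> homs (drop k zs).
Proof. by move=> hz p /mem_drop/hz. Qed.

Lemma sdeg_nil : sdeg [::] = 0. Proof. exact: big_nil. Qed.
Lemma sdeg_rcons zs z : sdeg (rcons zs z) = sdeg zs + (z.1 - 1).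
Proof. by rewrite /sdeg -cats1 big_cat big_seq1. Qed.
Lemma sdeg_cat ys zs : sdeg (ys ++ zs) = sdeg ys + sdeg zs.
Proof. exact: big_cat. Qed.

Local Notation el := (@unzip2 int A).

Lemma el_rcons zs z : el (rcons zs z) = rcons (el zs) z.2.
Proof. exact: map_rcons. Qed.

Lemma gr_mu i x zs : gr i x -> homs zs -> gr (i + sdeg zs) (mu x (el zs)).
Proof.
move=> gx; move: i x gx zs; apply: gr_ind => [i|i a x y _ _ gx gy|r|i w h _ gw] zs hz.
- by rewrite mu0; apply: gr0.
- by rewrite mu_linear; apply: gr_lin; [apply: gx | apply: gy].
- rewrite mu_inR; case: zs {hz} => [|z zs] /=; last exact: gr0.
  by rewrite sdeg_nil addr0; apply: gr_inR.
case/lastP: zs hz => [|zs z] hz.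
  by rewrite mu_nil sdeg_nil addr0; apply: grM (gr_inH _ _); rewrite -[w]mu_nil
    -[i]addr0 -sdeg_nil; apply: gw.
have [hzs gz] := (homs_rcons zs z).1 hz.
rewrite el_rcons mu_rcons_step; apply: grD.
  rewrite -el_rcons addrAC; apply: grM (gr_inH _ _); exact: gw.
have -> : i + 1 + sdeg (rcons zs z) = i + sdeg zs + z.1 by rewrite sdeg_rcons; lia.
by apply: gr_smul; [apply: gw | apply: gr_act].
Qed.

Lemma mu_mulR x r (ys : seq A) : mu (x * inR r) ys = mu x ys * inR r.
Proof.
elim/tensor_rcons_ind: x => [|a x y Ex Ey|s|w h _].
- by rewrite mul0r mu0 mul0r.
- by rewrite mulrDl -scalerAl !mu_linear Ex Ey mulrDl -scalerAl.
- by rewrite -inRM !mu_inR; case: ys => [|? ?]; rewrite ?inRM ?mul0r.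
rewrite -mulrA inH_inR; case/lastP: ys => [|ys y].
  by rewrite !mu_nil -mulrA inH_inR.
by rewrite !mu_rcons_step -inH_inR act_be smul_mulR mulrA -mulrDl.
Qed.

(** The arguments inserted into [b] are displaced by the whole degree of the brace
    of [a], which is where the sign comes from. *)
Lemma mu_mul i a j b zs : gr i a -> gr j b -> homs zs ->
  mu (a * b) (el zs) = \sum_(k < (size zs).+1)
    sgn ((i + sdeg (take k zs)) * sdeg (drop k zs)) *:
      (mu a (el (take k zs)) * mu b (el (drop k zs))).
Proof.
move=> ga gb; move: j b gb zs.
apply: gr_ind => [j|j c x y _ _ Ex Ey|r|j w h gw IHw] zs hz.
- rewrite mulr0 mu0 big1 // => k _; by rewrite mu0 mulr0 scaler0.
- rewrite mulrDr -scalerAr mu_linear Ex // Ey // scaler_sumr -big_split.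
  apply: eq_bigr => k _ /=.
  by rewrite mu_linear mulrDr -scalerAr scalerDr !scalerA [c * _]mulrC.
- rewrite mu_mulR big_ord_recr /= take_size drop_size sdeg_nil mulr0 sgn0 scale1r.
  rewrite mu_nil big1 ?add0r // => k _; rewrite mu_inR.
  case E: (drop k zs) => [|z zs'] /=; last by rewrite mulr0 scaler0.
  by have := congr1 size E; rewrite size_drop /=; case: k {E} => k /=; lia.
case/lastP: zs hz => [|zs z] hz.
  by rewrite big_ord1 /= !mu_nil sdeg_nil mulr0 scale1r.
have [hzs gz] := (homs_rcons zs z).1 hz.
rewrite mulrA el_rcons mu_rcons_step -el_rcons IHw // IHw // size_rcons.
rewrite big_ord_recr [in RHS]big_ord_recr /=.
have tE : take (size zs).+1 (rcons zs z) = rcons zs z.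
  by rewrite take_oversize ?size_rcons.
have dE : drop (size zs).+1 (rcons zs z) = [::].
  by rewrite drop_oversize ?size_rcons.
rewrite tE dE sdeg_nil mulr0 sgn0 !scale1r !mu_nil mulrDl mulrA addrAC.
congr (_ + _).
rewrite mulr_suml smul_suml -big_split; apply: eq_bigr => k _ /=.
have lek : (k <= size zs)%N by rewrite -ltnS.
have -> : take k (rcons zs z) = take k zs by rewrite -cats1 takel_cat.
rewrite drop_rcons // el_rcons mu_rcons_step.
rewrite mulrDr scalerDr -scalerAl mulrA -el_rcons; congr (_ + _).
have gA := gr_mu ga (@homs_take k _ hzs); have gB := gr_mu gw (@homs_drop k _ hzs).
have gC := gr_act h gz.
rewrite smulZl (smulE (grM gA gB) gC) (smulE gB gC) -scalerAr mulrA !scalerA.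
rewrite !sgnM sdeg_rcons; congr (_ *: _); parity.
Qed.

Lemma mu_smul i a j b zs : gr i a -> gr j b -> homs zs ->
  mu (a *s b) (el zs) = \sum_(k < (size zs).+1)
    sgn (sdeg (take k zs) * (j - 1)) *:
      (mu a (el (take k zs)) *s mu b (el (drop k zs))).
Proof.
move=> ga gb hz; rewrite (smulE ga gb) muZ (mu_mul ga gb hz) scaler_sumr.
apply: eq_bigr => k _; rewrite scalerA.
have gA := gr_mu ga (@homs_take k _ hz); have gB := gr_mu gb (@homs_drop k _ hz).
by rewrite (smulE gA gB) scalerA !sgnM; congr (_ *: _); parity.
Qed.

(** An argument y enters a letter g as g . y, and h . (g . y) = (h g) . y, so it
    does not matter whether [h] acts before or after the insertion; multiplicativity
    distributes [h] over the letters. *)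
Lemma act_mu h y (zs : seq A) : act h (mu y zs) = mu (act h y) zs.
Proof.
elim/tensor_rcons_ind: y h zs => [|a x y Ex Ey|r|w g IHw] h zs.
- by rewrite mu0 !linear0 mu0.
- by rewrite mu_linear !linearP /= mu_linear Ex Ey.
- by rewrite act_inR !mu_inR; case: zs => [|? ?]; rewrite ?linear0 ?act_inR.
case/lastP: zs => [|zs z]; first by rewrite !mu_nil.
rewrite mu_rcons_step linearD /= act_step act_smul act_step /sw mu_sum.
rewrite -big_split; apply: eq_bigr => p _ /=.
by rewrite mu_rcons_step !IHw act_comp.
Qed.

(** * The brace relation *)

(** The right-hand side of the relation for iterated braces, for an arbitrary
    function [F] of the resulting list of arguments.  The recursion is on the last
    y, which comes first in [rys]: it absorbs the z with numbers i+1, ..., e, those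
    after number e remain, and those up to number i are left to the other y. *)
Fixpoint star (rys zs : seq (int * A)) (F : seq A -> A) : A :=
  if rys is y :: rys' then
    \sum_(e < (size zs).+1) \sum_(i < e.+1)
      sgn ((y.1 - 1) * sdeg (take i zs)) *:
      star rys' (take i zs) (fun s =>
        F (s ++ mu y.2 (el (drop i (take e zs))) :: el (drop e zs)))
  else F (el zs).

Lemma eq_star rys zs F G : (forall s, F s = G s) -> star rys zs F = star rys zs G.
Proof. by move=> FG; congr star; apply: funext. Qed.

Lemma star_raddf (f : A -> A) rys zs F : linear f ->
  f (star rys zs F) = star rys zs (fun s => f (F s)).
Proof.
move=> fl; have fsum I (s : seq I) (G : I -> A) :
    f (\sum_(i <- s) G i) = \sum_(i <- s) f (G i).
  elim: s => [|i s IHs]; first by rewrite !big_nil (linear_fun0 fl).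
  by rewrite !big_cons -[G i]scale1r fl IHs !scale1r.
have fZ c u : f (c *: u) = c *: f u by rewrite -[c *: u]addr0 fl (linear_fun0 fl) addr0.
elim: rys zs F => [|y rys IHr] zs F //=.
rewrite fsum; apply: eq_bigr => e _; rewrite fsum; apply: eq_bigr => i _.
by rewrite fZ IHr.
Qed.

Lemma star_comb rys zs (c : K) F G :
  star rys zs (fun s => c *: F s + G s) = c *: star rys zs F + star rys zs G.
Proof.
elim: rys zs F G => [|y rys IHr] zs F G //=.
rewrite scaler_sumr -big_split; apply: eq_bigr => e _ /=.
rewrite scaler_sumr -big_split; apply: eq_bigr => i _ /=.
by rewrite IHr scalerDr !scalerA mulrC.
Qed.

Lemma star0 rys zs : star rys zs (fun=> 0) = 0.
Proof.
elim: rys zs => [|y rys IHr] zs //=.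
by rewrite big1 // => e _; rewrite big1 // => i _; rewrite IHr scaler0.
Qed.

Lemma starD rys zs F G :
  star rys zs (fun s => F s + G s) = star rys zs F + star rys zs G.
Proof.
rewrite -[star rys zs F]scale1r -star_comb; apply: eq_star => s.
by rewrite scale1r.
Qed.

(** The part of a brace of [w * inH h] in which an argument is inserted into [h]. *)
Definition mu_last w h (s : seq A) : A :=
  if rev s is y :: rs then mu w (rev rs) *s act h y else 0.

Lemma mu_last_rcons w h s y : mu_last w h (rcons s y) = mu w s *s act h y.
Proof. by rewrite /mu_last rev_rcons revK. Qed.

Lemma mu_step w h s : mu (w * inH h) s = mu w s * inH h + mu_last w h s.
Proof.
case/lastP: s => [|s y]; first by rewrite mu_nil_step /mu_last addr0.
by rewrite mu_rcons_step mu_last_rcons.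
Qed.

(** By induction on the last letter [h] of x = w h.  The summands of the right-hand
    side where nothing is inserted into [h] give the claim for [w], multiplied by
    [h].  In the others the last argument is inserted into [h]: it is either the
    last z, which is again the claim for [w], or the last y together with a final
    segment of the z, which matches the braces of a product ([mu_smul]) because
    the action commutes with braces ([act_mu]). *)
Lemma mu_mu_star i x ys zs : gr i x -> homs ys -> homs zs ->
  mu (mu x (el ys)) (el zs) = star (rev ys) zs (mu x).
Proof.
move=> gx; move: i x gx ys zs.
apply: gr_ind => [i|i c x x' _ _ Ex Ey|r|i w h gw IHw] ys zs hy hz.
- rewrite !mu0 (eq_star _ _ (G := fun=> 0)) ?star0 // => s; exact: mu0.
- rewrite !mu_linear Ex // Ey // (eq_star _ _ (fun s => mu_linear s c x x')).
  by rewrite star_comb.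
- case/lastP: ys {hy} => [|ys y]; first by rewrite mu_nil.
  rewrite el_rcons mu_inR_rcons mu0 rev_rcons /= big1 // => e _.
  rewrite big1 // => j _; rewrite (eq_star _ _ (G := fun=> 0)) ?star0 ?scaler0 //.
  by move=> s; rewrite mu_inR; case: s.
case/lastP: ys hy => [|ys y] hy; first by rewrite mu_nil.
have [hys gy] := (homs_rcons ys y).1 hy.
rewrite el_rcons mu_rcons_step -el_rcons muD.
rewrite (mu_smul (gr_mu gw hys) (gr_act h gy) hz).
rewrite (eq_star _ _ (mu_step w h)) starD.
have mull : linear (fun u : A => u * inH h).
  by move=> c u v; rewrite mulrDl -scalerAl.
have smull v : linear (fun u => u *s v) by move=> c u u'; rewrite smul_linearl.
rewrite -(star_raddf _ _ _ mull) -IHw // mu_step -addrA; congr (_ + _).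
rewrite rev_rcons [RHS]/= [RHS]big_ord_recr /=; congr (_ + _); last first.
  apply: eq_bigr => k _; rewrite drop_size take_size.
  rewrite (eq_star _ _ (G := fun s => mu w s *s act h (mu y.2 (el (drop k zs))))).
    rewrite -(star_raddf _ _ _ (smull _)) -IHw ?act_mu //; last exact: homs_take.
    congr (_ *: _); parity.
  by move=> s; rewrite cats1 mu_last_rcons.
case/lastP: zs hz => [|zs z] hz; first by rewrite big_ord0.
have [hzs gz] := (homs_rcons zs z).1 hz.
rewrite (el_rcons zs z) mu_last_rcons IHw // (star_raddf _ _ _ (smull _)) rev_rcons /=.
rewrite size_rcons; apply: eq_bigr => e _; apply: eq_bigr => k _.
have lee : (e <= size zs)%N by rewrite -ltnS.
have lek : (k <= e)%N by rewrite -ltnS.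
rewrite -cats1 !takel_cat ?(leq_trans lek lee) // cats1 drop_rcons //.
congr (_ *: _); apply: eq_star => s.
by rewrite el_rcons -rcons_cons -rcons_cat mu_last_rcons.
Qed.

End BraceIdentity.

(** * The indexing of the brace relation *)

Section BraceSum.
Variables (K : fieldType) (R H : algType K) (HA : hopf_algebroid R H).
Local Notation T := (tpow (alpha HA) (beta HA)).
Local Notation gr := (@dsum_homog K T).
Local Notation sgn := (sgn K).
Local Notation A := (tensor_alg HA).
Local Notation el := (@unzip2 int A).
Local Notation homs := (@homs K R H HA).
Implicit Types (ys zs : seq (int * A)) (ir : seq (nat * nat)).

Lemma nested_le m pos ir : nested m pos ir -> (pos <= m)%N.
Proof.
elim: ir pos => [|[i r] ir IHir] pos //= /andP[le_pos /IHir].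
exact: leq_trans (leq_trans le_pos (leq_addr _ _)).
Qed.

Lemma nested_rcons m pos ir i r :
  nested m pos (rcons ir (i, r)) = nested i pos ir && (i + r <= m)%N.
Proof.
elim: ir pos => [|[j s] ir IHir] pos //=.
by rewrite IHir andbA.
Qed.

Lemma insert_rcons (ys : seq A) y (zs : seq A) pos ir i r :
    size ir = size ys -> nested i pos ir ->
  insert_braces (@mu _ _ _ HA) zs pos (rcons ys y) (rcons ir (i, r)) =
  insert_braces (@mu _ _ _ HA) (take i zs) pos ys ir
    ++ mu y (take r (drop i zs)) :: drop (i + r) zs.
Proof.
elim: ys pos ir => [|y' ys IHys] pos [|[j s] ir] //= => [_ le_pos|[sz] /andP[le_pos ne]].
  by rewrite take_drop subnK.
rewrite IHys // -catA /=; have le_js := nested_le ne.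
have le_ji := leq_trans (leq_addr _ _) le_js.
have -> : take (j - pos) (drop pos zs) = take (j - pos) (drop pos (take i zs)).
  by rewrite !take_drop subnK // take_takel.
have -> // : take s (drop j zs) = take s (drop j (take i zs)).
by rewrite !take_drop take_takel // addnC.
Qed.

(** The exponent of the sign, with |y| + 1 replaced by |y| - 1; the parity is the
    same and the values are degrees after the shift. *)
Fixpoint brace_exp ys zs ir : int :=
  match ys, ir with
  | y :: ys', p :: ir' => (y.1 - 1) * sdeg (take p.1 zs) + brace_exp ys' zs ir'
  | _, _ => 0
  end.

Lemma brace_exp_rcons ys zs y ir p i : size ir = size ys -> nested i 0 ir ->
  brace_exp (rcons ys y) zs (rcons ir p) =
  (y.1 - 1) * sdeg (take p.1 zs) + brace_exp ys (take i zs) ir.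
Proof.
move: {1}0%N => pos.
elim: ys ir pos => [|y' ys IHys] [|[j s] ir] pos //= [sz] /andP[le_pos ne].
rewrite (IHys _ _ sz ne) addrCA; congr (_ + (_ + _)).
have le_js := nested_le ne.
by rewrite take_takel // (leq_trans (leq_addr _ _) le_js).
Qed.

(** An interval is given by its start and length on one side, by its end and start
    on the other. *)
Lemma triangle_sum (V : zmodType) (f : nat -> nat -> V) m M : (m <= M)%N ->
  \sum_(p : 'I_M.+1 * 'I_M.+1 | (p.1 + p.2 <= m)%N) f p.1 p.2 =
  \sum_(e < m.+1) \sum_(i < e.+1) f i (e - i)%N.
Proof.
move=> lemM; rewrite -(pair_big_dep xpredT
  (fun i r : 'I_M.+1 => (i + r <= m)%N) (fun i r => f i r)) /=.
transitivity (\sum_(e < m.+1) \sum_(i < M.+1 | (i < e.+1)%N) f i (e - i)%N);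
    last first.
  apply: eq_bigr => e _.
  rewrite (big_ord_widen M.+1 (fun i => f i (e - i)%N)) //.
  by rewrite ltnS (leq_trans _ lemM) // -ltnS.
rewrite [RHS](exchange_big_dep xpredT) //=; apply: eq_bigr => i _.
have [le_im|lt_mi] := leqP i m; last first.
  rewrite !big_pred0 // => [e|r].
    by have := ltn_ord e; lia.
  by rewrite leqNgt (leq_trans lt_mi) // leq_addr.
rewrite -(big_mkord (fun e => i < e.+1)%N (fun e => f i (e - i)%N)).
rewrite (@big_cat_nat _ _ _ i) //=; last exact: leqW.
rewrite big_nat_cond [X in _ = X + _]big_pred0 ?add0r; last first.
  by move=> e; lia.
transitivity (\sum_(0 <= r < m.+1 - i) f i r); last first.
  rewrite -[RHS]/(\sum_(0 + i <= e < m.+1 | (i < e.+1)%N) f i (e - i)%N).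
  rewrite [RHS]big_addn.
  by apply: eq_big => [r|r _]; rewrite ?ltnS ?leq_addl ?addnK.
have lew : (m.+1 - i <= M.+1)%N by rewrite (leq_trans (leq_subr _ _)).
rewrite big_mkord (big_ord_widen M.+1 (fun r => f i r) lew).
by apply: eq_bigl => r; rewrite ltn_subRL ltnS.
Qed.

Definition irs M n (ir : n.-tuple ('I_M.+1 * 'I_M.+1)) : seq (nat * nat) :=
  [seq (nat_of_ord p.1, nat_of_ord p.2) | p <- ir].

(** The type of the tuples depends on the bound [M], which therefore stays fixed
    while the induction replaces [zs] by its initial segments. *)
Lemma tuple_sum_star M ys zs (F : seq A -> A) : (size zs <= M)%N ->
  \sum_(ir : (size ys).-tuple ('I_M.+1 * 'I_M.+1) | nested (size zs) 0 (irs ir))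
     sgn (brace_exp ys zs (irs ir)) *:
     F (insert_braces (@mu _ _ _ HA) (el zs) 0 (el ys) (irs ir))
  = star (rev ys) zs F.
Proof.
elim/last_ind: ys zs F => [|ys y IHys] zs F leM.
  rewrite (big_pred1 [tuple]) => [|t]; last by rewrite [t]tuple0 /= eqxx.
  by rewrite /= drop0 sgn0 scale1r.
rewrite size_rcons rev_rcons /=.
pose n := size ys; pose I := ('I_M.+1 * 'I_M.+1)%type.
pose glue (q : n.-tuple I * I) : n.+1.-tuple I := [tuple of rcons q.1 q.2].
have glue_bij : bijective glue.
  apply: inj_card_bij; last by rewrite card_prod !card_tuple expnSr.
  move=> [t p] [t' p'] /(congr1 val)/= /rcons_inj[tt' ->].
  by congr (_, _); apply: val_inj.
rewrite (reindex glue) /=; last exact: onW_bij.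
pose f i r := sgn ((y.1 - 1) * sdeg (take i zs)) *:
  star (rev ys) (take i zs) (fun s =>
    F (s ++ mu y.2 (el (drop i (take (i + r) zs))) :: el (drop (i + r) zs))).
transitivity (\sum_(p : I | (p.1 + p.2 <= size zs)%N) f p.1 p.2); last first.
  rewrite (triangle_sum f) //; apply: eq_bigr => e _; apply: eq_bigr => i _.
  by rewrite /f subnKC // -ltnS.
rewrite (eq_bigl (fun q : n.-tuple I * I =>
   nested q.2.1 0 (irs q.1) && (q.2.1 + q.2.2 <= size zs)%N)); last first.
  by case=> t [i r]; rewrite /irs /= map_rcons nested_rcons.
rewrite -(pair_big_dep xpredT (fun (t : n.-tuple I) (p : I) => nested p.1 0 (irs t) &&
  (p.1 + p.2 <= size zs)%N)
  (fun t p => sgn (brace_exp (rcons ys y) zs (irs (glue (t, p)))) *: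
   F (insert_braces (@mu _ _ _ HA) (el zs) 0 (el (rcons ys y)) (irs (glue (t, p)))))) /=.
rewrite (exchange_big_dep (fun p : I => (p.1 + p.2 <= size zs)%N)) /=; last first.
  by move=> t p _ /andP[].
apply: eq_bigr => -[i r] /= le_irm.
have le_im := leq_trans (leq_addr _ _) le_irm.
have szi : size (take i zs) = i by rewrite size_takel.
rewrite /f -IHys; last by rewrite szi -ltnS.
rewrite scaler_sumr szi; apply: eq_big => [t|t]; first by rewrite le_irm andbT.
case/andP=> ne _; rewrite scalerA sgnM.
have szt : size (irs t) = size ys by rewrite size_map size_tuple.
have -> : irs (glue (t, (i, r))) = rcons (irs t) (nat_of_ord i, nat_of_ord r).
  by rewrite /irs /= map_rcons.
rewrite (brace_exp_rcons _ _ _ szt ne) el_rcons insert_rcons ?size_map ?size_tuple //.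
rewrite /unzip2 -!map_take -!map_drop -map_take take_drop.
by rewrite [(r + i)%N]addnC.
Qed.

Lemma has_degreesP es (ys : seq A) : has_degrees gr es ys ->
  exists zs, [/\ es = unzip1 zs, ys = el zs & homs zs].
Proof.
case=> sz gy; exists (zip es ys); rewrite unzip1_zip ?unzip2_zip ?sz //; split=> //.
move=> p /(nthP (0, 0))[i]; rewrite size_zip sz minnn => lti <-.
by rewrite nth_zip // ; apply: gy.
Qed.

Lemma shifted_degS es k :
  shifted_deg es k.+1 = shifted_deg es k + (nth 0 es k + 1).
Proof. exact: big_ord_recr. Qed.

Lemma oddz_shifted zs k : (k <= size zs)%N ->
  oddz (shifted_deg (unzip1 zs) k) = oddz (sdeg (take k zs)).
Proof.
elim: k => [|k IHk] lek; first by rewrite /shifted_deg big_ord0 take0 sdeg_nil.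
rewrite shifted_degS (take_nth (0, 0)) // sdeg_rcons !oddzD (IHk (ltnW lek)).
by rewrite (nth_map (0, 0)).
Qed.

Lemma brace_brace_hopf dx (x : A) es (ys : seq A) fs (zs : seq A) :
    gr dx x -> has_degrees gr es ys -> has_degrees gr fs zs ->
    let n := size ys in let m := size zs in
    mu (mu x ys) zs =
    \sum_(ir : n.-tuple ('I_m.+1 * 'I_m.+1) | nested m 0 (irs ir))
      sgn (\sum_(p < n) (nth 0 es p + 1) * shifted_deg fs (tnth ir p).1) *:
      mu x (insert_braces (@mu _ _ _ HA) zs 0 ys (irs ir)).
Proof.
move=> gx /has_degreesP[yd [-> -> hy]] /has_degreesP[zd [-> -> hz]] /=.
rewrite (mu_mu_star gx hy hz) !size_map.
rewrite -(tuple_sum_star _ _ (leqnn (size zd))).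
apply: eq_bigr => ir ne; congr (_ *: _); apply: sgn_eq.
move: ir ne; rewrite /irs => ir ne.
have key (s : seq ('I_(size zd).+1 * 'I_(size zd).+1)) (yt : seq (int * A)) :
    size s = size yt -> oddz (brace_exp yt zd
      [seq (nat_of_ord p.1, nat_of_ord p.2) | p <- s]) =
    oddz (\sum_(p < size yt) (nth 0 (unzip1 yt) p + 1) *
       shifted_deg (unzip1 zd) (nth (ord0, ord0) s p).1).
  elim: s yt => [|q s IHs] [|y yt] //= => [_|[sz]]; first by rewrite big_ord0.
  rewrite big_ord_recl /= !oddzD (IHs _ sz) !oddzM !oddzD.
  by rewrite oddz_shifted // -ltnS.
rewrite key ?size_tuple //; congr oddz; apply: eq_bigr => p _.
by rewrite (tnth_nth (ord0, ord0)).
Qed.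

End BraceSum.

(** * The differential and the cup product *)

Section Differential.
Variables (K : fieldType) (R H : algType K) (HA : hopf_algebroid R H).
Local Notation T := (tpow (alpha HA) (beta HA)).
Local Notation inH := (@inH K R H HA).
Local Notation gr := (@dsum_homog K T).
Local Notation sgn := (sgn K).
Local Notation A := (tensor_alg HA).
Local Notation el := (@unzip2 int A).
Local Notation homs := (@homs K R H HA).
Local Notation odd_part := (@odd_part K R H HA).
Local Notation "u *s v" := (smul u v) (at level 40, left associativity).
Implicit Types (x y z u v w : A) (ys zs : seq (int * A)).

Lemma scale_sgnN (c : int) u : - (sgn c *: u) = sgn (c + 1) *: u.
Proof. by rewrite -scaleNr sgnN. Qed.

Definition mul2 : A := inH 1 * inH 1.
Local Notation M := mul2.

Lemma gr_mul2 : gr 2 M. Proof. exact: grM (gr_inH _ _) (gr_inH _ _). Qed.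

Lemma mu1_cons y (ys : seq A) : mu (1 : A) (y :: ys) = 0.
Proof. by rewrite -inR1 mu_inR. Qed.

Lemma mu_inH1 h y : mu (inH h) [:: y] = act h y.
Proof.
by rewrite -[inH h]mul1r -[[:: y]]/(rcons [::] y) mu_rcons_step mu1_cons mul0r
  add0r mu_nil smul1l.
Qed.

Lemma mu_too_many i x (ys : seq A) : gr i x -> i < (size ys)%:Z -> mu x ys = 0.
Proof.
move=> gx; move: i x gx ys.
apply: gr_ind => [i|i c x y _ _ Ex Ey|r|i w h _ IHw] ys lti.
- exact: mu0.
- by rewrite mu_linear Ex // Ey // scaler0 addr0.
- by rewrite mu_inR; case: ys lti.
case/lastP: ys lti => [|ys y]; rewrite ?size_rcons => lti.
  by rewrite mu_nil_step IHw ?mul0r //; lia.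
by rewrite mu_rcons_step !IHw ?mul0r ?smul0l ?addr0 // ?size_rcons; lia.
Qed.

Lemma mu_mul2_1 x : mu M [:: x] = x * inH 1 + inH 1 *s x.
Proof.
by rewrite -[[:: x]]/(rcons [::] x) mu_rcons_step mu_inH1 mu_nil !act_id.
Qed.

Lemma mu_mul2_2 x y : mu M [:: x; y] = x *s y.
Proof.
rewrite -[[:: x; y]]/(rcons [:: x] y) mu_rcons_step mu_inH1 !act_id.
by rewrite (mu_too_many (gr_inH _ _)) ?mul0r ?add0r.
Qed.

Lemma mu_mul2_3 (ys : seq A) : (2 < size ys)%N -> mu M ys = 0.
Proof. by move=> lts; apply: (mu_too_many gr_mul2); rewrite ltz_nat. Qed.

Lemma mu_mul2_mul2 : mu M [:: M] = 0.
Proof.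
rewrite mu_mul2_1 (smulE (gr_inH HA 1) gr_mul2) mulrA.
by rewrite -[sgn _]/(-1 : K) scaleN1r subrr.
Qed.

Lemma homs1 i x : gr i x -> homs [:: (i, x)].
Proof. by move=> gx p; rewrite inE => /eqP->. Qed.

Lemma mu_insert0 x (s t : seq A) : mu x (s ++ 0 :: t) = 0.
Proof. exact: linear_fun0 (mu_multilinear x s t). Qed.

Lemma mu_insertD x (s t : seq A) u c v : mu x (s ++ u + c *: v :: t) =
  mu x (s ++ u :: t) + c *: mu x (s ++ v :: t).
Proof. by rewrite [u + _]addrC [RHS]addrC; apply: (mu_multilinear x s t). Qed.

(** The relation for iterated braces with one argument each time: z goes after y,
    into y, or before y. *)
Lemma mu1_mu1 i x j y k z : gr i x -> gr j y -> gr k z ->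
  mu (mu x [:: y]) [:: z] = mu x [:: y; z] + mu x [:: mu y [:: z]]
    + sgn ((j - 1) * (k - 1)) *: mu x [:: z; y].
Proof.
move=> gx gy gz; have := mu_mu_star gx (homs1 gy) (homs1 gz).
rewrite /= => ->; rewrite !big_ord_recr !big_ord0 /= !add0r.
rewrite /sdeg !big_cons !big_nil /= !mu_nil mulr0 sgn0 !scale1r !addr0 addrA.
by [].
Qed.

(** On a homogeneous element the second term is (-1)^|x| x{M}, see [cobar_dE]. *)
Definition cobar_d (x : A) : A := mu M [:: x] + mu (x - odd_part x *+ 2) [:: M].
(** On homogeneous elements this is (-1)^(|x| |y|) x y, see [cupE]. *)
Definition cup (x y : A) : A :=
  locked (x * y - (odd_part x * odd_part y) *+ 2).
Lemma cup_def x y : cup x y = x * y - (odd_part x * odd_part y) *+ 2.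
Proof. by rewrite /cup -lock. Qed.

Lemma cobar_dE i x : gr i x -> cobar_d x = mu M [:: x] + sgn i *: mu x [:: M].
Proof.
move=> gx; rewrite /cobar_d (odd_partE gx) sgnE -muZ; congr (_ + mu _ _).
case: (oddz i); last by rewrite mul0rn subr0 scale1r.
by rewrite mulr2n opprD addrA subrr sub0r scaleN1r.
Qed.

Lemma cupE i j x y : gr i x -> gr j y -> cup x y = sgn (i * j) *: (x * y).
Proof.
move=> gx gy; rewrite !cup_def (odd_partE gx) (odd_partE gy) sgnE oddzM.
case: (oddz i); last by rewrite mul0r mul0rn subr0 scale1r.
case: (oddz j); last by rewrite mulr0 mul0rn subr0 scale1r.
by rewrite mulr2n opprD addrA subrr sub0r scaleN1r.
Qed.

Lemma cup_linearl y : linear (cup^~ y).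
Proof.
move=> a x z; rewrite !cup_def linearP /= !mulrDl -!scalerAl mulrnDl opprD addrACA.
by rewrite scalerBr scalerMnr.
Qed.
Lemma cup_linearr x : linear (cup x).
Proof.
move=> a y z; rewrite !cup_def linearP /= !mulrDr -!scalerAr mulrnDl opprD addrACA.
by rewrite scalerBr scalerMnr.
Qed.

Lemma smul_cup i x y : gr i x -> x *s y = sgn i *: cup x y.
Proof.
move=> gx; elim/tensor_homog_ind: y => [|a u v Eu Ev|j u gu].
- by rewrite smul0r (linear_fun0 (cup_linearr x)) scaler0.
- by rewrite smul_linearr cup_linearr Eu Ev scalerDr !scalerA mulrC.
rewrite (smulE gx gu) (cupE gx gu) scalerA sgnM; congr (_ *: _); parity.
Qed.

Lemma mu1_linear x a y z :
  mu x [:: a *: y + z] = a *: mu x [:: y] + mu x [:: z].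
Proof. exact: (mu_multilinear x [::] [::]). Qed.

Lemma cobar_d_linear : linear cobar_d.
Proof.
have mlin : linear (fun x => x - odd_part x *+ 2).
  move=> a x y; rewrite linearP /= mulrnDl opprD addrACA scalerBr.
  by rewrite scalerMnr.
move=> a x y; rewrite /cobar_d mlin mu_linear.
by rewrite mu1_linear scalerDr addrACA.
Qed.

Lemma cobar_dZ a x : cobar_d (a *: x) = a *: cobar_d x.
Proof. by rewrite -[a *: x]addr0 cobar_d_linear (linear_fun0 cobar_d_linear) addr0. Qed.

Lemma gr_cobar_d i x : gr i x -> gr (i + 1) (cobar_d x).
Proof.
move=> gx; rewrite (cobar_dE gx); apply: grD.
  have := gr_mu gr_mul2 (homs1 gx); rewrite /sdeg big_seq1 /=.
  by have -> : 2 + (i - 1) = i + 1 by lia.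
apply: grZ; have := gr_mu gx (homs1 gr_mul2); rewrite /sdeg big_seq1 /=.
by [].
Qed.

Lemma gr_cup i j x y : gr i x -> gr j y -> gr (i + j) (cup x y).
Proof. by move=> gx gy; rewrite (cupE gx gy); apply/grZ/grM. Qed.

(** Write s = (-1)^|x|.  The relation for iterated braces gives x{M}{M} = 0, since
    its two terms x{M, M} have opposite signs and M{M} = 0.  So
    d(dx) = M{M{x}} + s M{x{M}} - s M{x}{M} = M{M{x}} - s M{x, M} + M{M, x},
    which is the expansion of M{M}{x} = 0. *)
Lemma cobar_d_square x : cobar_d (cobar_d x) = 0.
Proof.
elim/tensor_homog_ind: x => [|a x y Ex Ey|i x gx].
- by rewrite !(linear_fun0 cobar_d_linear).
- by rewrite !cobar_d_linear Ex Ey scaler0 addr0.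
have gM := gr_mul2.
have E1 := mu1_mu1 gM gM gx; have E2 := mu1_mu1 gM gx gM.
have E3 := mu1_mu1 gx gM gM.
move: E1 E3; rewrite mu_mul2_mul2 mu0 (mu_insert0 x [::] [::]) addr0.
rewrite [sgn ((2 - 1) * (2 - 1))]/(-1 : K) scaleN1r subrr -addrA addrCA.
move=> /esym/eqP; rewrite addr_eq0 => /eqP E1 E3.
have -> : cobar_d (cobar_d x) = mu M [:: cobar_d x] + sgn (i + 1) *: mu (cobar_d x) [:: M].
  exact: cobar_dE (gr_cobar_d gx).
rewrite (cobar_dE gx) ![_ + sgn i *: _]addrC mu1_linear mu_linear E2 E3 scaler0.
rewrite add0r E1 !sgnE !oddzE; case: (oddz i); rewrite /= ?scaleN1r ?scale1r.
  apply/eqP; rewrite -opprD addr_eq0 eqr_opp; apply/eqP.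
  by rewrite [RHS]addrC [LHS]addrC addrA.
apply/eqP; rewrite subr_eq0 opprB addrA; apply/eqP; congr (_ - _).
exact: addrC.
Qed.

Lemma cobar_d_cup i j x y : gr i x -> gr j y ->
  cobar_d (cup x y) = cup (cobar_d x) y + sgn i *: cup x (cobar_d y).
Proof.
move=> gx gy; have gxy := gr_cup gx gy; have gM := gr_mul2.
have gM1 k z : gr k z -> mu M [:: z] = z * inH 1 + sgn (k - 1) *: (inH 1 * z).
  move=> gz; rewrite mu_mul2_1 (smulE (gr_inH _ _) gz).
  by congr (_ + _ *: _); rewrite mul1r.
have E : mu (x * y) [:: M] = sgn i *: (x * mu y [:: M]) + mu x [:: M] * y.
  have := mu_mul gx gy (homs1 gM); rewrite /= => ->.
  rewrite !big_ord_recr big_ord0 /= add0r /sdeg !big_cons !big_nil !mu_nil.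
  rewrite mulr0 sgn0 scale1r; congr (_ *: _ + _); parity.
rewrite (cupE (gr_cobar_d gx) gy) (cupE gx (gr_cobar_d gy)) (cupE gx gy).
rewrite (cobar_dZ) (cobar_dE (grM gx gy)) (cobar_dE gx) (cobar_dE gy) (gM1 _ _ (grM gx gy)).
rewrite (gM1 _ _ gx) (gM1 _ _ gy) E !(mulrDl, mulrDr).
rewrite -!(scalerAl, scalerAr) !(scalerDr, scalerA, sgnM) !mulrA.
rewrite [RHS](AC (3*3) ((1*5)*((4*2)*(6*3)))).
rewrite /= -[X in _ = X + _]scalerDl.
have -> : sgn (i * j + 1 * j) + sgn (i + (i * j + i * 1) + (j - 1)) = 0.
  rewrite -[X in _ + X]opprK sgnN; apply/eqP; rewrite subr_eq0; apply/eqP.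
  parity.
rewrite scale0r add0r; congr (_ + _ + (_ + _)); congr (_ *: _); parity.
Qed.

Lemma cupA : associative cup.
Proof.
move=> x y z; elim/tensor_homog_ind: x => [|a u v Eu Ev|i x gx].
- by rewrite !(linear_fun0 (cup_linearl _)).
- by rewrite !cup_linearl Eu Ev.
elim/tensor_homog_ind: y => [|a u v Eu Ev|j y gy].
- by rewrite (linear_fun0 (cup_linearl _)) !(linear_fun0 (cup_linearr _))
    (linear_fun0 (cup_linearl _)).
- by rewrite cup_linearl !cup_linearr Eu Ev cup_linearl.
elim/tensor_homog_ind: z => [|a u v Eu Ev|k z gz].
- by rewrite !(linear_fun0 (cup_linearr _)).
- by rewrite !cup_linearr Eu Ev.
rewrite (cupE gx (gr_cup gy gz)) (cupE (gr_cup gx gy) gz) (cupE gx gy) (cupE gy gz).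
by rewrite -scalerAl -scalerAr !scalerA !sgnM mulrA; congr (_ *: _); parity.
Qed.

Lemma mu_cup i1 x1 i2 x2 es (ys : seq A) :
    gr i1 x1 -> gr i2 x2 -> has_degrees gr es ys ->
  mu (cup x1 x2) ys = \sum_(k < (size ys).+1) sgn (i2 * shifted_deg es k) *:
    cup (mu x1 (take k ys)) (mu x2 (drop k ys)).
Proof.
move=> g1 g2 /has_degreesP[zs [-> -> hz]].
rewrite (cupE g1 g2) muZ (mu_mul g1 g2 hz) scaler_sumr size_map.
apply: eq_bigr => k _; rewrite -map_take -map_drop.
have gt := gr_mu g1 (@homs_take _ _ _ HA k _ hz).
have gd := gr_mu g2 (@homs_drop _ _ _ HA k _ hz).
rewrite (cupE gt gd) !scalerA !sgnM; congr (_ *: _); apply: sgn_eq.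
rewrite !oddzE oddz_shifted -1?ltnS //.
parities.
Qed.

(** * The differential of a brace *)

(** An operation on at most two arguments receives a composite argument together
    with the arguments outside the interval from i to e.  At most one of those is
    left outside, at the start or at the end. *)
Lemma triangle_sum_corner (f : nat -> nat -> A) n :
    (forall i e, (i <= e)%N -> (e <= n.+1)%N -> (1 < i + (n.+1 - e))%N -> f i e = 0) ->
  \sum_(e < n.+2) \sum_(i < e.+1) f i e = f 0%N n.+1 + f 0%N n + f 1%N n.+1.
Proof.
move=> f0; rewrite big_ord_recr big_ord_recr /= big1 ?add0r; last first.
  move=> e _; rewrite big1 // => i _.
  by apply: f0; have := ltn_ord e; have := ltn_ord i; lia.
rewrite [\sum_(i < n.+1) _]big_ord_recl big1 /= ?addr0; last first.
  by move=> i _; apply: f0; rewrite /bump /=; have := ltn_ord i; lia.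
rewrite !big_ord_recl big1 /= ?addr0; last first.
  by move=> i _; apply: f0; rewrite /bump /=; have := ltn_ord i; lia.
by rewrite addrCA addrA.
Qed.

Lemma mu_mul2_sum a x zs (z : int * A) : gr a x -> homs (rcons zs z) ->
  mu (mu M [:: x]) (el (rcons zs z)) = mu M [:: mu x (el (rcons zs z))]
   + mu x (el zs) *s z.2
   + sgn ((a - 1) * sdeg (take 1 (rcons zs z))) *:
     (nth 0 (el (rcons zs z)) 0 *s mu x (behead (el (rcons zs z)))).
Proof.
move=> gx hz; have := mu_mu_star gr_mul2 (homs1 gx) hz; rewrite /= => ->.
set ws := rcons zs z; have sz : size ws = (size zs).+1 by rewrite size_rcons.
pose f i e := sgn ((a - 1) * sdeg (take i ws)) *:
  mu M (el (take i ws) ++ mu x (el (drop i (take e ws))) :: el (drop e ws)).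
rewrite sz (triangle_sum_corner (f := f)) => [|i e le_ie le_en lt1]; last first.
  rewrite /f mu_mul2_3 ?scaler0 // size_cat /= !size_map size_drop size_takel sz; lia.
rewrite /f -sz /= !(take0, drop_size, take_size, drop0) sdeg_nil mulr0 sgn0 !scale1r.
have -> : take (size zs) ws = zs by rewrite /ws -cats1 take_size_cat.
have -> : drop (size zs) ws = [:: z] by rewrite /ws -cats1 drop_size_cat.
rewrite /= mu_mul2_2; congr (_ + _ + _ *: _).
by rewrite /ws; case: (zs) => [|y t]; rewrite /= ?take0 ?drop0 /= mu_mul2_2.
Qed.

(** The pairs that survive when at most two consecutive arguments are absorbed. *)
Lemma triangle_sum_band (f : nat -> nat -> A) n :
    (forall i e, (i.+2 < e)%N -> (e <= n)%N -> f i e = 0) ->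
  \sum_(e < n.+1) \sum_(i < e.+1) f i e = \sum_(i < n.+1) f i i +
    \sum_(i < n) f i i.+1 + \sum_(i < n.-1) f i i.+2.
Proof.
move=> f0; pose g1 e := if e is e'.+1 then f e' e else 0.
pose g2 e := if e is e'.+2 then f e' e else 0.
transitivity (\sum_(e < n.+1) (f e e + g1 e + g2 e)).
  apply: eq_bigr => -[e /= lt_en] _; rewrite big_ord_recr /= -addrA addrC.
  congr (_ + _); case: e lt_en => [|e] lt_en; first by rewrite big_ord0 addr0.
  rewrite big_ord_recr /= addrC; congr (_ + _).
  case: e lt_en => [|e] lt_en; first by rewrite big_ord0.
  rewrite big_ord_recr /= big1 ?add0r // => i _.
  by apply: f0; [exact: ltn_ord | exact: lt_en].
rewrite !big_split /=; congr (_ + _ + _).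
  by rewrite big_ord_recl /= add0r; apply: eq_bigr.
rewrite big_ord_recl /= add0r; case: n {f0} => [|n]; first by rewrite !big_ord0.
by rewrite big_ord_recl /= add0r; apply: eq_bigr.
Qed.

(** Here [M] is the y of the relation, so it absorbs none, one or two of the
    consecutive arguments. *)
Lemma mu_mul2_insert a x zs : gr a x -> homs zs ->
  mu (mu x [:: M]) (el zs) =
    \sum_(i < (size zs).+1) sgn (sdeg (take i zs)) *:
        mu x (take i (el zs) ++ M :: drop i (el zs))
  + \sum_(i < size zs) sgn (sdeg (take i zs)) *:
        mu x (take i (el zs) ++ mu M [:: nth 0 (el zs) i] :: drop i.+1 (el zs))
  + \sum_(i < (size zs).-1) sgn (sdeg (take i zs)) *:
        mu x (take i (el zs) ++ (nth 0 (el zs) i *s nth 0 (el zs) i.+1)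
           :: drop i.+2 (el zs)).
Proof.
move=> gx hz; have := mu_mu_star gx (homs1 gr_mul2) hz; rewrite /= => ->.
pose f i e := sgn (sdeg (take i zs)) *:
  mu x (take i (el zs) ++ mu M (drop i (take e (el zs))) :: drop e (el zs)).
transitivity (\sum_(e < (size zs).+1) \sum_(i < e.+1) f i e).
  apply: eq_bigr => e _; apply: eq_bigr => i _; rewrite /f.
  rewrite /unzip2 !map_drop !map_take; congr (_ *: _); parity.
rewrite (triangle_sum_band (f := f)) => [|i e lt_ie le_e]; last first.
  rewrite /f mu_mul2_3 ?mu_insert0 ?scaler0 //.
  rewrite size_drop size_takel ?size_map //; lia.
have sz : size (el zs) = size zs by rewrite size_map.
have dt i k : (i + k <= size zs)%N ->
    drop i (take (i + k) (el zs)) = take k (drop i (el zs)).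
  by move=> _; rewrite take_drop addnC.
congr (_ + _ + _); apply: eq_bigr => -[i /= lti] _; rewrite /f.
- by have := dt i 0%N; rewrite addn0 take0 => ->; rewrite ?mu_nil.
- have := dt i 1%N; rewrite addn1 => -> //.
  by rewrite (drop_nth 0) ?sz // /= take0.
have := dt i 2%N; rewrite addn2 => ->; last by lia.
rewrite (drop_nth 0) ?sz; last by lia.
rewrite (drop_nth 0 (n := i.+1)) ?sz; last by lia.
by rewrite /= take0 mu_mul2_2.
Qed.

Lemma star_nil ys F : star (rev ys) [::] F = F (el ys).
Proof.
elim/last_ind: ys F => [|ys y IHys] F //.
rewrite rev_rcons /= !big_ord1 sdeg_nil mulr0 sgn0 scale1r IHys el_rcons mu_nil.
by rewrite -cats1.
Qed.

Lemma star_one (y : int * A) ys (z : int * A) F : star (y :: rev ys) [:: z] F =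
  F (el ys ++ [:: y.2; z.2]) + F (el ys ++ [:: mu y.2 [:: z.2]]) +
  sgn ((y.1 - 1) * (z.1 - 1)) *: star (rev ys) [:: z] (fun s => F (s ++ [:: y.2])).
Proof.
rewrite /= !big_ord_recr !big_ord0 /= !add0r !star_nil sdeg_nil mulr0 sgn0 !scale1r.
by rewrite mu_nil /sdeg big_seq1 addrA.
Qed.

(** The single argument [M] either stands between two arguments or is inserted
    into one of them. *)
Lemma star_mul2 zs F : star (rev zs) [:: (2 : int, M)] F =
    \sum_(i < (size zs).+1) sgn (sdeg (drop i zs)) *:
        F (take i (el zs) ++ M :: drop i (el zs))
  + \sum_(i < size zs) sgn (sdeg (drop i.+1 zs)) *:
        F (take i (el zs) ++ mu (nth 0 (el zs) i) [:: M] :: drop i.+1 (el zs)).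
Proof.
elim/last_ind: zs F => [|zs z IHzs] F.
  by rewrite big_ord1 big_ord0 addr0 /= sdeg_nil sgn0 scale1r.
have sz : size (el zs) = size zs by rewrite size_map.
rewrite rev_rcons star_one IHzs size_rcons [_.2]/=.
have -> : sgn ((z.1 - 1) * ((2 : int, M).1 - 1)) = sgn (z.1 - 1) by parity.
have tn : take (size zs) (el (rcons zs z)) = el zs.
  by rewrite el_rcons -cats1 -sz take_size_cat.
have dn : drop (size zs).+1 (el (rcons zs z)) = [::].
  by rewrite drop_oversize // size_map size_rcons.
have dn' : drop (size zs).+1 (rcons zs z) = [::].
  by rewrite drop_oversize // size_rcons.
rewrite [X in _ = X + _]big_ord_recr [X in _ = _ + X]big_ord_recr /=.
rewrite dn dn' tn sdeg_nil sgn0 !scale1r.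
have -> : nth 0 (el (rcons zs z)) (size zs) = z.2.
  by rewrite el_rcons nth_rcons sz ltnn eqxx.
have -> : take (size zs).+1 (el (rcons zs z)) ++ [:: M] = el zs ++ [:: z.2; M].
  by rewrite take_oversize ?size_map ?size_rcons // el_rcons cat_rcons.
have sdeg_drop i : (i <= size zs)%N ->
    sgn (sdeg (drop i (rcons zs z))) = sgn (z.1 - 1) * sgn (sdeg (drop i zs)).
  by move=> le_i; rewrite drop_rcons // sdeg_rcons sgnM addrC.
have eld i : (i <= size zs)%N ->
    drop i (el (rcons zs z)) = drop i (el zs) ++ [:: z.2].
  by move=> le_i; rewrite el_rcons drop_rcons ?sz // cats1.
have elt i : (i <= size zs)%N -> take i (el (rcons zs z)) = take i (el zs).
  by move=> le_i; rewrite el_rcons -cats1 takel_cat ?sz.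
rewrite scalerDr !scaler_sumr addrACA; congr (_ + _); rewrite addrC.
  congr (_ + _); apply: eq_bigr => -[i lti] _ /=.
  by rewrite scalerA sdeg_drop // eld // elt // -catA.
congr (_ + _); apply: eq_bigr => -[i lti] _ /=.
rewrite scalerA sdeg_drop // eld // elt ?(ltnW lti) // -catA el_rcons nth_rcons sz lti.
by [].
Qed.

Lemma mu_insert_mul2 a x zs : gr a x -> homs zs -> mu (mu x (el zs)) [:: M] =
    \sum_(i < (size zs).+1) sgn (sdeg (drop i zs)) *:
        mu x (take i (el zs) ++ M :: drop i (el zs))
  + \sum_(i < size zs) sgn (sdeg (drop i.+1 zs)) *:
        mu x (take i (el zs) ++ mu (nth 0 (el zs) i) [:: M] :: drop i.+1 (el zs)).
Proof.
by move=> gx hz; rewrite -star_mul2; apply: mu_mu_star gx hz (homs1 gr_mul2).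
Qed.

(** All differentials are expressed by braces with [M].  The terms with [M] between
    two arguments of x cancel, and so do the terms with a y_i{M} and with an M{y_i},
    against the differentials of the y_i.  What is left are the products of
    adjacent arguments, and the products of the first and of the last argument with
    the rest of the brace. *)
Lemma mu_cobar_d dx x es (ys : seq A) : gr dx x -> has_degrees gr es ys ->
    (0 < size ys)%N -> let n := size ys in
  cobar_d (mu x ys) - mu (cobar_d x) ys
      - \sum_(i < n) sgn (dx + 1 + shifted_deg es i) *:
          mu x (take i ys ++ cobar_d (nth 0 ys i) :: drop i.+1 ys)
    = sgn (dx * (nth 0 es 0 + 1)) *: cup (nth 0 ys 0) (mu x (behead ys))
      - \sum_(i < n.-1) sgn (dx + 1 + shifted_deg es i.+1) *:
          mu x (take i ys ++ cup (nth 0 ys i) (nth 0 ys i.+1) :: drop i.+2 ys)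
      + sgn (dx + 1 + shifted_deg es n.-1) *:
          cup (mu x (take n.-1 ys)) (nth 0 ys n.-1).
Proof.
move=> gx /has_degreesP[zs [-> -> hz]]; rewrite size_map => n0 /=.
have nthz i : (i < size zs)%N -> gr (nth 0 (unzip1 zs) i) (nth 0 (el zs) i).
  move=> lti; rewrite !(nth_map (0, 0)) //; exact/hz/mem_nth.
have sdeg_split k : sdeg zs = sdeg (take k zs) + sdeg (drop k zs).
  by rewrite -sdeg_cat cat_take_drop.
have sh k : (k <= size zs)%N ->
    oddz (shifted_deg (unzip1 zs) k) = oddz (sdeg (take k zs)).
  exact: oddz_shifted.
have sdegS k : (k < size zs)%N -> oddz (sdeg (drop k zs)) =
    ~~ oddz (nth 0 (unzip1 zs) k) (+) oddz (sdeg (drop k.+1 zs)).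
  move=> ltk; rewrite (drop_nth (0, 0)) // /sdeg big_cons -/(sdeg _) oddzD.
  by rewrite (nth_map (0, 0)) // oddzD addbT.
rewrite (cobar_dE (gr_mu gx hz)) (cobar_dE gx) muD muZ.
rewrite (mu_insert_mul2 gx hz) (mu_mul2_insert gx hz) !scalerDr.
set P0 := mu M _.
pose S1 := \sum_(i < size zs) sgn (dx + 1 + shifted_deg (unzip1 zs) i) *:
  mu x (take i (el zs) ++ mu M [:: nth 0 (el zs) i] :: drop i.+1 (el zs)).
pose SZ := \sum_(i < size zs) sgn (dx + 1 + shifted_deg (unzip1 zs) i) *:
  (sgn (nth 0 (unzip1 zs) i) *:
  mu x (take i (el zs) ++ mu (nth 0 (el zs) i) [:: M] :: drop i.+1 (el zs))).
have -> : \sum_(i < size zs) sgn (dx + 1 + shifted_deg (unzip1 zs) i) *: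
    mu x (take i (el zs) ++ cobar_d (nth 0 (el zs) i) :: drop i.+1 (el zs)) = S1 + SZ.
  rewrite -big_split; apply: eq_bigr => -[i lti] _ /=.
  by rewrite (cobar_dE (nthz i lti)) mu_insertD scalerDr.
have sgnT u b c : oddz b = oddz c -> sgn b *: u = sgn c *: u.
  by move=> /sgn_eq ->.
have -> : sgn (dx + sdeg zs) *: (\sum_(i < (size zs).+1) sgn (sdeg (drop i zs)) *:
       mu x (take i (el zs) ++ M :: drop i (el zs))) =
    sgn dx *: (\sum_(i < (size zs).+1) sgn (sdeg (take i zs)) *:
       mu x (take i (el zs) ++ M :: drop i (el zs))).
  rewrite !scaler_sumr; apply: eq_bigr => i _; rewrite !scalerA !sgnM.
  by apply: sgnT; rewrite (sdeg_split i) !oddzD -!addbA addbb addbF.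
set SM := sgn dx *: _.
have -> : sgn (dx + sdeg zs) *: (\sum_(i < size zs) sgn (sdeg (drop i.+1 zs)) *:
    mu x (take i (el zs) ++ mu (nth 0 (el zs) i) [:: M] :: drop i.+1 (el zs))) = SZ.
  rewrite scaler_sumr; apply: eq_bigr => -[i lti] _; rewrite !scalerA !sgnM /=.
  apply: sgnT; rewrite (sdeg_split i) !oddzD sh ?(ltnW lti) // (sdegS i lti) oddz1.
  parities.
have -> : sgn dx *: (\sum_(i < size zs) sgn (sdeg (take i zs)) *:
    mu x (take i (el zs) ++ mu M [:: nth 0 (el zs) i] :: drop i.+1 (el zs))) = - S1.
  rewrite scaler_sumr -sumrN; apply: eq_bigr => -[i lti] _ /=.
  rewrite scalerA sgnM scale_sgnN; apply: sgnT; rewrite !oddzD sh ?(ltnW lti) //.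
  parities.
set S2 := \sum_(i < (size zs).-1) sgn (_ + shifted_deg _ _) *: _.
have -> : sgn dx *: (\sum_(i < (size zs).-1) sgn (sdeg (take i zs)) *:
    mu x (take i (el zs) ++ (nth 0 (el zs) i *s nth 0 (el zs) i.+1)
       :: drop i.+2 (el zs))) = S2.
  rewrite scaler_sumr; apply: eq_bigr => -[i lti] _ /=.
  have lti' : (i < size zs)%N by lia.
  rewrite (smul_cup _ (nthz i lti')).
  have muZi c u : mu x (take i (el zs) ++ c *: u :: drop i.+2 (el zs)) =
      c *: mu x (take i (el zs) ++ u :: drop i.+2 (el zs)).
    by rewrite -[c *: u]add0r mu_insertD mu_insert0 add0r.
  rewrite muZi !scalerA !sgnM; apply: sgnT.
  rewrite shifted_degS !oddzD sh ?(ltnW lti') // oddz1.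
  parities.
case/lastP: zs hz n0 nthz sdeg_split sh sdegS @P0 @S1 @SZ @SM @S2 => [|zs z] hz //.
move=> _ nthz sdeg_split sh _ P0 S1 SZ SM S2.
rewrite (mu_mul2_sum gx hz) -/P0.
have [hzs gz] := (homs_rcons zs z).1 hz.
set P1 := mu x (el zs) *s z.2; set Q := sgn _ *: _.
have -> : sgn (dx * (nth 0 (unzip1 (rcons zs z)) 0 + 1)) *:
    cup (nth 0 (el (rcons zs z)) 0) (mu x (behead (el (rcons zs z)))) = - Q.
  rewrite /Q (smul_cup _ (nthz 0%N _)) ?size_rcons // scalerA sgnM scale_sgnN.
  apply: sgnT; rewrite (take_nth (0, 0)) ?size_rcons // take0 sdeg_rcons sdeg_nil.
  rewrite (nth_map (0, 0)) ?size_rcons // !oddzE.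
  parities.
have -> : sgn (dx + 1 + shifted_deg (unzip1 (rcons zs z)) (size (rcons zs z)).-1) *:
    cup (mu x (take (size (rcons zs z)).-1 (el (rcons zs z))))
      (nth 0 (el (rcons zs z)) (size (rcons zs z)).-1) = - P1.
  rewrite /P1 (smul_cup _ (gr_mu gx hzs)) scale_sgnN size_rcons [_.-1]/=.
  have sz : size (el zs) = size zs by rewrite size_map.
  have tz (U : Type) (s : seq U) (t : U) : take (size s) (rcons s t) = s.
    by rewrite -cats1 take_size_cat.
  rewrite !el_rcons nth_rcons sz ltnn eqxx -[in take _ _]sz tz.
  apply: sgnT; rewrite !oddzD sh ?size_rcons // tz oddz1.
  parities.
clearbody P0 S1 SZ SM S2 P1 Q.
apply/eqP; rewrite -addrA -opprD subr_eq; apply/eqP.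
rewrite [RHS](AC (3*((3*3)*2)) (((1*6)*(2*9)*(3*5)*(8*10)) * (4*(7*11)))) /=.
by rewrite !addNr !add0r.
Qed.

End Differential.

(** * Braces of pure tensors *)

Definition incr k p (j : {ffun 'I_k -> 'I_p}) : bool :=
  [forall l : 'I_k, forall l' : 'I_k, (l < l')%N ==> (j l < j l')%N].

Lemma incrP k p (j : {ffun 'I_k -> 'I_p}) :
  reflect (forall l l' : 'I_k, (l < l')%N -> (j l < j l')%N) (incr j).
Proof.
apply: (iffP forallP) => [jP l l' lt_l|jP l].
  by have /forallP/(_ l')/implyP := jP l; apply.
by apply/forallP => l'; apply/implyP; apply: jP.
Qed.

Lemma incr_inj k p (j : {ffun 'I_k -> 'I_p}) : incr j -> injective j.
Proof.
move=> /incrP jP l l' jl; apply: val_inj.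
by case: (ltngtP l l') => // /jP; rewrite jl ltnn.
Qed.

Definition slot k p (j : {ffun 'I_k -> 'I_p}) (i : 'I_p) : option 'I_k :=
  [pick l | j l == i].

Lemma slot_some k p (j : {ffun 'I_k -> 'I_p}) l i :
  incr j -> j l = i -> slot j i = Some l.
Proof.
move=> /incr_inj ji jl; rewrite /slot; case: pickP => [l' /eqP|/(_ l)].
  by rewrite -jl => /ji->.
by rewrite jl eqxx.
Qed.

Lemma slot_none k p (j : {ffun 'I_k -> 'I_p}) i :
  (forall l, j l != i) -> slot j i = None.
Proof. by move=> jl; rewrite /slot; case: pickP => // l /eqP jli; case/eqP: (jl l). Qed.

Lemma slotP k p (j : {ffun 'I_k -> 'I_p}) i :
  (exists2 l, j l = i & slot j i = Some l) \/ ((forall l, j l != i) /\ slot j i = None).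
Proof.
rewrite /slot; case: pickP => [l /eqP jl|jl]; first by left; exists l.
by right; split=> // l; rewrite jl.
Qed.

Definition widen1 p : 'I_p -> 'I_p.+1 := widen_ord (leqnSn p).

Definition shift_out k p (j : {ffun 'I_k -> 'I_p}) : {ffun 'I_k -> 'I_p.+1} :=
  [ffun l => widen1 (j l)].

Definition shift_in k p (j : {ffun 'I_k -> 'I_p}) : {ffun 'I_k.+1 -> 'I_p.+1} :=
  [ffun l => if unlift ord_max l is Some l' then widen1 (j l') else ord_max].

Lemma unlift_widen1 k (l : 'I_k) : unlift ord_max (widen1 l) = Some l.
Proof.
have -> : widen1 l = fintype.lift ord_max l.
  by apply: val_inj; rewrite /= /bump leqNgt ltn_ord.
exact: liftK.
Qed.

Lemma shift_in_widen1 k p (j : {ffun 'I_k -> 'I_p}) l :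
  shift_in j (widen1 l) = widen1 (j l).
Proof. by rewrite ffunE unlift_widen1. Qed.
Lemma shift_in_max k p (j : {ffun 'I_k -> 'I_p}) : shift_in j ord_max = ord_max.
Proof. by rewrite ffunE unlift_none. Qed.

Lemma widen1_inj k : injective (@widen1 k).
Proof. by move=> l l' /(congr1 val)/= /val_inj. Qed.

Lemma ord_max_or_widen1 k (l : 'I_k.+1) : l = ord_max \/ exists l', l = widen1 l'.
Proof.
have [ltl|] := ltnP l k; first by right; exists (Ordinal ltl); apply: val_inj.
by move=> lekl; left; apply: val_inj; apply/eqP; rewrite eqn_leq lekl -ltnS ltn_ord.
Qed.

Lemma incr_shift_out k p (j : {ffun 'I_k -> 'I_p}) : incr (shift_out j) = incr j.
Proof. by apply: eq_forallb => l; apply: eq_forallb => l'; rewrite !ffunE. Qed.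

Lemma incr_shift_in k p (j : {ffun 'I_k -> 'I_p}) : incr (shift_in j) = incr j.
Proof.
apply/incrP/incrP => jP l l' lt_l.
  by have := jP (widen1 l) (widen1 l') lt_l; rewrite !shift_in_widen1.
have [l'E|[m' l'E]] := ord_max_or_widen1 l'; have [lE|[m lE]] := ord_max_or_widen1 l.
- by move: lt_l; rewrite l'E lE ltnn.
- by rewrite l'E lE shift_in_max shift_in_widen1 /=.
- by move: lt_l; rewrite l'E lE /= ltnNge ltnW.
by rewrite l'E lE !shift_in_widen1; apply: jP; move: lt_l; rewrite lE l'E.
Qed.

Lemma sum_injection (V : nmodType) (I J : finType) (h : J -> I) (P : pred I) (Q : pred J)
    (G : I -> V) :
    injective h -> (forall j, Q j -> P (h j)) ->
    (forall i, P i -> exists2 j, Q j & h j = i) ->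
  \sum_(i | P i) G i = \sum_(j | Q j) G (h j).
Proof.
move=> inj QP PQ; rewrite -(big_imset (h := h) (A := Q) G); last exact: in2W.
apply: eq_bigl => i; apply/idP/imsetP => [/PQ[j Qj <-]|[j Qj ->]]; last exact: QP.
by exists j.
Qed.

Section IncreasingSums.
Variables (V : nmodType) (p : nat).

Lemma sum_incr0 (G : {ffun 'I_0 -> 'I_p} -> V) (j0 : {ffun 'I_0 -> 'I_p}) :
  \sum_(j | incr j) G j = G j0.
Proof.
rewrite (big_pred1 j0) // => j.
have -> : j = j0 by apply/ffunP => -[].
by rewrite /= eqxx; apply/incrP => -[].
Qed.

Lemma sum_incr_empty k (G : {ffun 'I_k.+1 -> 'I_0} -> V) :
  \sum_(j | incr j) G j = 0.
Proof. by apply: big1 => j; case: (j ord0). Qed.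

(** An increasing map either avoids the last slot or sends the last index to it. *)
Lemma sum_incrS k (G : {ffun 'I_k.+1 -> 'I_p.+1} -> V) :
  \sum_(j | incr j) G j = \sum_(j | incr j) G (shift_out j)
    + \sum_(j | incr j) G (shift_in j).
Proof.
rewrite (bigID (fun j : {ffun 'I_k.+1 -> 'I_p.+1} => j ord_max != ord_max)) /=.
congr (_ + _); apply: sum_injection.
- move=> j j' /ffunP E; apply/ffunP => l; apply: widen1_inj.
  by have := E l; rewrite !ffunE.
- move=> j jP; rewrite incr_shift_out jP /= ffunE -val_eqE /=.
  by rewrite neq_ltn ltn_ord.
- move=> j /andP[/incrP jP jm].
  have ltj l : (j l < p)%N.
    have ltm : (j ord_max < p)%N.
      by rewrite ltn_neqAle -ltnS ltn_ord andbT; apply: contra jm.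
    have [->//|[l' ->]] := ord_max_or_widen1 l.
    by apply: ltn_trans ltm; apply: jP; rewrite /= ltn_ord.
  pose j' := [ffun l => Ordinal (ltj l)].
  have j'E : shift_out j' = j.
    by apply/ffunP => l; rewrite !ffunE; apply: val_inj.
  by exists j' => //; rewrite -incr_shift_out j'E; apply/incrP.
- move=> j j' E; apply/ffunP => l; apply: widen1_inj.
  by rewrite -!shift_in_widen1 E.
- by move=> j jP; rewrite incr_shift_in jP shift_in_max eqxx.
move=> j /andP[/incrP jP /negPn/eqP jm].
have ltj (l : 'I_k) : (j (widen1 l) < p)%N.
  by have := jP (widen1 l) ord_max; rewrite jm /= ltn_ord; apply.
pose j' := [ffun l => Ordinal (ltj l)].
have j'E : shift_in j' = j.
  apply/ffunP => l; have [->|[l' ->]] := ord_max_or_widen1 l.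
    by rewrite shift_in_max jm.
  by rewrite shift_in_widen1 ffunE; apply: val_inj.
by exists j' => //; rewrite -incr_shift_in j'E; apply/incrP.
Qed.

End IncreasingSums.

Section BraceFormula.
Variables (K : fieldType) (R H : algType K) (HA : hopf_algebroid R H).
Local Notation T := (tpow (alpha HA) (beta HA)).
Local Notation inH := (@inH K R H HA).
Local Notation inR := (@inR K R H HA).
Local Notation gr := (@dsum_homog K T).
Local Notation sgn := (sgn K).
Local Notation A := (tensor_alg HA).

(** The summand of the braces of a pure tensor for the choice [j] of slots. *)
Definition slot_term k p (x : 'I_p -> H) (Y : 'I_k -> A)
    (j : {ffun 'I_k -> 'I_p}) : A :=
  \prod_(i < p) (if slot j i is Some l then act (x i) (Y l) else inH (x i)).

Definition slot_exp k p (q : 'I_k -> nat) (j : {ffun 'I_k -> 'I_p}) : int :=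
  \sum_(l < k) ((j l)%:Z - l%:Z + \sum_(l' < k | (l' < l)%N) (q l')%:Z)
     * ((q l)%:Z - 1).

Lemma gr_prod p (x : 'I_p -> H) : gr p%:Z (\prod_(i < p) inH (x i) : A).
Proof.
elim: p x => [|p IHp] x; first by rewrite big_ord0; apply: gr1.
have -> : p.+1%:Z = p%:Z + 1 by lia.
by rewrite big_ord_recr; apply: grM (gr_inH _ _).
Qed.

Lemma gr_mu_enum i (w : A) k (q : 'I_k -> nat) (Y : 'I_k -> A) :
    gr i w -> (forall l, gr (q l)%:Z (Y l)) ->
  gr (i + \sum_(l < k) ((q l)%:Z - 1)) (mu w [seq Y l | l <- enum 'I_k]).
Proof.
move=> gw gY; have := gr_mu gw (zs := [seq ((q l)%:Z, Y l) | l <- enum 'I_k]).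
rewrite /sdeg big_map big_enum /unzip2 -map_comp /=; apply.
by move=> z /mapP[l _ ->]; apply: gY.
Qed.

Lemma slot_shift_out k p (j : {ffun 'I_k -> 'I_p}) i :
  slot (shift_out j) (widen1 i) = slot j i.
Proof. by apply: eq_pick => l; rewrite /= ffunE (inj_eq (@widen1_inj p)). Qed.

Lemma slot_shift_out_max k p (j : {ffun 'I_k -> 'I_p}) :
  slot (shift_out j) ord_max = None.
Proof.
apply: slot_none => l; rewrite ffunE -val_eqE /=.
by rewrite neq_ltn ltn_ord.
Qed.

(** Avoiding and using the last slot are the two terms of the recursion for the
    braces.  In the second one the last argument is inserted at the position
    p - k + q_1 + ... + q_k, the degree of the brace in front of it. *)
Lemma mu_prod p (x : 'I_p -> H) k (q : 'I_k -> nat) (Y : 'I_k -> A) :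
    (forall l, gr (q l)%:Z (Y l)) ->
  mu (\prod_(i < p) inH (x i)) [seq Y l | l <- enum 'I_k] =
  \sum_(j : {ffun 'I_k -> 'I_p} | incr j) sgn (slot_exp q j) *: slot_term x Y j.
Proof.
elim: p x k q Y => [|p IHp] x [|k] q Y gY.
- rewrite enum_ord0 mu_nil (sum_incr0 _ (finfun (fun l : 'I_0 => l))).
  by rewrite /slot_exp /slot_term !big_ord0 scale1r.
- rewrite sum_incr_empty enum_ordSr map_rcons big_ord0 -[1]inR1.
  exact: mu_inR_rcons.
- have f0 : {ffun 'I_0 -> 'I_p.+1} by apply: finfun => -[].
  rewrite enum_ord0 mu_nil (sum_incr0 _ f0) /slot_exp big_ord0 scale1r.
  by apply: eq_bigr => i _; rewrite slot_none // => -[].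
rewrite big_ord_recr /= enum_ordSr map_rcons mu_rcons_step sum_incrS.
set w := \prod_(i < p) _.
have gw : gr p%:Z w by apply: gr_prod.
congr (_ + _).
  have := IHp (fun i => x (widen1 i)) _ _ _ gY; rewrite -/w enum_ordSr map_rcons.
  move=> ->; rewrite mulr_suml; apply: eq_bigr => j _.
  rewrite -scalerAl; congr (sgn _ *: _).
    by apply: eq_bigr => l _; rewrite ffunE.
  rewrite /slot_term big_ord_recr /= slot_shift_out_max; congr (_ * _).
  by apply: eq_bigr => i _; rewrite slot_shift_out.
rewrite -map_comp.
pose q' l := q (widen1 l); pose Y' l := Y (widen1 l).
have gY' l : gr (q' l)%:Z (Y' l) by apply: gY.
rewrite [[seq _ | _ <- _]](_ : _ = [seq Y' l | l <- enum 'I_k]) //.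
rewrite (smulE (gr_mu_enum gw gY') (gr_act _ (gY _))).
rewrite (IHp (fun i => x (widen1 i)) _ _ _ gY') mulr_suml scaler_sumr.
apply: eq_bigr => j jP.
rewrite -scalerAl scalerA sgnM; congr (_ *: _); last first.
  rewrite /slot_term big_ord_recr /=.
  rewrite (@slot_some _ _ _ ord_max) ?incr_shift_in ?shift_in_max //.
  congr (_ * _); apply: eq_bigr => i _.
  have [[l jl sl]|[jl sl]] := slotP j i.
    by rewrite sl (@slot_some _ _ _ (widen1 l)) ?incr_shift_in // shift_in_widen1 jl.
  rewrite sl slot_none // => l; have [->|[l' ->]] := ord_max_or_widen1 l.
    by rewrite shift_in_max -val_eqE /= neq_ltn ltn_ord orbT.
  by rewrite shift_in_widen1 (inj_eq (@widen1_inj p)).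
congr sgn; rewrite /slot_exp big_ord_recr /= addrC; congr (_ + _); last first.
  apply: eq_bigr => l _; rewrite -/(widen1 l) shift_in_widen1; congr ((_ + _) * _).
  rewrite big_mkcond [RHS]big_mkcond big_ord_recr /=.
  by rewrite [X in _ = _ + X]ifN ?addr0 // -leqNgt ltnW.
rewrite shift_in_max /=; congr (_ * _).
rewrite [in RHS]big_mkcond big_ord_recr /= ltnn addr0.
rewrite sumrB sumr_const card_ord addrA addrAC natz; congr (_ + _).
by apply: eq_bigr => l _; rewrite ltn_ord.
Qed.

Lemma cobar_d_inR r : cobar_d (inR r) = inR r * inH 1 - inH 1 * inR r.
Proof.
rewrite (cobar_dE (gr_inR HA r)) mu_inR scaler0 addr0 mu_mul2_1.
rewrite (smulE (gr_inH HA 1) (gr_inR HA r)); congr (_ + _).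
by rewrite sgnE !oddzE /= scaleN1r.
Qed.

Lemma cobar_d_prod n (x : 'I_n -> H) : let xs := \prod_(j < n) inH (x j) : A in
  cobar_d xs = xs * inH 1
    - \sum_(i < n) sgn (n%:Z - (i.+1)%:Z) *:
        (\prod_(j < n) (if j == i then tDelta HA (x j) else inH (x j)))
    - sgn n%:Z *: (inH 1 * xs).
Proof.
move=> xs; have gxs : gr n%:Z xs := gr_prod x.
rewrite (cobar_dE gxs) mu_mul2_1 (smulE (gr_inH HA 1) gxs) -addrA -[RHS]addrA.
congr (_ + _); rewrite [RHS]addrC scale_sgnN; congr (_ + _).
  by congr (_ *: _); parity.
have E : mu xs [:: mul2 HA] = \sum_(i < n) sgn i%:Z *:
    (\prod_(j < n) (if j == i then tDelta HA (x j) else inH (x j))).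
  rewrite /xs; elim: n x {xs gxs} => [|n IHn] x.
    by rewrite !big_ord0 -inR1 mu_inR.
  rewrite big_ord_recr -[[:: _]]/(rcons [::] _) mu_rcons_step IHn mu_nil.
  rewrite act_11 [RHS]big_ord_recr; congr (_ + _).
    rewrite mulr_suml; apply: eq_bigr => i _.
    rewrite -scalerAl big_ord_recr /= -val_eqE /=.
    by rewrite [in RHS]ifN // neq_ltn ltn_ord orbT.
  have gw := gr_prod (fun i => x (widen_ord (leqnSn n) i)).
  have gD : gr 2 (tDelta HA (x ord_max)) by apply: gr_inj.
  rewrite (smulE gw gD) big_ord_recr /= eqxx; congr (_ *: (_ * _)).
    by parity.
  by apply: eq_bigr => i _; rewrite -val_eqE /= ifN // neq_ltn ltn_ord.
rewrite E scaler_sumr -sumrN; apply: eq_bigr => i _.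
rewrite scalerA sgnM scale_sgnN; congr (_ *: _); apply: sgn_eq.
by rewrite -addn1 PoszD !oddzE; case: (oddz n%:Z); case: (oddz i%:Z).
Qed.

End BraceFormula.

(** * The brace algebra *)

Section Main.
Variables (K : fieldType) (R H : algType K) (HA : hopf_algebroid R H).
Local Notation T := (tpow (alpha HA) (beta HA)).
Local Notation A := (tensor_alg HA).

Lemma inW_word n (x : 'I_n -> H) :
  inW (\big[@hcat K R H HA/hone HA]_(j < n) in_H HA (x j)) =
  \prod_(j < n) inH HA (x j) :> A.
Proof. by rewrite inW_prod; apply: eq_bigr => j _; rewrite inW_inH. Qed.

Lemma cobar_d_is_hopf_differential : is_hopf_differential (@cobar_d K R H HA).
Proof.
split=> [r|n x xs].
  rewrite !inW_hcat inW_inH inW_inR; exact: cobar_d_inR.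
have xsE : inW xs = \prod_(j < n) inH HA (x j) :> A := inW_word x.
rewrite !inW_hcat !inW_inH xsE cobar_d_prod; congr (_ - _ - _).
apply: eq_bigr => i _; congr (_ *: _); rewrite inW_prod.
by apply: eq_bigr => j _; case: ifP => _ //; rewrite inW_inH.
Qed.

Lemma cup_is_hopf_cup : is_hopf_cup (@cup K R H HA).
Proof.
move=> n m x y; rewrite inW_hcat; apply: cupE.
  exact: (@gr_inj K T n).
exact: (@gr_inj K T m).
Qed.

Lemma mu_is_hopf_brace : is_hopf_brace (@mu K R H HA).
Proof.
split=> [r|p x k q y lekp|p x ys ltp _].
- exact: mu_nil.
- rewrite inW_word.
  have gY l : dsum_homog (q l)%:Z (inW (mkhom (y l))) by apply: gr_inj.
  rewrite (mu_prod x gY); apply: eq_bigr => j _; congr (_ *: _).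
  rewrite inW_prod; apply: eq_bigr => i _; rewrite /slot.
  by case: pickP => [l _|_]; rewrite ?act_inW ?inW_inH.
by apply: (mu_too_many (@gr_inj K T p x)); rewrite ltz_nat.
Qed.

Lemma brace_Binfty_hopf :
  brace_Binfty_algebra (@WH_homog K R H HA) (@cobar_d K R H HA) (@cup K R H HA)
    (@mu K R H HA).
Proof.
split.
- exact: dsum_grading.
- exact: cobar_d_linear.
- exact: gr_cobar_d.
- exact: cup_linearl.
- exact: cup_linearr.
- exact: gr_cup.
- exact: mu_linear.
- exact: mu_multilinear.
- move=> i x es ys gx /has_degreesP[zs [-> -> hz]].
  by rewrite /unzip1 big_map; apply: gr_mu.
- exact: mu_nil.
- exact: brace_brace_hopf.
- exact: cobar_d_square.
- exact: cobar_d_cup.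
- exact: cupA.
- exact: mu_cup.
exact: mu_cobar_d.
Qed.
End Main.

Theorem theorem1 (K : fieldType) (charK0 : [pchar K] =i pred0)
    (R H : algType K) (HA : hopf_algebroid R H) :
  exists (delta : WH HA -> WH HA) (cup : WH HA -> WH HA -> WH HA)
         (mu : WH HA -> seq (WH HA) -> WH HA),
    [/\ is_hopf_differential delta,
        is_hopf_cup cup,
        is_hopf_brace mu
      & brace_Binfty_algebra (@WH_homog K R H HA) delta cup mu].
Proof.
exists (@cobar_d K R H HA), (@cup K R H HA), (@mu K R H HA); split.
- exact: cobar_d_is_hopf_differential.
- exact: cup_is_hopf_cup.
- exact: mu_is_hopf_brace.
exact: brace_Binfty_hopf.
Qed.
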